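(* Let $R$ be an indecomposable reduced commutative ring with unit and let $E$ be a directed graph with associated path groupoid $\mathscr G_E$ and Leavitt path algebra $L_R(E)$. (Ungraded version.) Let $\mathscr G$ be any ample Hausdorff groupoid. Then the following are equivalent. (1) There is an isomorphism $\varphi\colon \mathscr G_E\to \mathscr G$ of topological groupoids. (2) There is a diagonal-preserving isomorphism $\Phi\colon L_R(E)\to R\mathscr G$ of $R$-algebras. (3) There is a diagonal-preserving isomorphism $\Phi\colon L_R(E)\to R\mathscr G$ of rings. (Graded version.) Let $\mathscr G$ be any ample Hausdorff $\mathbb Z$-graded groupoid. Then the following are equivalent. (1) There is a graded isomorphism $\varphi\colon \mathscr G_E\to \mathscr G$. (2) There is a diagonal-preserving graded isomorphism $\Phi\colon L_R(E)\to R\mathscr G$ of $R$-algebras. (3) There is a diagonal-preserving graded isomorphism $\Phi\colon L_R(E)\to R\mathscr G$ of rings. The same result (both versions) holds over any indecomposable commutative ring with unit $R$ (not necessarily reduced) if $E$ is assumed to satisfy condition (L): every cycle of $E$ has an exit.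
   Context: A commutative ring with unit is indecomposable if $0\neq1$ and $0,1$ are its only idempotents, and reduced if it has no non-zero nilpotent elements. Groupoids. A groupoid $\mathscr G$ is a small category with all arrows invertible; $\mathscr G^{(0)}$ is the set of objects (identified with the identity arrows), $\mathscr G^{(1)}$ the set of arrows, $\boldsymbol d,\boldsymbol r$ the domain and range maps; $\alpha\beta$ is defined when $\boldsymbol d(\alpha)=\boldsymbol r(\beta)$. A topological groupoid has topologies making all structure maps continuous; it is étale if $\boldsymbol d$ is a local homeomorphism (then $\mathscr G^{(0)}$ is open in $\mathscr G^{(1)}$). An ample groupoid is an étale groupoid with $\mathscr G^{(0)}$ Hausdorff with a basis of compact open sets; it is Hausdorff if $\mathscr G^{(1)}$ is Hausdorff. An isomorphism of topological groupoids is a continuous functor with a continuous inverse. A $\mathbb Z$-graded groupoid is a topological groupoid with a continuous functor (cocycle) $c\colon\mathscr G\to\mathbb Z$ ($\mathbb Z$ a discrete one-object groupoid); $\mathscr G_k=c^{-1}(k)$. Graded isomorphisms of groupoids are isomorphisms commuting with the cocycles. $R\mathscr G$ is the $R$-module of compactly supported locally constant functions $\mathscr G^{(1)}\to R$ with product $fg(\gamma)=\sum_{\boldsymbol d(\alpha)=\boldsymbol d(\gamma)}f(\gamma\alpha^{-1})g(\alpha)$; for $\mathscr G$ graded, $R\mathscr G_k$ consists of the functions supported on $\mathscr G_k$. The diagonal subalgebra $D(\mathscr G)$ is the set of functions supported on $\mathscr G^{(0)}$. An isomorphism $\Phi\colon R\mathscr G\to R\mathscr G'$ is diagonal-preserving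 if $\Phi(D(\mathscr G))=D(\mathscr G')$ and graded if $\Phi(R\mathscr G_k)=R\mathscr G'_k$ for all $k$. Graphs. $E$ has vertex set $E^{(0)}$, edge set $E^{(1)}$, source map $\boldsymbol s$ and range map $\boldsymbol r$. A vertex $v$ is a sink if $\boldsymbol s^{-1}(v)=\emptyset$ and an infinite emitter if $|\boldsymbol s^{-1}(v)|=\infty$. $|\alpha|$ is the length of a finite directed path $\alpha$; $\varepsilon_v$ is the empty path at $v$. A cycle is a simple directed closed circuit; it has an exit if some vertex on it has out-degree at least two. $L_R(E)$ is the $R$-algebra generated by pairwise orthogonal idempotents $v\in E^{(0)}$ and elements $e,e^*$ ($e\in E^{(1)}$) subject to: $\boldsymbol s(e)e=e=e\boldsymbol r(e)$; $\boldsymbol r(e)e^*=e^*=e^*\boldsymbol s(e)$; $e^*e'=\delta_{e,e'}\boldsymbol r(e)$; and $v=\sum_{e\in\boldsymbol s^{-1}(v)}ee^*$ whenever $v$ is neither a sink nor an infinite emitter. Path groupoid. $\partial E$ consists of all one-sided infinite paths and all finite paths (possibly empty) ending at a sink or infinite emitter. For a finite path $\alpha$, $Z(\alpha)$ is the set of elements of $\partial E$ of the form $\alpha\beta$ ($Z(\varepsilon_v)$ is the set of elements with initial vertex $v$). The sets $Z(\alpha)\setminus(Z(\alpha e_1)\cup\dots\cup Z(\alpha e_n))$, $e_i\in E^{(1)}$, $n\geq0$, form a basis of compact open sets of $\partial E$. $\mathscr G_E^{(0)}=\partial E$ and $\mathscr G_E^{(1)}=\{(\alpha\gamma,|\alpha|-|\beta|,\beta\gamma)\in\partial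 E\times\mathbb Z\times\partial E\mid |\alpha|,|\beta|<\infty\}$, with $\boldsymbol d(\eta,k,\gamma)=\gamma$, $\boldsymbol r(\eta,k,\gamma)=\eta$, $(\eta,k,\gamma)(\gamma,m,\xi)=(\eta,k+m,\xi)$, $(\eta,k,\gamma)^{-1}=(\gamma,-k,\eta)$ and $\mathbb Z$-grading $c(\eta,k,\gamma)=k$. A basis of the topology on $\mathscr G_E^{(1)}$ is given by the sets $\{(\alpha\gamma,|\alpha|-|\beta|,\beta\gamma)\mid\alpha\gamma\in U,\beta\gamma\in V\}$ with $\alpha,\beta$ finite paths ending at the same vertex and $U\subseteq Z(\alpha)$, $V\subseteq Z(\beta)$ compact open such that $\alpha\gamma\in U$ iff $\beta\gamma\in V$. $\mathscr G_E$ is a Hausdorff ample groupoid. Put $Z(\alpha,\beta)=\{(\alpha\gamma,|\alpha|-|\beta|,\beta\gamma)\in\mathscr G_E^{(1)}\}$. There is an isomorphism $L_R(E)\to R\mathscr G_E$ sending $v\mapsto\chi_{Z(\varepsilon_v,\varepsilon_v)}$, $e\mapsto\chi_{Z(e,\varepsilon_{\boldsymbol r(e)})}$, $e^*\mapsto\chi_{Z(\varepsilon_{\boldsymbol r(e)},e)}$; through it $L_R(E)$ is identified with $R\mathscr G_E$, and the diagonal subalgebra and $\mathbb Z$-grading of $L_R(E)$ are those of $R\mathscr G_E$. *)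

(* Defs.v *)
From HB Require Import structures.
From mathcomp Require Import all_boot all_order all_algebra generic_quotient.
From mathcomp Require Import finmap.
From mathcomp Require Import boolp classical_sets functions cardinality fsbigop.
From mathcomp Require Import filter topology numfun.
From mathcomp Require Import zify.

Set Implicit Arguments.
Unset Strict Implicit.
Unset Printing Implicit Defensive.

Import GRing.Theory.

Local Open Scope classical_set_scope.
Local Open Scope quotient_scope.
Local Open Scope ring_scope.

Definition indecomposable (R : comPzRingType) : Prop :=
  0 <> 1 :> R /\ forall e : R, e * e = e -> e = 0 \/ e = 1.

Definition reduced (R : comPzRingType) : Prop :=
  forall (x : R) (n : nat), x ^+ n = 0 -> x = 0.

(** * Topological groupoids *)

(* Objects and arrows form two separate spaces, related by [gunit]; in a
   topological groupoid [gunit] is a homeomorphism onto its range, which is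
   what the identification of objects with identity arrows amounts to.
   [gmul a b] is meaningful only when [gdom a = gran b]. *)
Record groupoid := Groupoid {
  gobj : topologicalType;
  garr : topologicalType;
  gdom : garr -> gobj;
  gran : garr -> gobj;
  gunit : gobj -> garr;
  ginv : garr -> garr;
  gmul : garr -> garr -> garr;
  gdom_unit : forall x, gdom (gunit x) = x;
  gran_unit : forall x, gran (gunit x) = x;
  gdom_inv : forall a, gdom (ginv a) = gran a;
  gran_inv : forall a, gran (ginv a) = gdom a;
  gdom_mul : forall a b, gdom a = gran b -> gdom (gmul a b) = gdom b;
  gran_mul : forall a b, gdom a = gran b -> gran (gmul a b) = gran a;
  gmulA : forall a b c, gdom a = gran b -> gdom b = gran c ->
    gmul a (gmul b c) = gmul (gmul a b) c;
  gmul1l : forall a, gmul (gunit (gran a)) a = a;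
  gmul1r : forall a, gmul a (gunit (gdom a)) = a;
  gmulV : forall a, gmul a (ginv a) = gunit (gran a);
  gmulVl : forall a, gmul (ginv a) a = gunit (gdom a)
}.

Definition topological_groupoid (G : groupoid) : Prop :=
  [/\ continuous (@gdom G), continuous (@gran G), continuous (@gunit G),
      continuous (@ginv G) &
      {within [set p : garr G * garr G | gdom p.1 = gran p.2],
         continuous (fun p : garr G * garr G => gmul p.1 p.2)}].

Definition local_homeomorphism (X Y : topologicalType) (f : X -> Y) : Prop :=
  forall x : X, exists (U : set X) (g : Y -> X),
    [/\ open U, U x & open (f @` U)] /\
    [/\ {within U, continuous f}, {within f @` U, continuous g} &
        {in U, cancel f g}].

Definition etale (G : groupoid) : Prop :=
  topological_groupoid G /\ local_homeomorphism (@gdom G).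

Definition ample (G : groupoid) : Prop :=
  [/\ etale G, hausdorff_space (gobj G) &
      exists2 B : set (set (gobj G)), basis B & B `<=` [set K | compact K]].

Definition hausdorff_groupoid (G : groupoid) : Prop := hausdorff_space (garr G).

Record gfunctor (G H : groupoid) := GFunctor {
  fobj : gobj G -> gobj H;
  farr : garr G -> garr H;
  fdom : forall a, gdom (farr a) = fobj (gdom a);
  fran : forall a, gran (farr a) = fobj (gran a);
  funit : forall x, farr (gunit x) = gunit (fobj x);
  fmul : forall a b, gdom a = gran b ->
    farr (gmul a b) = gmul (farr a) (farr b)
}.

Definition groupoid_iso (G H : groupoid) (phi : gfunctor G H) : Prop :=
  continuous (fobj phi) /\ continuous (farr phi) /\
  exists psi : gfunctor H G,
    [/\ continuous (fobj psi), continuous (farr psi),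
        cancel (fobj phi) (fobj psi) /\ cancel (fobj psi) (fobj phi),
        cancel (farr phi) (farr psi) & cancel (farr psi) (farr phi)].

(* Continuity is with respect to the discrete topology on the integers. *)
Definition cocycle (G : groupoid) (c : garr G -> int) : Prop :=
  (forall k, open (c @^-1` [set k])) /\
  (forall a b, gdom a = gran b -> c (gmul a b) = c a + c b).

(** * The convolution algebra of a groupoid *)

Section Steinberg.
Variables (R : comPzRingType) (G : groupoid).
Implicit Types f g : garr G -> R.

Definition locally_constant f : Prop :=
  forall a, \forall b \near a, f b = f a.

Definition support f : set (garr G) := f @^-1` [set~ 0].

Definition steinberg : set (garr G -> R) :=
  [set f | locally_constant f /\ compact (closure (support f))].

(* The sum has finite support on [steinberg] when [G] is ample Hausdorff. *)
Definition conv f g : garr G -> R := fun c =>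
  \sum_(a \in [set a | gdom a = gdom c]) f (gmul c (ginv a)) * g a.

Definition diagonal : set (garr G -> R) :=
  [set f | steinberg f /\ support f `<=` range (@gunit G)].

Definition homogeneous (c : garr G -> int) (k : int) : set (garr G -> R) :=
  [set f | steinberg f /\ support f `<=` c @^-1` [set k]].

End Steinberg.

(** * Graphs and paths *)

Record digraph := Digraph {
  vert : choiceType;
  edge : choiceType;
  src : edge -> vert;
  rng : edge -> vert
}.

Section Paths.
Variable E : digraph.

Definition sink (v : vert E) : Prop := [set e | src e = v] = set0.

Definition infinite_emitter (v : vert E) : Prop :=
  infinite_set [set e | src e = v].

(* A finite path is given by its initial vertex and its edges. *)
Definition fpath : Type := (vert E * seq (edge E))%type.

Fixpoint path_from (v : vert E) (p : seq (edge E)) : Prop :=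
  if p is e :: q then src e = v /\ path_from (rng e) q else True.

Definition is_fpath (a : fpath) : Prop := path_from a.1 a.2.

Definition fend (a : fpath) : vert E := last a.1 (map (@rng E) a.2).

Definition flen (a : fpath) : nat := size a.2.

Definition vpath (v : vert E) : fpath := (v, [::]).

Definition epath (e : edge E) : fpath := (src e, [:: e]).

Definition is_cycle (a : fpath) : Prop :=
  [/\ is_fpath a, a.2 <> [::], fend a = a.1 & uniq (map (@src E) a.2)].

Definition has_exit (a : fpath) : Prop :=
  exists e e', [/\ e != e', src e = src e' & src e \in map (@src E) a.2].

Inductive rawpath : Type :=
| Fin of fpath
| Inf of (nat -> edge E).

Definition start (x : rawpath) : vert E :=
  match x with Fin a => a.1 | Inf u => src (u 0%N) end.

Definition boundary_path (x : rawpath) : Prop :=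
  match x with
  | Fin a => is_fpath a /\ (sink (fend a) \/ infinite_emitter (fend a))
  | Inf u => forall n, rng (u n) = src (u n.+1)
  end.

Definition pcat (a : fpath) (x : rawpath) : rawpath :=
  match x with
  | Fin b => Fin (a.1, a.2 ++ b.2)
  | Inf u => Inf (fun n =>
      if (n < flen a)%N then nth (u 0%N) a.2 n else u (n - flen a)%N)
  end.

HB.instance Definition _ := gen_eqMixin rawpath.
HB.instance Definition _ := gen_choiceMixin rawpath.

Definition bpath : Type := {x : rawpath | `[< boundary_path x >]}.

HB.instance Definition _ := Choice.on bpath.

(* [x] is the concatenation of the finite path [a] and [y]. *)
Definition cat_of (a : fpath) (y x : bpath) : Prop :=
  [/\ is_fpath a, fend a = start (val y) & val x = pcat a (val y)].

Definition cylinder (a : fpath) : set bpath := [set x | exists y, cat_of a y x].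

(* [(a.1, rcons a.2 e)] is the path [a] followed by the edge [e]; its cylinder
   is empty when it is not a path. *)
Definition bpath_base : set (set bpath) :=
  [set A | exists (a : fpath) (s : seq (edge E)), is_fpath a /\
     A = cylinder a `\`
         [set x | exists2 e, e \in s & cylinder (a.1, rcons a.2 e) x]].

(* Since [bpath_base] is a base of a topology, taking it as a subbase yields
   that topology; likewise for [parrow_base] below. *)
HB.instance Definition _ :=
  @isSubBaseTopological.Build bpath (set bpath) bpath_base id.

Definition arrow_triple (t : bpath * int * bpath) : Prop :=
  exists (a b : fpath) (y : bpath),
    [/\ cat_of a y t.1.1, cat_of b y t.2 & t.1.2 = (flen a)%:Z - (flen b)%:Z].

Definition parrow : Type := {t : bpath * int * bpath | `[< arrow_triple t >]}.

HB.instance Definition _ := Choice.on parrow.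

Definition pran (g : parrow) : bpath := (val g).1.1.
Definition pdeg (g : parrow) : int := (val g).1.2.
Definition pdom (g : parrow) : bpath := (val g).2.

Definition parrow_set (a b : fpath) (U V : set bpath) : set parrow :=
  [set g | exists y, [/\ cat_of a y (pran g), cat_of b y (pdom g),
     pdeg g = (flen a)%:Z - (flen b)%:Z, U (pran g) & V (pdom g)]].

Definition parrow_base : set (set parrow) :=
  [set A | exists (a b : fpath) (U V : set bpath),
     [/\ is_fpath a, is_fpath b & fend a = fend b] /\
     [/\ U `<=` cylinder a, V `<=` cylinder b,
         open U /\ compact U, open V /\ compact V &
         forall y u v, cat_of a y u -> cat_of b y v -> (U u <-> V v)] /\
     A = parrow_set a b U V].

HB.instance Definition _ :=
  @isSubBaseTopological.Build parrow (set parrow) parrow_base id.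

Definition bicylinder (a b : fpath) : set parrow := parrow_set a b setT setT.

Lemma cat_of_vpath (x : bpath) : cat_of (vpath (start (val x))) x x.
Proof.
split=> //; case: (val x) => [[v p]|u] //=.
by congr Inf; apply/funext => n; rewrite subn0.
Qed.

Lemma arrow_triple_unit (x : bpath) : arrow_triple (x, 0, x).
Proof.
exists (vpath (start (val x))), (vpath (start (val x))), x.
by split=> //; exact: cat_of_vpath.
Qed.

Lemma arrow_triple_inv (t : bpath * int * bpath) :
  arrow_triple t -> arrow_triple (t.2, - t.1.2, t.1.1).
Proof.
by case=> a [b [y [? ? ->]]]; exists b, a, y; split=> //; rewrite opprB.
Qed.

Definition fcat (a b : fpath) : fpath := (a.1, a.2 ++ b.2).

Lemma is_fpath_fcat (a b : fpath) : fend a = b.1 ->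
  is_fpath (fcat a b) <-> is_fpath a /\ is_fpath b.
Proof.
case: a b => [v p] [w q]; rewrite /is_fpath /fend /=.
elim: p v => [|e p IH] v /= hend; first by rewrite hend; split=> // -[].
by rewrite IH //; tauto.
Qed.

Lemma fend_fcat (a b : fpath) : fend a = b.1 -> fend (fcat a b) = fend b.
Proof.
by case: a b => [v p] [w q]; rewrite /fend /= map_cat last_cat => ->.
Qed.

Lemma pcat_fcat (a b : fpath) (x : rawpath) :
  pcat (fcat a b) x = pcat a (pcat b x).
Proof.
case: x => [c|u] /=; first by rewrite catA.
congr Inf; apply/funext => n; rewrite /flen /= size_cat nth_cat.
case: (ltnP n (size a.2)) => [n_lt|n_ge].
  rewrite ltn_addr //; exact: set_nth_default.
by rewrite subnDA ltn_subLR.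
Qed.

Lemma start_pcat (a : fpath) (x : rawpath) :
  is_fpath a -> fend a = start x -> start (pcat a x) = a.1.
Proof. by case: x a => [c|u] [v [|e p]] //= [-> _]. Qed.

Lemma pcat_split (a b : fpath) (x y : rawpath) :
    (flen a <= flen b)%N -> a.1 = b.1 -> fend a = start x ->
    pcat a x = pcat b y ->
  exists k : fpath, [/\ fend a = k.1, b = fcat a k & x = pcat k y].
Proof.
move=> ab ab1 xE xy.
exists (fend a, drop (flen a) b.2).
suff [bE xE'] : take (flen a) b.2 = a.2 /\
    x = pcat (fend a, drop (flen a) b.2) y.
  split=> //; rewrite /fcat ab1 /= -[in X in X ++ _]bE cat_take_drop.
  by rewrite -surjective_pairing.
case: x y xE xy => [[v p]|u] [[w q]|u'] //= xE [].
  rewrite -xE => _ /[dup] /(congr1 (take (flen a))).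
  rewrite take_size_cat // takel_cat // => <-.
  move=> /(congr1 (drop (flen a))); rewrite drop_size_cat // drop_cat.
  move: ab; rewrite leq_eqVlt => /orP[/eqP ab|ab]; last by rewrite -/(flen b) ab => ->.
  by rewrite -/(flen b) -ab ltnn subnn drop0 ab drop_size => ->.
move=> uE0; have uE n := congr1 (@^~ n) uE0; rewrite /= in uE; split.
  have sz : size (take (flen a) b.2) = flen a by rewrite size_takel.
  apply: (@eq_from_nth _ (u' 0%N)) => // i; rewrite sz => ia.
  have := uE i; rewrite ia (leq_trans ia ab) nth_take // => <-.
  exact: set_nth_default.
congr Inf; apply/funext => n; have := uE (flen a + n)%N.
rewrite ltnNge leq_addr addKn /= => ->.
rewrite /flen /= size_drop nth_drop ltn_subRL subnBA //.
by rewrite (addnC n).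
Qed.

Lemma cat_of_fcat (a k : fpath) (y z x : bpath) :
  fend a = k.1 -> is_fpath k -> fend k = start (val z) ->
  val y = pcat k (val z) -> cat_of a y x -> cat_of (fcat a k) z x.
Proof.
move=> ak fk kz yE [fa ay xE]; split; first exact/is_fpath_fcat.
- by rewrite fend_fcat.
- by rewrite pcat_fcat -yE.
Qed.

Lemma arrow_triple_mul (x y z : bpath) (k m : int) :
  arrow_triple (x, k, y) -> arrow_triple (y, m, z) ->
  arrow_triple (x, k + m, z).
Proof.
case=> a [b [t /= [ax byt ->]]] [c [d [u /= [cu du ->]]]].
have [fb bt yE] := byt; have [fc cs yE'] := cu.
have bc1 : b.1 = c.1.
  by rewrite -(start_pcat fb bt) -yE yE' start_pcat.
have xy : pcat b (val t) = pcat c (val u) by rewrite -yE.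
case: (leqP (flen b) (flen c)) => [bc|/ltnW cb].
  have [h [bh cE tE]] := pcat_split bc bc1 bt xy.
  have fh : is_fpath h by move: fc; rewrite cE => /(is_fpath_fcat bh)[].
  have hu : fend h = start (val u) by rewrite -cs cE fend_fcat.
  exists (fcat a h), d, u; split=> //=.
    have ah : fend a = h.1 by case: (ax) => _ -> _; rewrite -bh.
    exact: cat_of_fcat ah fh hu tE ax.
  by rewrite cE /flen /= !size_cat; lia.
have [h [ch bE uE]] := pcat_split cb (esym bc1) cs (esym xy).
have fh : is_fpath h by move: fb; rewrite bE => /(is_fpath_fcat ch)[].
have ht : fend h = start (val t) by rewrite -bt bE fend_fcat.
exists a, (fcat d h), t; split=> //=.
  have dh : fend d = h.1 by case: (du) => _ -> _; rewrite -ch.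
  exact: cat_of_fcat dh fh ht uE du.
by rewrite bE /flen /= !size_cat; lia.
Qed.

Definition pmk (t : bpath * int * bpath) (h : arrow_triple t) : parrow :=
  exist _ t (asboolT h).

Lemma parrowP (g : parrow) : arrow_triple (pran g, pdeg g, pdom g).
Proof.
by have := valP g => /asboolP; rewrite /pran /pdeg /pdom; case: (val g) => -[].
Qed.

Definition punit (x : bpath) : parrow := pmk (arrow_triple_unit x).

Definition pinv (g : parrow) : parrow := pmk (arrow_triple_inv (parrowP g)).

Definition pmul (g h : parrow) : parrow :=
  insubd g (pran g, pdeg g + pdeg h, pdom h).

Lemma val_pmul (g h : parrow) : pdom g = pran h ->
  val (pmul g h) = (pran g, pdeg g + pdeg h, pdom h).
Proof.
move=> gh; rewrite /pmul val_insubd ifT //; apply/asboolP.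
by apply: arrow_triple_mul (parrowP g) _; rewrite gh; exact: parrowP.
Qed.

Lemma parrow_eq (g h : parrow) :
  pran g = pran h -> pdeg g = pdeg h -> pdom g = pdom h -> g = h.
Proof.
case: g h => [[[x k] y] ?] [[[x' k'] y'] ?] /= xx kk yy.
by apply: val_inj => /=; congr (_, _, _).
Qed.

Lemma pran_mul g h : pdom g = pran h -> pran (pmul g h) = pran g.
Proof. by move=> /val_pmul; rewrite /pran => ->. Qed.

Lemma pdeg_mul g h : pdom g = pran h -> pdeg (pmul g h) = pdeg g + pdeg h.
Proof. by move=> /val_pmul; rewrite /pdeg => ->. Qed.

Lemma pdom_mul g h : pdom g = pran h -> pdom (pmul g h) = pdom h.
Proof. by move=> /val_pmul; rewrite /pdom => ->. Qed.

Lemma pmulA f g h : pdom f = pran g -> pdom g = pran h ->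
  pmul f (pmul g h) = pmul (pmul f g) h.
Proof.
move=> fg gh.
have fgh : pdom f = pran (pmul g h) by rewrite pran_mul.
have fgh' : pdom (pmul f g) = pran h by rewrite pdom_mul.
by apply: parrow_eq; rewrite ?(pran_mul, pdeg_mul, pdom_mul) // addrA.
Qed.

Lemma pmul1l g : pmul (punit (pran g)) g = g.
Proof.
have h : pdom (punit (pran g)) = pran g by [].
by apply: parrow_eq; rewrite ?(pran_mul, pdeg_mul, pdom_mul) // add0r.
Qed.

Lemma pmul1r g : pmul g (punit (pdom g)) = g.
Proof.
have h : pdom g = pran (punit (pdom g)) by [].
by apply: parrow_eq; rewrite ?(pran_mul, pdeg_mul, pdom_mul) // addr0.
Qed.

Lemma pmulV g : pmul g (pinv g) = punit (pran g).
Proof.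
have h : pdom g = pran (pinv g) by [].
by apply: parrow_eq; rewrite ?(pran_mul, pdeg_mul, pdom_mul) // subrr.
Qed.

Lemma pmulVl g : pmul (pinv g) g = punit (pdom g).
Proof.
have h : pdom (pinv g) = pran g by [].
by apply: parrow_eq; rewrite ?(pran_mul, pdeg_mul, pdom_mul) // addNr.
Qed.

Definition path_groupoid : groupoid :=
  @Groupoid bpath parrow pdom pran punit pinv pmul
    (fun=> erefl) (fun=> erefl) (fun=> erefl) (fun=> erefl)
    pdom_mul pran_mul pmulA pmul1l pmul1r pmulV pmulVl.

End Paths.

Definition condition_L (E : digraph) : Prop :=
  forall a : fpath E, is_cycle a -> has_exit a.

(** * Leavitt path algebras *)

Section Leavitt.
Variables (R : comPzRingType) (E : digraph).

Inductive lterm : Type :=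
| LVert of vert E
| LEdge of edge E
| LGhost of edge E
| LZero
| LAdd of lterm & lterm
| LOpp of lterm
| LScale of R & lterm
| LMul of lterm & lterm.

Definition lsum_ghost (s : seq (edge E)) : lterm :=
  foldr (fun e t => LAdd (LMul (LEdge e) (LGhost e)) t) LZero s.

(* The congruence on terms generated by the axioms of (not necessarily unital)
   associative [R]-algebras and the defining relations of [L_R(E)]. *)
Inductive lcong : lterm -> lterm -> Prop :=
| lcong_refl t : lcong t t
| lcong_sym t u : lcong t u -> lcong u t
| lcong_trans t u w : lcong t u -> lcong u w -> lcong t w
| lcong_add t t' u u' :
    lcong t t' -> lcong u u' -> lcong (LAdd t u) (LAdd t' u')
| lcong_opp t t' : lcong t t' -> lcong (LOpp t) (LOpp t')
| lcong_scale a t t' : lcong t t' -> lcong (LScale a t) (LScale a t')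
| lcong_mul t t' u u' :
    lcong t t' -> lcong u u' -> lcong (LMul t u) (LMul t' u')
| lcong_addA t u w : lcong (LAdd t (LAdd u w)) (LAdd (LAdd t u) w)
| lcong_addC t u : lcong (LAdd t u) (LAdd u t)
| lcong_add0 t : lcong (LAdd LZero t) t
| lcong_addN t : lcong (LAdd (LOpp t) t) LZero
| lcong_scaleA a b t : lcong (LScale a (LScale b t)) (LScale (a * b) t)
| lcong_scale1 t : lcong (LScale 1 t) t
| lcong_scaleDr a t u :
    lcong (LScale a (LAdd t u)) (LAdd (LScale a t) (LScale a u))
| lcong_scaleDl a b t :
    lcong (LScale (a + b) t) (LAdd (LScale a t) (LScale b t))
| lcong_mulA t u w : lcong (LMul t (LMul u w)) (LMul (LMul t u) w)
| lcong_mulDl t u w : lcong (LMul (LAdd t u) w) (LAdd (LMul t w) (LMul u w))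
| lcong_mulDr t u w : lcong (LMul t (LAdd u w)) (LAdd (LMul t u) (LMul t w))
| lcong_scaleAl a t u : lcong (LScale a (LMul t u)) (LMul (LScale a t) u)
| lcong_scaleAr a t u : lcong (LScale a (LMul t u)) (LMul t (LScale a u))
| lcong_vert v : lcong (LMul (LVert v) (LVert v)) (LVert v)
| lcong_vert0 v w : v != w -> lcong (LMul (LVert v) (LVert w)) LZero
| lcong_src e : lcong (LMul (LVert (src e)) (LEdge e)) (LEdge e)
| lcong_rng e : lcong (LMul (LEdge e) (LVert (rng e))) (LEdge e)
| lcong_ghost_rng e : lcong (LMul (LVert (rng e)) (LGhost e)) (LGhost e)
| lcong_ghost_src e : lcong (LMul (LGhost e) (LVert (src e))) (LGhost e)
| lcong_ck1 e : lcong (LMul (LGhost e) (LEdge e)) (LVert (rng e))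
| lcong_ck1_0 e f : e != f -> lcong (LMul (LGhost e) (LEdge f)) LZero
| lcong_ck2 v : ~ sink v -> ~ infinite_emitter v ->
    lcong (LVert v) (lsum_ghost (fset_set [set e | src e = v])).

HB.instance Definition _ := gen_eqMixin lterm.
HB.instance Definition _ := gen_choiceMixin lterm.

Definition lcongb (t u : lterm) : bool := `[< lcong t u >].

Lemma lcongb_equiv : equiv_class_of lcongb.
Proof.
split=> [t|t u|u t w].
- exact/asboolP/lcong_refl.
- by apply: asbool_equiv_eq; split; exact: lcong_sym.
- by move=> /asboolP tu /asboolP uw; apply/asboolP; exact: lcong_trans uw.
Qed.

Canonical lcong_equiv := EquivRelPack lcongb_equiv.

Definition lpa : Type := {eq_quot lcong_equiv}.

HB.instance Definition _ := Choice.on lpa.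
HB.instance Definition _ := EqQuotient.on lpa.

Definition lpi (t : lterm) : lpa := \pi t.

Lemma lpiP (t u : lterm) : lpi t = lpi u <-> lcong t u.
Proof.
rewrite /lpi; split=> [/eqmodP/asboolP //|tu].
by apply/eqmodP; apply/asboolP.
Qed.

Lemma repr_lpi (t : lterm) : lcong (repr (lpi t)) t.
Proof. by apply/lpiP; rewrite /lpi reprK. Qed.

Definition lpa_add (x y : lpa) : lpa := lpi (LAdd (repr x) (repr y)).
Definition lpa_opp (x : lpa) : lpa := lpi (LOpp (repr x)).
Definition lpa_scale (a : R) (x : lpa) : lpa := lpi (LScale a (repr x)).
Definition lpa_mul (x y : lpa) : lpa := lpi (LMul (repr x) (repr y)).

Lemma lpi_add t u : lpa_add (lpi t) (lpi u) = lpi (LAdd t u).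
Proof. by apply/lpiP; apply: lcong_add; exact: repr_lpi. Qed.

Lemma lpi_opp t : lpa_opp (lpi t) = lpi (LOpp t).
Proof. by apply/lpiP; apply: lcong_opp; exact: repr_lpi. Qed.

Lemma lpi_scale a t : lpa_scale a (lpi t) = lpi (LScale a t).
Proof. by apply/lpiP; apply: lcong_scale; exact: repr_lpi. Qed.

Lemma lpi_mul t u : lpa_mul (lpi t) (lpi u) = lpi (LMul t u).
Proof. by apply/lpiP; apply: lcong_mul; exact: repr_lpi. Qed.

Lemma lpi_surj (x : lpa) : exists t, x = lpi t.
Proof. by exists (repr x); rewrite /lpi reprK. Qed.

Lemma lpa_addA : associative lpa_add.
Proof.
move=> x y z; have [t ->] := lpi_surj x; have [u ->] := lpi_surj y.
by have [w ->] := lpi_surj z; rewrite !lpi_add; apply/lpiP/lcong_addA.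
Qed.

Lemma lpa_addC : commutative lpa_add.
Proof.
move=> x y; have [t ->] := lpi_surj x; have [u ->] := lpi_surj y.
by rewrite !lpi_add; apply/lpiP/lcong_addC.
Qed.

Lemma lpa_add0 : left_id (lpi LZero) lpa_add.
Proof.
by move=> x; have [t ->] := lpi_surj x; rewrite lpi_add; apply/lpiP/lcong_add0.
Qed.

Lemma lpa_addN : left_inverse (lpi LZero) lpa_opp lpa_add.
Proof.
move=> x; have [t ->] := lpi_surj x.
by rewrite lpi_opp lpi_add; apply/lpiP/lcong_addN.
Qed.

HB.instance Definition _ :=
  GRing.isZmodule.Build lpa lpa_addA lpa_addC lpa_add0 lpa_addN.

Lemma lpa_scaleA a b x : lpa_scale a (lpa_scale b x) = lpa_scale (a * b) x.
Proof.
by have [t ->] := lpi_surj x; rewrite !lpi_scale; apply/lpiP/lcong_scaleA.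
Qed.

Lemma lpa_scale1 : left_id 1 lpa_scale.
Proof.
move=> x; have [t ->] := lpi_surj x.
by rewrite lpi_scale; apply/lpiP/lcong_scale1.
Qed.

Lemma lpa_scaleDr : right_distributive lpa_scale +%R.
Proof.
move=> a x y; have [t ->] := lpi_surj x; have [u ->] := lpi_surj y.
rewrite /GRing.add /= !(lpi_add, lpi_scale).
by apply/lpiP/lcong_scaleDr.
Qed.

Lemma lpa_scaleDl x : {morph lpa_scale^~ x : a b / a + b}.
Proof.
move=> a b; have [t ->] := lpi_surj x.
rewrite [RHS]/GRing.add /= !(lpi_add, lpi_scale).
by apply/lpiP/lcong_scaleDl.
Qed.

HB.instance Definition _ := GRing.Zmodule_isLmodule.Build R lpa
  lpa_scaleA lpa_scale1 lpa_scaleDr lpa_scaleDl.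

Let GE : groupoid := path_groupoid E.

Fixpoint lterm_eval (t : lterm) : garr GE -> R :=
  match t with
  | LVert v => \1_(bicylinder (vpath v) (vpath v))
  | LEdge e => \1_(bicylinder (epath e) (vpath (rng e)))
  | LGhost e => \1_(bicylinder (vpath (rng e)) (epath e))
  | LZero => fun=> 0
  | LAdd t u => fun g => lterm_eval t g + lterm_eval u g
  | LOpp t => fun g => - lterm_eval t g
  | LScale a t => fun g => a * lterm_eval t g
  | LMul t u => conv (G := GE) (lterm_eval t) (lterm_eval u)
  end.

(* The canonical map [L_R(E) -> R G_E], along which the diagonal and the grading
   of [L_R(E)] are pulled back. Congruent terms have the same value, because
   the characteristic functions above satisfy the relations of [L_R(E)]; so
   the choice of a representative is immaterial. *)
Definition lpa_to_steinberg (x : lpa) : garr GE -> R := lterm_eval (repr x).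

Definition lpa_diagonal : set lpa := lpa_to_steinberg @^-1` @diagonal R GE.

Definition lpa_homogeneous (k : int) : set lpa :=
  lpa_to_steinberg @^-1` @homogeneous R GE (@pdeg E) k.

Variable G : groupoid.
Implicit Type Phi : lpa -> garr G -> R.

Definition ring_iso Phi : Prop :=
  [/\ set_bij setT (@steinberg R G) Phi, {morph Phi : x y / x + y} &
      {morph Phi : x y / lpa_mul x y >-> conv x y}].

Definition alg_iso Phi : Prop :=
  ring_iso Phi /\ forall a x g, Phi (a *: x) g = a * Phi x g.

Definition diagonal_preserving Phi : Prop :=
  Phi @` lpa_diagonal = @diagonal R G.

Definition graded_iso (c : garr G -> int) Phi : Prop :=
  forall k, Phi @` lpa_homogeneous k = @homogeneous R G c k.

End Leavitt.

(* Main.v *)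
Require Import Defs.
From mathcomp Require Import all_boot all_order all_algebra.
From mathcomp Require Import finmap.
From mathcomp Require Import boolp classical_sets functions cardinality fsbigop.
From mathcomp Require Import filter topology numfun zify.
Import Defs.

(* The Steinberg algebra of the path groupoid [G_E] is [L_R(E)]: evaluation is
   onto because the characteristic functions of the sets [Z(a, b)] span, and
   injective by induction on the length of the paths [a] in a combination of
   monomials [a b^*], multiplying on the left by ghost edges.

   Conversely let [T : R G -> R G_E] be a ring isomorphism preserving diagonals.
   Since [R] is indecomposable the idempotents of the diagonals are the
   characteristic functions of compact open sets, so Stone duality yields a
   homeomorphism [f0] of the unit spaces. For a compact open bisection [V] of [G]
   the function [T 1_V] normalizes the diagonal of [R G_E], and its support is
   then a bisection: over a unit [x] it is a unit of the group algebra of the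
   isotropy group at [x], which is trivial or infinite cyclic, and such units are
   trivial when [R] is reduced; under condition (L) the isotropy is trivial at a
   dense set of units, whatever [R]. An arrow [b] in [V] is sent to the unique
   arrow in the support of [T 1_V] whose domain is [f0 (gdom b)]; this is
   independent of [V] and is the inverse of the required isomorphism. *)

Set Implicit Arguments.
Unset Strict Implicit.
Unset Printing Implicit Defensive.

Import GRing.Theory.

Local Open Scope classical_set_scope.
Local Open Scope ring_scope.

(** * Convolution on a groupoid *)

(** The converse goes from [R G] to [R G_E] because isotropy is known only on the side of the path
    groupoid, where it is computed from paths; all that is needed there is put into one hypothesis
    on normalizers. As [T] is only an isomorphism of rings, it may move scalars and the values of
    [T 1_V] are not controlled, so the arguments use supports. Two facts stand in for linearity. The
    values of [T 1_V] on its support are units of [R], hence products of such values do not vanish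
    although [R] may have zero divisors. A multiple [r 1_V] is the product of a diagonal function
    with [1_V], so [T] maps it to a function supported inside the support of [T 1_V]. For gradings,
    each set of constant degree is open and contains small bisections [V]; [1_V] is then
    homogeneous, and [T 1_V] reveals the degree of the corresponding arrows. In the injectivity of
    evaluation the delicate vertices are the infinite emitters, where no relation expresses [v]
    through its edges: an edge that is absent from the given combination serves as a test. *)

Section GroupoidAlgebra.
Variable G : groupoid.
Implicit Types a b c : garr G.

Lemma gran_mulV c a : gdom a = gdom c -> gran (gmul c (ginv a)) = gran c.
Proof. by move=> e; rewrite gran_mul // gran_inv. Qed.

Lemma gdom_mulV c a : gdom a = gdom c -> gdom (gmul c (ginv a)) = gran a.
Proof. by move=> e; rewrite gdom_mul ?gdom_inv // gran_inv. Qed.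

Lemma gmulVK c a : gdom a = gdom c -> gmul (gmul c (ginv a)) a = c.
Proof.
by move=> e; rewrite -gmulA ?gran_inv ?gdom_inv // gmulVl e gmul1r.
Qed.

Lemma gmulKV c a : gdom c = gran a -> gmul (gmul c a) (ginv a) = c.
Proof. by move=> e; rewrite -gmulA ?gran_inv // gmulV -e gmul1r. Qed.

Lemma gmulKl a c : gdom a = gran c -> gmul (ginv a) (gmul a c) = c.
Proof.
by move=> e; rewrite gmulA ?gdom_inv // gmulVl e gmul1l.
Qed.

Lemma gmul_injr a b c : gdom a = gran c -> gdom b = gran c ->
  gmul a c = gmul b c -> a = b.
Proof. by move=> ac bc e; rewrite -(gmulKV ac) e gmulKV. Qed.

Lemma gmul_injl a b c : gdom a = gran b -> gdom a = gran c ->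
  gmul a b = gmul a c -> b = c.
Proof. by move=> ac bc e; rewrite -(gmulKl ac) e gmulKl. Qed.

Lemma ginvK : involutive (@ginv G).
Proof.
move=> a; apply: (@gmul_injl (ginv a)); rewrite ?gran_inv ?gdom_inv //.
by rewrite gmulV gmulVl gran_inv.
Qed.

Lemma ginv_mul a b : gdom a = gran b ->
  ginv (gmul a b) = gmul (ginv b) (ginv a).
Proof.
move=> ab; apply: (@gmul_injl (gmul a b)).
- by rewrite gran_inv.
- by rewrite gdom_mul // gran_mul ?gran_inv // gdom_inv.
- rewrite gmulV gran_mul // gmulA; last by rewrite gran_inv gdom_inv.
    by rewrite gmulKV // gmulV.
  by rewrite gdom_mul // gran_inv.
Qed.

Lemma ginv_unit x : ginv (gunit x) = gunit x :> garr G.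
Proof.
apply: (@gmul_injl (gunit x)); rewrite ?gran_inv ?gdom_unit ?gran_unit //.
rewrite gmulV gran_unit; have := gmul1l (gunit x : garr G).
by rewrite gran_unit => ->.
Qed.

Lemma gmul_unitl a x : x = gran a -> gmul (gunit x) a = a.
Proof. by move=> ->; rewrite gmul1l. Qed.

Lemma gunit_inj : injective (@gunit G).
Proof. by move=> x y e; rewrite -(gdom_unit x) e gdom_unit. Qed.

Lemma ginv_inj : injective (@ginv G).
Proof. exact: can_inj ginvK. Qed.

(** Cancelling one factor of [a a = a] leaves a unit. This is how a multiplicative map of arrows is
    seen to preserve units. *)
Lemma gidem_unit a : gdom a = gran a -> gmul a a = a -> a = gunit (gdom a).
Proof.
move=> aa e; apply: (@gmul_injr _ _ a) => //; first by rewrite gdom_unit.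
by rewrite e aa gmul1l.
Qed.

Lemma gmulV_unit a c x : gdom a = gdom c -> gmul c (ginv a) = gunit x -> a = c.
Proof.
move=> e h; rewrite -[RHS](gmulVK e) h gmul_unitl //.
by rewrite -(gdom_unit x) -h gdom_mulV.
Qed.

End GroupoidAlgebra.

Lemma indic_eq1 (R : comPzRingType) T (A : set T) (x : T) : A x -> \1_A x = 1 :> R.
Proof. by move=> Ax; rewrite indicE mem_set. Qed.

Lemma indic_eq0 (R : comPzRingType) T (A : set T) (x : T) : ~ A x -> \1_A x =
  0 :> R.
Proof. by move=> Ax; rewrite indicE memNset. Qed.

Lemma indic_neq0 (R : comPzRingType) T (A : set T) (x : T) :
  \1_A x <> 0 :> R -> A x.
Proof. by move=> h; apply: contrapT => nA; apply: h; exact: indic_eq0. Qed.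

Section Convolution.
Variables (R : comPzRingType) (G : groupoid).
Implicit Types (f g h : garr G -> R) (a b c : garr G).

(** [conv] is a finitely supported sum, equal to 0 when infinitely many terms are nonzero, so its
    algebraic laws need this finiteness. The condition is free of topology, and the values of terms
    of the Leavitt algebra satisfy it by induction. *)
Definition finite_fibres f : Prop :=
  forall x, finite_set [set a | gdom a = x /\ f a <> 0].

Lemma conv_seq f g c (s : seq (garr G)) : uniq s ->
  (forall a, a \in s -> gdom a = gdom c) ->
  (forall a, gdom a = gdom c -> f (gmul c (ginv a)) * g a <> 0 -> a \in s) ->
  conv f g c = \sum_(a <- s) f (gmul c (ginv a)) * g a.
Proof.
move=> us sc sup; rewrite /conv (fsbigE s) //.
  rewrite big_seq_cond [RHS]big_seq; apply: eq_bigl => a.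
  by case: (boolP (a \in s)) => //= /sc ac; rewrite mem_set.
by move=> a ac as0; apply: contrapT => /(sup a ac); exact/negP.
Qed.

Lemma conv_single f g c b : gdom b = gdom c ->
  (forall a, gdom a = gdom c -> f (gmul c (ginv a)) * g a <> 0 -> a = b) ->
  conv f g c = f (gmul c (ginv b)) * g b.
Proof.
move=> bc sup; rewrite (@conv_seq _ _ _ [:: b]) ?big_seq1 //.
  by move=> a; rewrite inE => /eqP ->.
by move=> a ac n0; rewrite inE; apply/eqP/sup.
Qed.

Lemma conv_eq0 f g c :
  (forall a, gdom a = gdom c -> f (gmul c (ginv a)) * g a = 0) -> conv f g c = 0.
Proof.
move=> sup; rewrite (@conv_seq _ _ _ [::]) ?big_nil // => a ac.
by rewrite sup.
Qed.

Lemma conv_neq0 f g c : conv f g c <> 0 ->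
  exists a, [/\ gdom a = gdom c, f (gmul c (ginv a)) <> 0 & g a <> 0].
Proof.
move=> n0; apply: contrapT => h; apply: n0; apply: conv_eq0 => a ac.
apply: contrapT => n0; apply: h; exists a; split=> // e0; apply: n0.
  by rewrite e0 mul0r.
by rewrite e0 mulr0.
Qed.

Lemma conv_diagr f g c : support g `<=` range (@gunit G) ->
  conv f g c = f c * g (gunit (gdom c)).
Proof.
move=> sg; rewrite (@conv_single _ _ _ (gunit (gdom c))).
- by rewrite ginv_unit gmul1r.
- by rewrite gdom_unit.
move=> a ac n0; have [|x _ xa] := sg a.
  by move=> g0; apply: n0; rewrite g0 mulr0.
by rewrite -ac -xa gdom_unit.
Qed.

Lemma conv_diagl f g c : support f `<=` range (@gunit G) ->
  conv f g c = f (gunit (gran c)) * g c.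
Proof.
move=> sf; rewrite (@conv_single _ _ _ c) ?gmulV //.
move=> a ac n0; have [|x _ xa] := sf (gmul c (ginv a)).
  by move=> f0; apply: n0; rewrite f0 mul0r.
by apply: gmulV_unit ac (esym xa).
Qed.

Lemma finite_fibres_conv f g :
  finite_fibres f -> finite_fibres g -> finite_fibres (conv f g).
Proof.
move=> ff fg x.
have fin : finite_set (\bigcup_(b in [set b | gdom b = x /\ g b <> 0])
    (fun a => gmul a b) @` [set a | gdom a = gran b /\ f a <> 0]).
  by apply: bigcup_finite => // b _; apply: finite_image.
apply: sub_finite_set fin => c [cx /conv_neq0[b [bc fn gn]]].
exists b; first by rewrite /= bc.
exists (gmul c (ginv b)); last by rewrite gmulVK.
by rewrite /= gdom_mulV.
Qed.

Lemma finite_fibresD f g : finite_fibres f -> finite_fibres g ->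
  finite_fibres (fun a => f a + g a).
Proof.
move=> ff fg x.
have fin : finite_set ([set a | gdom a = x /\ f a <> 0] `|`
                       [set a | gdom a = x /\ g a <> 0]).
  by rewrite finite_setU.
apply: sub_finite_set fin => a [ax n0].
have [f0|f0] := pselect (f a = 0); last by left.
by right; split=> // g0; apply: n0; rewrite f0 g0 addr0.
Qed.

Lemma finite_fibres_sub f g :
  (forall a, g a <> 0 -> f a <> 0) -> finite_fibres f -> finite_fibres g.
Proof. by move=> fg ff x; apply: sub_finite_set (ff x) => a [? /fg]. Qed.

Lemma finite_fibres_seq f x : finite_fibres f ->
  exists s : seq (garr G), uniq s /\
    forall a, (a \in s) <-> (gdom a = x /\ f a <> 0).
Proof.
move=> /(_ x) fin; exists (fset_set [set a | gdom a = x /\ f a <> 0]).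
by split=> [|a]; rewrite ?fset_uniq // in_fset_set // inE.
Qed.

Lemma convDl f g h : finite_fibres h ->
  conv (fun a => f a + g a) h = (fun c => conv f h c + conv g h c).
Proof.
move=> fh; apply/funext => c; have [s [us sE]] := finite_fibres_seq (gdom c) fh.
rewrite !(@conv_seq _ _ _ s) // -?big_split /=; last first.
- by move=> a ac n0; apply/sE; split=> // h0; apply: n0; rewrite h0 mulr0.
- by move=> a /sE[].
- by move=> a ac n0; apply/sE; split=> // h0; apply: n0; rewrite h0 mulr0.
- by move=> a /sE[].
- by move=> a ac n0; apply/sE; split=> // h0; apply: n0; rewrite h0 mulr0.
- by move=> a /sE[].
by apply: eq_bigr => a _; rewrite mulrDl.
Qed.

Lemma convDr f g h : finite_fibres g -> finite_fibres h ->
  conv f (fun a => g a + h a) = (fun c => conv f g c + conv f h c).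
Proof.
move=> fg fh; apply/funext => c.
have [s [us sE]] := finite_fibres_seq (gdom c) fg.
have [t [ut tE]] := finite_fibres_seq (gdom c) fh.
have st a : a \in undup (s ++ t) <-> gdom a = gdom c /\ (g a <> 0 \/ h a <> 0).
  rewrite mem_undup mem_cat; split.
    by case/orP => [/sE[? ?]|/tE[? ?]]; split=> //; [left|right].
  by case=> ac [g0|h0]; apply/orP; [left; apply/sE|right; apply/tE].
have U k : (forall a, k a <> 0 -> g a <> 0 \/ h a <> 0) ->
    conv f k c = \sum_(a <- undup (s ++ t)) f (gmul c (ginv a)) * k a.
  move=> kgh; apply: conv_seq; rewrite ?undup_uniq // => a; first by case/st.
  by move=> ac n0; apply/st; split=> //; apply: kgh => k0; apply: n0;
    rewrite k0 mulr0.
rewrite !U -?big_split /=; first by apply: eq_bigr => a _; rewrite mulrDr.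
- by move=> a; right.
- by move=> a; left.
move=> a n0; have [g0|g0] := pselect (g a = 0); last by left.
by right=> h0; apply: n0; rewrite g0 h0 addr0.
Qed.

Lemma convZl k f g : finite_fibres g ->
  conv (fun a => k * f a) g = (fun c => k * conv f g c).
Proof.
move=> fh; apply/funext => c; have [s [us sE]] := finite_fibres_seq (gdom c) fh.
rewrite !(@conv_seq _ _ _ s) // ?big_distrr /=; last first.
- by move=> a ac n0; apply/sE; split=> // h0; apply: n0; rewrite h0 mulr0.
- by move=> a /sE[].
- by move=> a ac n0; apply/sE; split=> // h0; apply: n0; rewrite h0 mulr0.
- by move=> a /sE[].
by apply: eq_bigr => a _; rewrite mulrA.
Qed.

Lemma convZr k f g : finite_fibres g ->
  conv f (fun a => k * g a) = (fun c => k * conv f g c).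
Proof.
move=> fg; apply/funext => c.
have [s [us sE]] := finite_fibres_seq (gdom c) fg.
have U h : (forall a, h a <> 0 -> g a <> 0) ->
    conv f h c = \sum_(a <- s) f (gmul c (ginv a)) * h a.
  move=> hg; apply: conv_seq => // a; first by case/sE.
  by move=> ac n0; apply/sE; split=> //; apply: hg => h0; apply: n0;
    rewrite h0 mulr0.
rewrite !U // ?big_distrr /=; first by apply: eq_bigr => a _; rewrite mulrCA.
by move=> a n0 g0; apply: n0; rewrite g0 mulr0.
Qed.

(** Both sides become a double sum over [b] in the support of [h] above [gdom c] and [a] in a finite
    set carrying [conv g h]; substituting [a b^-1] for [a] turns the inner sum into a value of
    [conv f g]. *)
Lemma convA f g h : finite_fibres g -> finite_fibres h ->
  conv f (conv g h) = conv (conv f g) h.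
Proof.
move=> fg fh; apply/funext => c.
have [S [uS SE]] := finite_fibres_seq (gdom c) fh.
have fgh := finite_fibres_conv fg fh.
have [Q0 [uQ0 Q0E]] := finite_fibres_seq (gdom c) fgh.
pose T b := sval (cid (finite_fibres_seq (gran b) fg)).
have TE b a : (a \in T b) <-> (gdom a = gran b /\ g a <> 0).
  by rewrite /T; case: cid => s /= [_]; exact.
(* All products of an arrow in the support of [g] with one in [S]; duplicates are removed since
   different pairs may have the same product. *)
pose Q := undup [seq gmul a b | b <- S, a <- T b].
have Qdom a : a \in Q -> gdom a = gdom c.
  rewrite mem_undup => /allpairsPdep[b [a' [bS /TE[a'b _] ->]]].
  by rewrite gdom_mul //; case/SE: bS.
have QP a b : b \in S -> gdom a = gran b -> g a <> 0 -> gmul a b \in Q.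
  move=> bS ab ga; rewrite mem_undup; apply/allpairsPdep.
  by exists b, a; split=> //; apply/TE.
rewrite (@conv_seq _ _ _ Q) ?undup_uniq //; last first.
  move=> a ac n0; have gh0 : conv g h a <> 0.
    by move=> e0; apply: n0; rewrite e0 mulr0.
  have [b [ba gb hb]] := conv_neq0 gh0.
  rewrite -(gmulVK ba); apply: QP => //; last by rewrite gdom_mulV.
  by apply/SE; rewrite ba.
rewrite (@conv_seq _ _ _ S) //; last first.
- move=> b bc n0; apply/SE; split=> // h0; apply: n0.
  by rewrite h0 mulr0.
- by move=> b /SE[].
transitivity (\sum_(a <- Q) \sum_(b <- S)
    f (gmul c (ginv a)) * g (gmul a (ginv b)) * h b).
  rewrite big_seq [RHS]big_seq; apply: eq_bigr => a aQ.
  rewrite (@conv_seq _ _ _ S) // ?big_distrr /=; last first.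
  - move=> b bc n0; apply/SE; split; first by rewrite bc Qdom.
    by move=> h0; apply: n0; rewrite h0 mulr0.
  - by move=> b /SE[->]; rewrite Qdom.
  by apply: eq_bigr => b _; rewrite mulrA.
rewrite exchange_big /= big_seq [RHS]big_seq; apply: eq_bigr => b bS.
have [bc hb] := (SE b).1 bS.
have dmap a : a \in Q -> gdom (gmul a (ginv b)) = gran b.
  by move=> /Qdom ac; rewrite gdom_mulV // bc.
rewrite -big_distrl /=; congr (_ * _).
rewrite (@conv_seq _ _ _ [seq gmul a (ginv b) | a <- Q]).
- rewrite big_map big_seq [RHS]big_seq; apply: eq_bigr => a aQ.
  congr (f _ * _); have ac := Qdom a aQ.
  rewrite ginv_mul ?gran_inv ?ac // ginvK gmulA.
  + by rewrite gmulVK.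
  + by rewrite gdom_mulV.
  + by rewrite gran_inv ac.
- rewrite map_inj_in_uniq ?undup_uniq // => a a' aQ a'Q.
  by apply: gmul_injr; rewrite gran_inv bc Qdom.
- by move=> _ /mapP[a aQ ->]; rewrite dmap // gdom_mulV.
move=> a; rewrite gdom_mulV // => ab n0; apply/mapP; exists (gmul a b).
  by apply: QP => // g0; apply: n0; rewrite g0 mulr0.
by rewrite gmulKV.
Qed.

End Convolution.

(** * Compact open sets *)

Section CompactOpen.
Variable X : topologicalType.
Implicit Types (A B K U : set X) (x : X).

Definition compact_open : set (set X) := [set A | open A /\ compact A].

Definition has_compact_open_base : Prop :=
  forall x U, open U -> U x -> exists A, [/\ compact_open A, A x & A `<=` U].

Lemma open_local A : (forall x, A x -> exists U, [/\ open U, U x & U `<=` A]) ->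
  open A.
Proof.
move=> h; rewrite openE => x /h[U [oU Ux UA]].
by rewrite /interior /= nbhsE; exists U.
Qed.

Lemma nbhs_openP x A : nbhs x A -> exists U, [/\ open U, U x & U `<=` A].
Proof. by rewrite nbhsE => -[U [? ?] ?]; exists U. Qed.

(* The sets [A] with [P (K `\` A)] form a filter, which would have no cluster
   point in [K] if [P K] failed. *)
Lemma compact_ind (P : set X -> Prop) K : compact K ->
  P set0 -> (forall A B, P A -> P B -> P (A `|` B)) ->
  (forall A B, A `<=` B -> P B -> P A) ->
  (forall x, K x -> exists U, [/\ open U, U x & P U]) -> P K.
Proof.
move=> cK P0 PU PS Ploc; apply: contrapT => nPK.
pose F : set_system X := fun A => P (K `\` A).
have FF : ProperFilter F.
  apply: Build_ProperFilter_ex.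
    move=> A FA; apply: contrapT => nA; apply: nPK; apply: PS FA => x Kx.
    by split=> // Ax; apply: nA; exists x.
  split; first by rewrite /F setDT.
    by move=> A B FA FB; apply: PS (PU _ _ FA FB); rewrite setDIr.
  by move=> A B AB; apply: PS => x [Kx nB]; split=> // /AB.
have FK : F K by rewrite /F setDv.
have [x [Kx clx]] := cK F FF FK.
have [U [oU Ux PUU]] := Ploc x Kx.
have [y []] : (~` U) `&` U !=set0; last by [].
apply: clx; last by rewrite nbhsE; exists U.
by apply: PS PUU => y [_]; exact: contrapT.
Qed.

Section Hausdorff.
Hypothesis hX : hausdorff_space X.

Lemma hausdorff_sep x y : x <> y ->
  exists U V, [/\ open U, open V, U x, V y & U `&` V = set0].
Proof.
move=> xy; have := hX; rewrite open_hausdorff => /(_ x y).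
case=> [|[U V] [/= Ux Vy] [oU oV UV]]; first exact/eqP.
by exists U, V; split=> //; [move: Ux|move: Vy|exact/eqP]; rewrite ?inE.
Qed.

Lemma compact_openI A B : compact_open A -> compact_open B ->
  compact_open (A `&` B).
Proof.
move=> [oA cA] [oB cB]; split; first exact: openI.
by apply: compact_closedI => //; exact: compact_closed.
Qed.

Lemma compact_openD A B : compact_open A -> compact_open B ->
  compact_open (A `\` B).
Proof.
move=> [oA cA] [oB cB]; rewrite setDE; split.
  by apply: openI => //; apply: closed_openC; exact: compact_closed.
by apply: compact_closedI => //; exact: open_closedC.
Qed.

Hypothesis bX : has_compact_open_base.

Lemma compact_open_sep x y : x <> y ->
  exists A, [/\ compact_open A, A x & ~ A y].
Proof.
move=> /hausdorff_sep[U [V [oU oV Ux Vy UV]]].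
have [A [cA Ax AU]] := bX oU Ux; exists A; split=> // Ay.
have : (U `&` V) y by split=> //; exact: AU.
by rewrite UV.
Qed.

End Hausdorff.
End CompactOpen.

(** The inverse of an open injective map is continuous; in terms of filters, a cluster point of the
    image filter is [f a] with [a] a cluster point of the filter. Compactness of bisections is read
    off their domains in this way. *)
Lemma compact_open_image_inj (X Y : topologicalType) (f : X -> Y) (V : set X) :
  (forall U, open U -> open (f @` U)) -> open V ->
  (forall a b, V a -> V b -> f a = f b -> a = b) ->
  compact (f @` V) -> compact V.
Proof.
move=> fo oV fi cfV F FF FV.
have [|_ [[a Va <-] cla]] := cfV (f @ F) (fmap_proper_filter f FF).
  rewrite /fmap /=; apply: (filterS _ FV) => a Va; by exists a.
exists a; split=> // S N FS /nbhs_openP[U [oU Ua UN]].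
have [] := cla (f @` (S `&` V)) (f @` (U `&` V)).
- by rewrite /fmap /=; apply: (filterS _ (filterI FS FV)) => b Sb; exists b.
- rewrite nbhsE; exists (f @` (U `&` V)) => //; split.
    by apply: fo; exact: openI.
  by exists a.
move=> y [[b [Sb Vb] <-] [b' [Ub' Vb'] /(fi _ _ Vb' Vb) b'b]].
by exists b; split=> //; apply: UN; rewrite -b'b.
Qed.

Lemma image_compact_open (X Y : topologicalType) (f : X -> Y) (A : set X) :
  continuous f -> (forall U, open U -> open (f @` U)) ->
  compact_open A -> compact_open (f @` A).
Proof.
move=> fc fo [oA cA]; split; first exact: fo.
by apply: continuous_compact => //; exact: continuous_subspaceT.
Qed.

(* Preserving differences is enough, as [A `&` B = A `\` (A `\` B)]. *)
Section StonePoint.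
Variables (X Y : topologicalType) (t : set X -> set Y) (s : set Y -> set X).
Hypotheses (hX : hausdorff_space X) (bX : has_compact_open_base X).
Hypotheses (hY : hausdorff_space Y) (bY : has_compact_open_base Y).
Hypothesis tX : forall A, compact_open A -> compact_open (t A).
Hypothesis st : forall A, compact_open A -> s (t A) = A.
Hypothesis tD : forall A B, compact_open A -> compact_open B ->
  t (A `\` B) = t A `\` t B.

Lemma stone_point x : exists y, forall A, compact_open A -> (A x <-> t A y).
Proof.
have tI A B : compact_open A -> compact_open B -> t (A `&` B) = t A `&` t B.
  move=> cA cB; rewrite -setDD tD ?tD //; last exact: compact_openD.
  by rewrite setDD.
have t0 : t set0 = set0.
  have c0 : compact_open (set0 : set X) by split; [exact: open0|exact: compact0].
  by rewrite -(setDv set0) tD // setDv.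
have tn0 A : compact_open A -> A !=set0 -> t A !=set0.
  move=> cA [a Aa]; apply: contrapT => h.
  have tA0 : t A = set0 by apply/eqP; apply/negP => /negP/set0P.
  have c0 : compact_open (set0 : set X) by split; [exact: open0|exact: compact0].
  by have := st cA; rewrite tA0 -t0 (st c0) => A0; rewrite -A0 in Aa.
have [A0 [cA0 A0x _]] : exists A, [/\ compact_open A, A x & A `<=` setT].
  by apply: bX => //; exact: openT.
(* Filter generated by the images of the compact open neighbourhoods of [x]; the required [y] is a
   cluster point of it in the compact set [t A0]. *)
pose F : set_system Y := fun B =>
  exists A, [/\ compact_open A, A x & t A `<=` B].
have FF : ProperFilter F.
  apply: Build_ProperFilter_ex.
    by move=> B [A [cA Ax AB]]; have [|y ty] := tn0 A cA; [exists x|exists y;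
      exact: AB].
  split; first by exists A0.
    move=> B C [A [cA Ax AB]] [A' [cA' A'x AC]].
    exists (A `&` A'); split=> //; first exact: compact_openI.
    by rewrite tI // => y [/AB ? /AC].
  by move=> B C BC [A [cA Ax AB]]; exists A; split=> //; exact: subset_trans BC.
have [_ ctA0] := tX cA0.
have [|y [_ cly]] := ctA0 F FF.
  by exists A0; split=> //; exact: subset_refl.
have into A : compact_open A -> A x -> t A y.
  move=> cA Ax; have [otA ctA] := tX cA.
  apply: (compact_closed hY ctA) => N Ny.
  by apply: cly => //; exists A; split=> //; exact: subset_refl.
exists y => A cA; split; first exact: into.
(* A point [x] outside [A] lies in [A0 \ A], whose image avoids [t A]. *)
move=> tAy; apply: contrapT => nAx.
have : t (A0 `\` A) y by apply: into => //; exact: compact_openD.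
by rewrite tD // => -[].
Qed.

End StonePoint.

Section StoneDuality.
Variables (X Y : topologicalType) (t : set X -> set Y) (s : set Y -> set X).
Hypotheses (hX : hausdorff_space X) (bX : has_compact_open_base X).
Hypotheses (hY : hausdorff_space Y) (bY : has_compact_open_base Y).
Hypotheses (tX : forall A, compact_open A -> compact_open (t A))
  (sY : forall B, compact_open B -> compact_open (s B)).
Hypotheses (st : forall A, compact_open A -> s (t A) = A)
  (ts : forall B, compact_open B -> t (s B) = B).
Hypothesis tD : forall A B, compact_open A -> compact_open B ->
  t (A `\` B) = t A `\` t B.

(** Compact open sets separate points, which makes the point maps obtained from [t] and from [s]
    inverse to each other; preimages of compact open sets are given by [s] and [t], whence
    continuity. *)
Lemma stone_duality : exists (f : X -> Y) (g : Y -> X),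
  [/\ cancel f g, cancel g f, continuous f, continuous g &
      forall A x, compact_open A -> (A x <-> t A (f x))].
Proof.
have sD A B : compact_open A -> compact_open B -> s (A `\` B) = s A `\` s B.
  move=> cA cB; rewrite -{1}(ts cA) -{1}(ts cB) -tD ?st //; try exact: sY.
  by apply: compact_openD => //; exact: sY.
have /choice[f fE] := stone_point hX bX hY tX st tD.
have /choice[g gE] := stone_point hY bY hX sY ts sD.
have fg : cancel f g.
  move=> x; apply: contrapT => /(compact_open_sep hX bX)[A [cA Ag nAx]].
  apply: nAx; apply/(fE _ _ cA)/(gE _ _ (tX cA)).
  by rewrite st.
have gf : cancel g f.
  move=> y; apply: contrapT => /(compact_open_sep hY bY)[A [cA Ag nAx]].
  apply: nAx; apply/(gE _ _ cA)/(fE _ _ (sY cA)).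
  by rewrite ts.
exists f, g; split=> //; last by move=> A x; exact: fE.
- apply/continuousP => B oB; apply: open_local => x Bfx.
  have [A [cA Ax AB]] := bY oB Bfx.
  exists (s A); split; [by case: (sY cA)| |].
    by apply/fE; [exact: sY|rewrite ts].
  by move=> z /(fE _ _ (sY cA)); rewrite ts // => /AB.
- apply/continuousP => B oB; apply: open_local => x Bfx.
  have [A [cA Ax AB]] := bX oB Bfx.
  exists (t A); split; [by case: (tX cA)| |].
    by apply/gE; [exact: tX|rewrite st].
  by move=> z /(gE _ _ (tX cA)); rewrite st // => /AB.
Qed.

End StoneDuality.

(** * Steinberg functions *)

Section SteinbergFunctions.
Variables (R : comPzRingType) (G : groupoid).
Implicit Types (f g : garr G -> R) (A : set (garr G)).

Lemma open_level f r : locally_constant f -> open [set a | f a = r].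
Proof.
move=> lf; rewrite openE => a /= far; rewrite /interior /=.
by apply: filterS (lf a) => b /= ->.
Qed.

Lemma open_level_pred f (P : R -> Prop) : locally_constant f ->
  open [set a | P (f a)].
Proof.
move=> lf; rewrite openE => a /= far; rewrite /interior /=.
by apply: filterS (lf a) => b /= ->.
Qed.

Lemma closed_support f : locally_constant f -> closed (support f).
Proof.
move=> lf; rewrite (_ : support f = ~` [set a | f a = 0]) //.
exact/open_closedC/open_level.
Qed.

Lemma open_support f : locally_constant f -> open (support f).
Proof. exact: open_level_pred. Qed.

Lemma steinbergP f :
  steinberg f <-> locally_constant f /\ compact (support f).
Proof.
have cl : locally_constant f -> closure (support f) = support f.
  by move=> /closed_support/closure_id.
by split=> -[lf]; rewrite /steinberg /= cl.
Qed.

Lemma compact_open_support f : steinberg f -> compact_open (support f).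
Proof. by move/steinbergP => [lf cf]; split=> //; exact: open_support. Qed.

Lemma locally_constant_op2 (op : R -> R -> R) f g :
  locally_constant f -> locally_constant g ->
  locally_constant (fun a => op (f a) (g a)).
Proof.
by move=> lf lg a; apply: (filterS _ (filterI (lf a) (lg a))) => b /= [-> ->].
Qed.

Lemma locally_constant_op1 (op : R -> R) f :
  locally_constant f -> locally_constant (fun a => op (f a)).
Proof. by move=> lf a; apply: filterS (lf a) => b ->. Qed.

Lemma steinberg_sub f g : locally_constant g -> steinberg f ->
  (support g `<=` support f) -> steinberg g.
Proof.
move=> lg /steinbergP[lf cf] gf; apply/steinbergP; split=> //.
by apply: subclosed_compact cf gf; exact: closed_support.
Qed.

Lemma steinbergD f g : steinberg f -> steinberg g ->
  steinberg (fun a => f a + g a).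
Proof.
move=> /steinbergP[lf cf] /steinbergP[lg cg].
have lfg := locally_constant_op2 +%R lf lg.
apply/steinbergP; split=> //.
apply: subclosed_compact (compactU cf cg) _; first exact: closed_support.
move=> a n0; have [f0|f0] := pselect (f a = 0); last by left.
by right=> g0; apply: n0; rewrite /= f0 g0 addr0.
Qed.

Lemma steinbergZ k f : steinberg f -> steinberg (fun a => k * f a).
Proof.
move=> sf; apply: (steinberg_sub _ sf).
  by case: sf => lf _; exact: (locally_constant_op1 (fun r => k * r)).
by move=> a n0 f0; apply: n0; rewrite /= f0 mulr0.
Qed.

Lemma steinberg0 : steinberg ((fun=> 0) : garr G -> R).
Proof.
apply/steinbergP; split; first by move=> a; exact: filterE.
rewrite (_ : support _ = set0); first exact: compact0.
by apply/seteqP; split=> a //; apply.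
Qed.

Hypothesis hG : hausdorff_groupoid G.

Lemma steinberg_indic A : compact_open A -> steinberg (\1_A : garr G -> R).
Proof.
move=> [oA cA]; have clA : closed A by exact: compact_closed.
have lA : locally_constant (\1_A : garr G -> R).
  move=> a; have [Aa|nAa] := pselect (A a).
    have nA : nbhs a A by apply: open_nbhs_nbhs; split.
    by apply: filterS nA => b Ab; rewrite /= !indic_eq1.
  have nA : nbhs a (~` A).
    by apply: open_nbhs_nbhs; split=> //; exact: closed_openC.
  by apply: filterS nA => b Ab; rewrite /= !indic_eq0.
apply/steinbergP; split=> //; apply: subclosed_compact cA _.
  exact: closed_support.
by move=> a; exact: indic_neq0.
Qed.

End SteinbergFunctions.

(* [M] is tested on sets [A] carrying some [e] in [M] that is [1] on [A] and
   keeps [f] inside [M]; such sets are stable under finite unions through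
   [e + e' - e e']. *)
Lemma steinberg_generated (R : comPzRingType) (G : groupoid)
    (M : set (garr G -> R)) :
  M (fun=> 0) ->
  (forall f g, M f -> M g -> M (fun a => f a + g a)) ->
  (forall k f, M f -> M (fun a => k * f a)) ->
  (forall f g, M f -> M g -> M (fun a => f a * g a)) ->
  (forall a (U : set (garr G)), open U -> U a ->
     exists A : set (garr G), [/\ open A, A a, A `<=` U & M (\1_A)]) ->
  steinberg (R := R) (G := G) `<=` M.
Proof.
move=> M0 MD MZ MM Mb f /steinbergP[lf cf].
pose P A := exists e, [/\ M e, forall a, A a -> e a = 1 & M (fun a => e a * f a)].
have [e [Me e1 Mef]] : P (support f).
  apply: (compact_ind (P := P) cf).
  - exists (fun=> 0); split=> //; rewrite (_ : (fun a => _) = fun=> 0) //.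
    by apply/funext => a; rewrite mul0r.
  - move=> A B [e [Me e1 Mef]] [e' [Me' e1' Mef']].
    exists (fun a => e a + e' a + -1 * (e a * e' a)); split.
    + by apply: (MD _ _); [exact: MD|apply: (MZ _ _); exact: MM].
    + move=> a [/e1 ->|/e1' ->].
        by rewrite mul1r mulN1r addrK.
      by rewrite mulr1 mulN1r addrC addKr.
    rewrite (_ : (fun a => _) =
      (fun a => (e a * f a + e' a * f a) + -1 * (e a * (e' a * f a)))).
      by apply: (MD _ _); [exact: MD|apply: (MZ _ _); exact: (MM _ _)].
    by apply/funext => a; rewrite !mulrDl !mulrA.
  - move=> A B AB [e [Me e1 Mef]]; exists e; split=> // a /AB; exact: e1.
  move=> a fa; have [A [oA Aa Al MA]] := Mb a _ (open_level (f a) lf) erefl.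
  exists A; split=> //; exists (\1_A); split=> //.
    by move=> b Ab; rewrite indic_eq1.
  rewrite (_ : (fun b => _) = (fun b => f a * \1_A b)); first exact: MZ.
  apply/funext => b; have [Ab|Ab] := pselect (A b).
    by rewrite indic_eq1 // mul1r mulr1; exact: Al.
  by rewrite indic_eq0 // mul0r mulr0.
rewrite (_ : f = fun a => e a * f a) //; apply/funext => a.
have [->|fa] := pselect (f a = 0); first by rewrite mulr0.
by rewrite e1 // mul1r.
Qed.

(** * Compact open bisections *)

Definition bisection (G : groupoid) (A : set (garr G)) : Prop :=
  (forall a b, A a -> A b -> gdom a = gdom b -> a = b) /\
  (forall a b, A a -> A b -> gran a = gran b -> a = b).

(* Continuity of the multiplication is left out: products of compact open
   bisections are recognized as compact open because the algebra is closed under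
   convolution. *)
Record ample_facts (G : groupoid) : Prop := AmpleFacts {
  af_obj : hausdorff_space (gobj G);
  af_arr : hausdorff_space (garr G);
  af_base : has_compact_open_base (gobj G);
  af_dom : continuous (@gdom G);
  af_dom_open : forall U : set (garr G), open U -> open (@gdom G @` U);
  af_inv : continuous (@ginv G);
  af_unit : continuous (@gunit G);
  af_unit_open : open (range (@gunit G));
  af_bisection : forall (a : garr G) U, open U -> U a ->
    exists A, [/\ compact_open A, bisection A, A a & A `<=` U]
}.

Lemma open_local_homeomorphism (X Y : topologicalType) (f : X -> Y) (O : set X) :
  local_homeomorphism f -> open O -> open (f @` O).
Proof.
move=> lf oO; apply: open_local => _ [x Ox <-].
have [U [g [[oU Ux ofU] [_ gc gK]]]] := lf x.
have og : open ((f @` U) `&` g @^-1` O).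
  by move: gc; rewrite continuous_open_subspace // continuous_inP //; apply.
exists ((f @` U) `&` g @^-1` O); split=> //.
  by split; [exists x|rewrite /preimage /= gK ?inE].
move=> _ [[u Uu <-]]; rewrite /preimage /= gK ?inE // => Ou.
by exists u.
Qed.

Lemma ample_ample_facts (G : groupoid) :
  ample G -> hausdorff_groupoid G -> ample_facts G.
Proof.
move=> [[[cd cr cu ci _] ld] hO [B [oB Bb] Bc]] hG.
have dop U : open U -> open (@gdom G @` U) by exact: open_local_homeomorphism.
have bO : has_compact_open_base (gobj G).
  move=> x U oU Ux; have [|A [BA Ax] AU] := Bb x U; first exact: open_nbhs_nbhs.
  by exists A; split=> //; split; [exact: oB|exact: Bc].
have dinj (a : garr G) : exists U, [/\ open U, U a &
    forall b c, U b -> U c -> gdom b = gdom c -> b = c].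
  have [U [g [[oU Ua _] [_ _ gK]]]] := ld a; exists U; split=> // b c Ub Uc bc.
  by rewrite -(gK b) ?inE // bc gK ?inE.
split=> //.
- apply: open_local => _ [x _ <-].
  (* An arrow [b] close to a unit and the unit [gunit (gdom b)] lie in one set on which [gdom] is
     injective and have the same domain, so [b] is that unit. *)
  have [N [oN Nx Ninj]] := dinj (gunit x).
  have oM : open (N `&` (fun b => gunit (gdom b)) @^-1` N).
    apply: openI => //; apply: open_comp => // b _.
    by apply: continuous_comp; [exact: cd|exact: cu].
  exists (N `&` (fun b => gunit (gdom b)) @^-1` N); split=> //.
    by split=> //; rewrite /preimage /= gdom_unit.
  move=> b [Nb Nub]; exists (gdom b) => //.
  by apply: Ninj => //; rewrite gdom_unit.
- move=> a U oU Ua; have [N [oN Na Ninj]] := dinj a.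
  have [N' [oN' Na' Ninj']] := dinj (ginv a).
  (* Both [gdom] and [gran] are injective on [V]; compactness is then obtained by cutting [V] over a
     compact open set of domains. *)
  pose V := U `&` (N `&` @ginv G @^-1` N').
  have oV : open V.
    by apply: openI => //; apply: openI => //; apply: open_comp => // b _;
      exact: ci.
  have [W [cW Wa WV]] : exists A, [/\ compact_open A,
    A (gdom a) & A `<=` @gdom G @` V].
    by apply: bO; [exact: dop|exists a].
  have oA : open (V `&` @gdom G @^-1` W).
    by apply: openI => //; apply: open_comp => [b _|]; [exact: cd|case: cW].
  have iA b c : (V `&` @gdom G @^-1` W) b -> (V `&` @gdom G @^-1` W) c ->
      gdom b = gdom c -> b = c.
    by move=> [[_ [Nb _]] _] [[_ [Nc _]] _]; exact: Ninj.
  exists (V `&` @gdom G @^-1` W); split.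
  + split=> //; apply: compact_open_image_inj dop oA iA _.
    rewrite (_ : _ @` _ = W); first by case: cW.
    apply/seteqP; split=> [_ [b [_ Wb] <-] //|x Wx].
    by have [b Vb bx] := WV x Wx; exists b => //; split=> //;
      rewrite /preimage /= bx.
  + split=> // b c [[_ [_ Nb]] _] [[_ [_ Nc]] _] bc.
    by apply: ginv_inj; apply: Ninj' => //; rewrite !gdom_inv.
  + by [].
  + by move=> b [[]].
Qed.

Section AmpleFacts.
Variables (R : comPzRingType) (G : groupoid).
Hypothesis aG : ample_facts G.
Implicit Types (U V : set (garr G)) (W : set (gobj G)).

Let hG : hausdorff_groupoid G := af_arr aG.

Lemma continuous_gran : continuous (@gran G).
Proof.
rewrite (_ : @gran G = fun a => gdom (ginv a)).
  by move=> a; apply: continuous_comp; [exact: af_inv|exact: af_dom].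
by apply/funext => a; rewrite gdom_inv.
Qed.

Lemma ginv_image U : @ginv G @` U = @ginv G @^-1` U.
Proof.
apply/seteqP; split=> [_ [a Ua <-]|a Ua]; first by rewrite /preimage /= ginvK.
by exists (ginv a) => //; rewrite ginvK.
Qed.

Lemma ginv_imageK U : @ginv G @` (@ginv G @` U) = U.
Proof. by rewrite !ginv_image -comp_preimage (_ : _ \o _ = id) //;
  apply/funext/ginvK. Qed.

Lemma compact_open_inv U : compact_open U -> compact_open (@ginv G @` U).
Proof.
apply: image_compact_open; first exact: af_inv.
by move=> V oV; rewrite ginv_image; apply: open_comp => // a _; exact: af_inv.
Qed.

Lemma bisection_inv U : bisection U -> bisection (@ginv G @` U).
Proof.
move=> [dU rU]; split=> _ _ [a Ua <-] [b Ub <-]; rewrite ?gdom_inv ?gran_inv.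
  by move=> /rU ->.
by move=> /dU ->.
Qed.

Lemma compact_open_dom U : compact_open U -> compact_open (@gdom G @` U).
Proof.
by apply: image_compact_open; [exact: af_dom|exact: af_dom_open].
Qed.

Lemma gran_image U : @gran G @` U = @gdom G @` (@ginv G @` U).
Proof.
apply/seteqP; split=> [_ [a Ua <-]|_ [_ [a Ua <-] <-]].
  by exists (ginv a); [exists a|rewrite gdom_inv].
by exists a => //; rewrite gdom_inv.
Qed.

Lemma compact_open_ran U : compact_open U -> compact_open (@gran G @` U).
Proof. by move=> cU; rewrite gran_image;
  exact/compact_open_dom/compact_open_inv. Qed.

Lemma open_dom_preimage W : open W -> open (@gdom G @^-1` W).
Proof. by move=> oW; apply: open_comp => // a _; exact: af_dom. Qed.

Lemma open_ran_preimage W : open W -> open (@gran G @^-1` W).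
Proof. by move=> oW; apply: open_comp => // a _; exact: continuous_gran. Qed.

Lemma closed_compact_open (X Y : topologicalType) (f : X -> Y) (B : set Y) :
  hausdorff_space Y -> continuous f -> compact_open B -> closed (f @^-1` B).
Proof.
by move=> hY cf [oB cB]; apply: preimage_closed => [x _|];
  [exact: cf|exact: compact_closed].
Qed.

Lemma compact_open_dom_restr U W : compact_open U -> compact_open W ->
  compact_open (U `&` @gdom G @^-1` W).
Proof.
move=> [oU cU] cW; split.
  by apply: openI => //; apply: open_dom_preimage; case: cW.
apply: compact_closedI => //.
by apply: closed_compact_open cW; [exact: af_obj|exact: af_dom].
Qed.

Lemma compact_open_ran_restr U W : compact_open U -> compact_open W ->
  compact_open (U `&` @gran G @^-1` W).
Proof.
move=> [oU cU] cW; split.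
  by apply: openI => //; apply: open_ran_preimage; case: cW.
apply: compact_closedI => //.
by apply: closed_compact_open cW; [exact: af_obj|exact: continuous_gran].
Qed.

Lemma bisection_sub U V : U `<=` V -> bisection V -> bisection U.
Proof.
by move=> UV [dV rV]; split=> a b /UV Va /UV Vb; [exact: dV|exact: rV].
Qed.

Lemma unit_imageE W : @gunit G @` W = range (@gunit G) `&` @gdom G @^-1` W.
Proof.
apply/seteqP; split=> [_ [x Wx <-]|_ [[x _ <-]]].
  by split; [exists x|rewrite /preimage /= gdom_unit].
by rewrite /preimage /= gdom_unit => Wx; exists x.
Qed.

Lemma unit_image_unit W x : (@gunit G @` W) (gunit x) = W x.
Proof.
apply/propext; split=> [[y Wy /gunit_inj <-] //|Wx]; by exists x.
Qed.

Lemma compact_open_unit W : compact_open W -> compact_open (@gunit G @` W).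
Proof.
move=> [oW cW]; split.
  by rewrite unit_imageE; apply: openI;
    [exact: af_unit_open|exact: open_dom_preimage].
by apply: continuous_compact => //; apply: continuous_subspaceT; exact: af_unit.
Qed.

(** The idempotent of the diagonal belonging to [W]: as a right factor it cuts a function to domains
    in [W], as a left factor to ranges in [W]. *)
Definition unit_indic W : garr G -> R := \1_(@gunit G @` W).

Lemma support_unit_indic W : support (unit_indic W) `<=` range (@gunit G).
Proof. by move=> a n0; have [x _ <-] := indic_neq0 n0; exists x. Qed.

Lemma unit_indicE W x : unit_indic W (gunit x) = \1_W x.
Proof.
have [Wx|Wx] := pselect (W x).
  by rewrite /unit_indic !indic_eq1 // unit_image_unit.
by rewrite /unit_indic !indic_eq0 // unit_image_unit.
Qed.

Lemma diagonal_unit_indic W : compact_open W -> diagonal (unit_indic W).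
Proof.
move=> cW; split; last exact: support_unit_indic.
by apply: steinberg_indic => //; exact: compact_open_unit.
Qed.

Lemma conv_unit_indicr f W : conv f (unit_indic W) = fun a => f a * \1_W (gdom a).
Proof.
apply/funext => a; rewrite conv_diagr ?unit_indicE //.
exact: support_unit_indic.
Qed.

Lemma conv_unit_indicl f W : conv (unit_indic W) f = fun a => \1_W (gran a) * f a.
Proof.
apply/funext => a; rewrite conv_diagl ?unit_indicE //.
exact: support_unit_indic.
Qed.

Lemma diagonal_eq (f g : garr G -> R) : support f `<=` range (@gunit G) ->
  support g `<=` range (@gunit G) ->
  (forall x, f (gunit x) = g (gunit x)) -> f = g.
Proof.
move=> sf sg fg; apply/funext => a.
have [[x _ <-] //|na] := pselect (range (@gunit G) a).
have /contrapT -> : ~ f a <> 0 by move=> /sf.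
by have /contrapT -> : ~ g a <> 0 by move=> /sg.
Qed.

(** Convolution of diagonal functions is pointwise multiplication on units, so every value is an
    idempotent of [R], that is 0 or 1. *)
Lemma diagonal_idempotent f : indecomposable R -> diagonal f ->
  conv f f = f -> exists2 W, compact_open W & f = unit_indic W.
Proof.
move=> [n01 hR] [sf df] ff.
have idf x : f (gunit x) = 0 \/ f (gunit x) = 1.
  apply: hR; have := congr1 (fun h => h (gunit x)) ff.
  by rewrite conv_diagl // gran_unit.
have [osf csf] := compact_open_support sf.
exists (@gunit G @^-1` support f).
  split; first by apply: open_comp => // x _; exact: af_unit.
  have -> : @gunit G @^-1` support f = @gdom G @` support f.
    apply/seteqP; split=> [x fx|_ [a fa <-]].
      by exists (gunit x) => //; rewrite gdom_unit.
    by have [x _ xa] := df a fa; rewrite -xa gdom_unit /preimage /= xa.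
  by apply: continuous_compact => //; apply: continuous_subspaceT; exact: af_dom.
apply: diagonal_eq => //; first exact: support_unit_indic.
move=> x; rewrite unit_indicE; case: (idf x) => fx; rewrite fx.
  by rewrite indic_eq0 // => nf; exact: nf fx.
by rewrite indic_eq1 // /preimage /support /= fx => e; apply: n01.
Qed.

Lemma unit_indic_inj W W' : 0 <> 1 :> R -> unit_indic W = unit_indic W' -> W = W'.
Proof.
move=> n01 e; apply/funext => x; apply/propext.
have := congr1 (fun h => h (gunit x)) e; rewrite !unit_indicE.
have [Wx|Wx] := pselect (W x); have [Wx'|Wx'] := pselect (W' x) => //.
  by rewrite indic_eq1 // indic_eq0 // => /esym.
by rewrite indic_eq0 // indic_eq1 // => /n01.
Qed.

Lemma conv_unit_indic W W' :
  conv (unit_indic W) (unit_indic W') = unit_indic (W `&` W').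
Proof.
apply: diagonal_eq; rewrite ?conv_unit_indicr.
- move=> a n0; apply: (@support_unit_indic W) => a0; apply: n0.
  by rewrite /= a0 mul0r.
- exact: support_unit_indic.
by move=> x; rewrite !unit_indicE gdom_unit indicI.
Qed.

Lemma conv_indic_dom U f a b : bisection U -> U b -> gdom b = gdom a ->
  conv f (\1_U : garr G -> R) a = f (gmul a (ginv b)).
Proof.
move=> [dU _] Ub ba; rewrite (@conv_single _ _ _ _ _ b) //.
  by rewrite indic_eq1 // mulr1.
move=> c ca n0; apply: dU => //; last by rewrite ba.
by apply: (@indic_neq0 R) => c0; apply: n0; rewrite c0 mulr0.
Qed.

Lemma conv_indic_eq0 U f a :
  (forall b, U b -> gdom b <> gdom a) -> conv f (\1_U : garr G -> R) a = 0.
Proof.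
move=> nU; apply: conv_eq0 => b ba; rewrite indic_eq0 ?mulr0 // => /nU.
exact.
Qed.

(** In the inverse semigroup of bisections [U U^-1] is the set of units over the ranges of [U]: if
    [b] and [a b] both lie in [U], they have the same domain, hence are equal and [a] is a unit. *)
Lemma conv_indic_inv U : bisection U ->
  conv (\1_U : garr G -> R) (\1_(@ginv G @` U) : garr G -> R) =
    unit_indic (@gran G @` U).
Proof.
move=> bU; apply/funext => a.
have [[b Ub ba]|nb] := pselect (exists2 b, U b & gran b = gdom a); last first.
  rewrite conv_indic_eq0; last first.
    by move=> _ [b Ub <-]; rewrite gdom_inv => ba; apply: nb; exists b.
  rewrite /unit_indic indic_eq0 // => -[x [b Ub bx] xa].
  by apply: nb; exists b => //; rewrite bx -xa gdom_unit.
rewrite (@conv_indic_dom _ _ _ (ginv b)); [|exact: bisection_inv| by exists b|];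
  last by rewrite gdom_inv.
rewrite ginvK; have [Uab|nUab] := pselect (U (gmul a b)).
  have ab : gdom a = gran b by [].
  have e : gmul a b = b by case: bU => dU _; apply: dU => //; rewrite gdom_mul.
  rewrite indic_eq1 //.
  have aE : a = gunit (gran b).
    by apply: (@gmul_injr _ _ _ b) => //; rewrite ?gdom_unit // e gmul1l.
  by rewrite /unit_indic indic_eq1 // aE unit_image_unit; exists b.
rewrite indic_eq0 // /unit_indic indic_eq0 // => -[x [b' Ub' b'x] xa].
apply: nUab; rewrite -xa gmul_unitl //.
by rewrite -(gdom_unit x) xa ba.
Qed.

Lemma conv_inv_indic U : bisection U ->
  conv (\1_(@ginv G @` U) : garr G -> R) (\1_U : garr G -> R) =
    unit_indic (@gdom G @` U).
Proof.
move=> bU; have := conv_indic_inv (bisection_inv bU).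
by rewrite gran_image ginv_imageK.
Qed.

End AmpleFacts.

(** * Boundary paths *)

Section BoundaryPaths.
Variable E : digraph.
Implicit Types (a b k : fpath E) (x y z : bpath E) (v : vert E) (e : edge E).

Lemma bpathP x : boundary_path (val x).
Proof. by apply/asboolP; exact: (valP x). Qed.

Definition mkbpath (r : rawpath E) (h : boundary_path r) : bpath E :=
  exist _ r (asboolT h).

Lemma pcat_nil v (r : rawpath E) : v = start r -> pcat (v, [::]) r = r.
Proof.
case: r => [[w p]|u] /= -> //; congr Inf; apply/funext => n.
by rewrite subn0.
Qed.

Lemma boundary_edge e (r : rawpath E) : rng e = start r -> boundary_path r ->
  boundary_path (pcat (src e, [:: e]) r).
Proof.
case: r => [[w p]|u] /= er; first by rewrite /is_fpath /fend /= er => -[? ?].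
move=> ub [|n] /=; first by rewrite subnn.
by rewrite !subn1 /= ub.
Qed.

Lemma boundary_pcat a (r : rawpath E) : is_fpath a -> fend a = start r ->
  boundary_path r -> boundary_path (pcat a r).
Proof.
case: a => [v p]; rewrite /is_fpath /fend /=.
elim: p v => [|e p IH] v /=; first by move=> _ vr; rewrite pcat_nil.
move=> [<- pp] pr br.
have -> : pcat (src e, e :: p) r = pcat (src e, [:: e]) (pcat (rng e, p) r).
  by rewrite -pcat_fcat.
apply: boundary_edge; last exact: IH.
by rewrite start_pcat.
Qed.

Lemma cat_of_ex a y : is_fpath a -> fend a = start (val y) ->
  exists x, cat_of a y x.
Proof.
move=> fa ay; exists (mkbpath (boundary_pcat fa ay (bpathP y))).
by split.
Qed.

Lemma cat_of_fun a y x x' : cat_of a y x -> cat_of a y x' -> x = x'.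
Proof. by move=> [_ _ xE] [_ _ x'E]; apply: val_inj; rewrite xE x'E. Qed.

Lemma pcat_inj a (r r' : rawpath E) : fend a = start r -> fend a = start r' ->
  pcat a r = pcat a r' -> r = r'.
Proof.
move=> ar ar' e; have [k [ak aE rE]] := pcat_split (leqnn _) (erefl a.1) ar e.
have k2 : k.2 = [::].
  by move/(congr1 (@flen E)): aE; case: (k) => w [|f q] //;
    rewrite /flen size_cat /=; lia.
by rewrite rE; case: k ak k2 {aE rE} => w q /= ak ->; rewrite pcat_nil // -ak ar'.
Qed.

Lemma cat_of_inj a y y' x : cat_of a y x -> cat_of a y' x -> y = y'.
Proof.
move=> [fa ay xE] [_ ay' xE']; apply: val_inj.
by apply: (pcat_inj ay ay'); rewrite -xE.
Qed.

Lemma cat_of_start a y x : cat_of a y x -> start (val x) = a.1.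
Proof. by move=> [fa ay ->]; rewrite start_pcat. Qed.

Lemma cylinder_start a x : cylinder a x -> start (val x) = a.1.
Proof. by move=> [y /cat_of_start]. Qed.

Lemma cylinder_fpath a x : cylinder a x -> is_fpath a.
Proof. by move=> [y []]. Qed.

Lemma cylinder_vpath v x : cylinder (vpath v) x <-> start (val x) = v.
Proof.
split=> [/cylinder_start //|<-]; exists x; exact: cat_of_vpath.
Qed.

Lemma cat_of_vpathE v y x : cat_of (vpath v) y x <-> y = x /\ start (val x) = v.
Proof.
split=> [h|[-> <-]]; last exact: cat_of_vpath.
have xv := cat_of_start h; split=> //; apply: (cat_of_inj h).
by rewrite /= in xv; rewrite -xv; exact: cat_of_vpath.
Qed.

Lemma cat_of_trans a k y z x :
  cat_of k z y -> cat_of a y x -> cat_of (fcat a k) z x.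
Proof.
move=> zy yx; have yk := cat_of_start zy; have [fk kz yE] := zy.
by apply: (cat_of_fcat _ fk kz yE yx); case: yx => _ ->.
Qed.

Lemma cat_of_split a k z x : fend a = k.1 -> cat_of (fcat a k) z x ->
  exists2 y, cat_of k z y & cat_of a y x.
Proof.
move=> ak [/(is_fpath_fcat ak)[fa fk]]; rewrite fend_fcat // pcat_fcat => kz xE.
have [y zy] := cat_of_ex fk kz; exists y => //.
have yk := cat_of_start zy; have [_ _ yE] := zy.
by split; rewrite // ?yk ?yE.
Qed.

Lemma cylinder_fcat a k x : fend a = k.1 -> cylinder (fcat a k) x -> cylinder a x.
Proof. by move=> ak [z /(cat_of_split ak)[y _ yx]]; exists y. Qed.

Lemma cylinder_comparable a b x : cylinder a x -> cylinder b x ->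
  (flen a <= flen b)%N -> exists2 k, fend a = k.1 /\ is_fpath k & b = fcat a k.
Proof.
move=> ax bx ab; have fb := cylinder_fpath bx.
have ab1 : a.1 = b.1 by rewrite -(cylinder_start ax) (cylinder_start bx).
have [y [fa ay xE]] := ax; have [z [_ bz xE']] := bx.
have [|k [ak bE _]] := pcat_split ab ab1 ay (y := val z); first by rewrite -xE.
exists k => //; split=> //.
by move: fb; rewrite bE => /(is_fpath_fcat ak)[].
Qed.

Lemma cat_of_comparable a k y z x : fend a = k.1 -> cat_of a y x ->
  cat_of (fcat a k) z x -> cat_of k z y.
Proof.
move=> ak yx /(cat_of_split ak)[y' zy' y'x].
by rewrite (cat_of_inj yx y'x).
Qed.

Lemma fcatA a b k : fcat a (fcat b k) = fcat (fcat a b) k.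
Proof. by rewrite /fcat /= catA. Qed.

Lemma fcat_size0 a k : fend a = k.1 -> k.2 = [::] -> fcat a k = a.
Proof. by case: a k => [v p] [w q] /= _ ->; rewrite /fcat /= cats0. Qed.

Lemma flen_fcat a k : flen (fcat a k) = (flen a + flen k)%N.
Proof. by rewrite /flen size_cat. Qed.

Definition fpath_rcons a e : fpath E := (a.1, rcons a.2 e).

Lemma fpath_rconsE a e : fpath_rcons a e = fcat a (src e, [:: e]).
Proof. by rewrite /fpath_rcons /fcat cats1. Qed.

Lemma is_fpath_rcons a e : is_fpath a -> fend a = src e ->
  is_fpath (fpath_rcons a e).
Proof. by move=> fa ae; rewrite fpath_rconsE; apply/is_fpath_fcat. Qed.

Lemma is_fpath_rconsP a e : is_fpath (fpath_rcons a e) -> is_fpath a /\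
  fend a = src e.
Proof.
case: a => [v p]; rewrite /fpath_rcons /is_fpath /fend /=.
elim: p v => [|f p IH] v /= => [[-> _] //|[-> /IH[? ?]]].
by split.
Qed.

Lemma fend_fpath_rcons a e : fend (fpath_rcons a e) = rng e.
Proof. by rewrite /fpath_rcons /fend /= map_rcons last_rcons. Qed.

Lemma cylinder_fpath_rcons a e x : cylinder (fpath_rcons a e) x -> cylinder a x.
Proof.
move=> h; have [fa ae] := is_fpath_rconsP (cylinder_fpath h).
by move: h; rewrite fpath_rconsE; exact: cylinder_fcat.
Qed.

Lemma cylinder_fpath_rcons_inj a e f x :
  cylinder (fpath_rcons a e) x -> cylinder (fpath_rcons a f) x -> e = f.
Proof.
move=> ex fx; have [|k [ak _] bE] := cylinder_comparable ex fx.
  by rewrite /flen /= !size_rcons.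
have := congr1 (fun b : fpath E => b.2) bE; have := congr1 (@flen E) bE.
rewrite flen_fcat /flen /= !size_rcons; case: (k) => w [|g q] /=; last lia.
by rewrite cats0 => _ /rcons_inj[].
Qed.

Lemma bpath_tail x :
  (exists e y, rng e = start (val y) /\ cat_of (epath e) y x) \/
  val x = Fin (vpath (start (val x))) /\
    (sink (start (val x)) \/ infinite_emitter (start (val x))).
Proof.
case: x => [[[v [|e p]]|u] h] /=; have /asboolP bx := h.
- by right; case: bx.
- left; have [[/= se fp] bd] := bx.
  have by_ : boundary_path (Fin (rng e, p)) by split.
  by exists e, (mkbpath by_); split=> //; split=> //=; rewrite /epath /= se.
- left; have by_ : boundary_path (Inf (fun n => u n.+1)) by move=> n; exact: bx.
  exists (u 0%N), (mkbpath by_); split; first exact: (bx 0%N).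
  split; [by []|exact: (bx 0%N)|] => /=.
  congr Inf; apply/funext => -[|n] //=.
  by rewrite subn1.
Qed.

Lemma cylinder_next a x : cylinder a x ->
  (exists e, cylinder (fpath_rcons a e) x) \/
  [/\ val x = Fin a & sink (fend a) \/ infinite_emitter (fend a)].
Proof.
move=> [y yx]; have [fa ay xE] := yx.
case: (bpath_tail y) => [[e [z [ez zy]]]|[yE ybd]].
  left; exists e; exists z; rewrite fpath_rconsE; exact: (cat_of_trans zy yx).
by right; rewrite xE yE /= cats0 ay -surjective_pairing.
Qed.

Lemma cylinder_take n x : (exists2 a, cylinder a x & flen a = n) \/
  exists2 a, val x = Fin a & (flen a < n)%N.
Proof.
elim: n => [|n [[a ax an]|[a xE an]]].
- by left; exists (vpath (start (val x))) => //; exact/cylinder_vpath.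
- case: (cylinder_next ax) => [[e ex]|[xE _]].
    by left; exists (fpath_rcons a e) => //; rewrite /flen /= size_rcons -an.
  by right; exists a; rewrite ?an.
- by right; exists a => //; rewrite ltnS ltnW.
Qed.

(** A vertex from which no boundary path starts is not a sink, and its edges lead to vertices of the
    same kind; following such edges yields an infinite path, which is a boundary path after all.
    Cylinders of paths are therefore nonempty. *)
Lemma bpath_from v : exists x, start (val x) = v.
Proof.
apply: contrapT => nv.
pose B w := ~ exists x, start (val x) = w.
have next w : B w -> exists e, src e = w /\ B (rng e).
  move=> Bw; have nsw : ~ sink w.
    move=> sw; apply: Bw.
    have bw : boundary_path (Fin (vpath w)) by split=> //; left.
    by exists (mkbpath bw).
  have [e ew] : exists e, src e = w.
    apply: contrapT => ne; apply: nsw; apply/seteqP; split=> // e ew.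
    by apply: ne; exists e.
  exists e; split=> // -[y ye]; apply: Bw.
  have [x yx] : exists x, cat_of (epath e) y x by apply: cat_of_ex; rewrite ?ye.
  by exists x; rewrite (cat_of_start yx).
have [e0 [e0v _]] := next v nv.
have /choice[f fP] : forall w, exists e, B w -> src e = w /\ B (rng e).
  move=> w; have [/next[e]|nBw] := pselect (B w); first by exists e.
  by exists e0 => /nBw.
pose w n := iter n (fun w => rng (f w)) v.
have Bw n : B (w n) by elim: n => //= n /fP[].
have bu : boundary_path (Inf (fun n => f (w n))).
  by move=> n; have [] := fP _ (Bw n.+1) => ->.
by apply: (nv); exists (mkbpath bu) => /=; have [] := fP _ nv.
Qed.

Lemma cylinder_nonempty a : is_fpath a -> cylinder a !=set0.
Proof.
move=> fa; have [y ya] := bpath_from (fend a).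
by have [x yx] := cat_of_ex fa (esym ya); exists x; exists y.
Qed.

(** * The topology of the boundary path space *)

Definition ncylinder a (s : seq (edge E)) : set (bpath E) :=
  cylinder a `\` [set x | exists2 e, e \in s & cylinder (fpath_rcons a e) x].

Lemma ncylinder_nil a : ncylinder a [::] = cylinder a.
Proof.
apply/seteqP; split=> [x []//|x ax]; split=> // -[e].
by rewrite in_nil.
Qed.

Lemma open_ncylinder a s : is_fpath a -> open (ncylinder a s).
Proof.
move=> fa.
exists [set ncylinder a s] => [_ ->|]; last by rewrite bigcup_set1.
exists [fset (ncylinder a s)]%fset; first by move=> B /fset1P ->; rewrite inE;
  exists a, s.
by apply/seteqP; split=> x; [move=> h;
  exact: (h _ (fset11 (ncylinder a s)))|move=> ax B /fset1P ->].
Qed.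

(* A prefix strictly longer than [a] determines the edge following [a]. *)
Lemma cylinder_sub_ncylinder a k s x : fend a = k.1 -> k.2 <> [::] ->
  cylinder (fcat a k) x -> ncylinder a s x ->
  cylinder (fcat a k) `<=` ncylinder a s.
Proof.
move=> ak k0 kx [ax nx] x' kx'; split; first exact: cylinder_fcat kx'.
case: k k0 ak kx kx' => [w [|f q]] //= _ ak kx kx' [e es ex'].
have fk := cylinder_fpath kx.
have [_ [/= sf _]] := (is_fpath_fcat (a := a) (b := (w, f :: q)) ak).1 fk.
have kE : fcat a (w, f :: q) = fcat (fpath_rcons a f) (rng f, q).
  by rewrite /fcat /fpath_rcons /= cat_rcons.
have fq : fend (fpath_rcons a f) = (rng f, q).1 by rewrite fend_fpath_rcons.
have fx' : cylinder (fpath_rcons a f) x' by move: kx'; rewrite kE;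
  exact: cylinder_fcat.
have fx : cylinder (fpath_rcons a f) x by move: kx; rewrite kE;
  exact: cylinder_fcat.
by apply: nx; exists e => //; rewrite (cylinder_fpath_rcons_inj ex' fx').
Qed.

(** Both paths are initial segments of [x], so one of them extends the other. If the extension is
    proper, the whole cylinder of the longer path lies in the set of the shorter one; if the paths
    are equal, the excluded edges are merged. *)
Lemma ncylinderI a s b r x : ncylinder a s x -> ncylinder b r x ->
  exists c q, ncylinder c q x /\ ncylinder c q `<=` ncylinder a s `&` ncylinder b r.
Proof.
wlog ab : a s b r / (flen a <= flen b)%N.
  move=> wl ax bx; have [ab|/ltnW ba] := leqP (flen a) (flen b); first exact: wl.
  have [c [q [cx cs]]] := wl b r a s ba bx ax; exists c, q; split=> //.
  by rewrite setIC.
move=> ax bx; have [k [ak fk] bE] := cylinder_comparable ax.1 bx.1 ab.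
have [k0|k0] := pselect (k.2 = [::]).
  move: bx; rewrite bE fcat_size0 // => bx; exists a, (s ++ r); split.
    split=> [|[e]]; first by case: ax.
    rewrite mem_cat => /orP[es|er] ex; [apply: ax.2|apply: bx.2]; by exists e.
  move=> x' [ax' nx']; split; split=> // -[e es ex']; apply: nx'; exists e => //.
    by rewrite mem_cat es.
  by rewrite mem_cat es orbT.
exists b, r; split=> // y yb; split=> //; case: yb => by_ _.
have bx' : cylinder (fcat a k) x by rewrite -bE; case: bx.
by apply: (cylinder_sub_ncylinder ak k0 bx' ax); rewrite -bE.
Qed.

(** The topology is declared by a subbase; induction on a finite intersection, with [ncylinderI] as
    the step, shows that the subbase is a base. *)
Lemma open_ncylinderP x (A : set (bpath E)) : open A -> A x ->
  exists a s, ncylinder a s x /\ ncylinder a s `<=` A.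
Proof.
move=> [D' sD' <-] [B DB Bx].
have [fs fsD BE] := sD' B DB.
suff [a [s [ax as_]]] : exists a s, ncylinder a s x /\
    ncylinder a s `<=` \bigcap_(i in [set` fs]) i.
  exists a, s; split=> // x' /as_; rewrite BE => Bx'; by exists B.
have {BE} : (\bigcap_(i in [set` fs]) i) x by rewrite BE.
move: fsD; elim/finSet_rect: fs => fs IH fsD fsx.
have [->|[A0 A0fs]] := fset_0Vmem fs.
  exists (vpath (start (val x))), [::]; rewrite ncylinder_nil; split.
    exact/cylinder_vpath.
  by move=> y _ i /=; rewrite inE.
have [|||a [s [ax as_]]] := IH (fs `\ A0)%fset.
- by apply: fproperD1.
- by move=> i; rewrite inE => /andP[_ /fsD].
- by move=> i /=; rewrite inE => /andP[_ ifs]; exact: fsx.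
have [b [r [fb A0E]]] : bpath_base A0 by have := fsD A0 A0fs; rewrite inE.
have bx : ncylinder b r x by have := fsx A0 A0fs; rewrite {1}A0E.
have [c [q [cx cs]]] := ncylinderI ax bx; exists c, q; split=> //.
move=> y /cs[/as_ ay]; rewrite -[ncylinder b r]A0E => A0y i /= ifs.
have [->//|iA0] := eqVneq i A0.
by apply: ay; rewrite /= !inE iA0.
Qed.

Lemma cylinder_open a : open (cylinder a).
Proof.
have [fa|nfa] := pselect (is_fpath a).
  by rewrite -ncylinder_nil; exact: open_ncylinder.
rewrite (_ : cylinder a = set0); first exact: open0.
by apply/seteqP; split=> x // /cylinder_fpath.
Qed.


Lemma flen0_fcat a k : flen (fcat a k) = flen a -> k.2 = [::].
Proof. by rewrite flen_fcat /flen; case: k.2 => //= f q; lia. Qed.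

Lemma cylinder_flen_eq a b x : cylinder a x -> cylinder b x ->
  flen a = flen b -> a = b.
Proof.
move=> ax bx ab; have [|k [ak _] bE] := cylinder_comparable ax bx; first
  by rewrite ab.
by rewrite bE fcat_size0 //; apply: (@flen0_fcat a); rewrite -bE ab.
Qed.

Lemma cylinder_Fin a b x : val x = Fin b -> cylinder a x -> (flen a <= flen b)%N.
Proof.
by move=> xE [y [_ _]]; rewrite xE; case: (val y) => // c [->];
  rewrite /flen size_cat leq_addr.
Qed.

Lemma Fin_cylinder b x : val x = Fin b -> cylinder b x.
Proof.
move=> xE; have [[a ax ab]|[a aE]] := cylinder_take (flen b) x; last first.
  by move: aE; rewrite xE => -[->]; rewrite ltnn.
have [y [fa ay xE']] := ax.
move: xE'; rewrite xE; case yE: (val y) => [c|//] [bE].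
suff -> : b = a by [].
have c0 : c.2 = [::].
  by move: ab; rewrite bE /flen /= size_cat; case: c.2 => //= f q; lia.
by rewrite bE c0 cats0 -surjective_pairing.
Qed.

(** The only conflict arises when [a] properly extends [b]; excluding the edge that follows [b] in
    [a] then separates the two sets, and keeps [x], which stops at [b]. *)
Lemma cylinder_Fin_disjoint a b x : val x = Fin b -> ~ cylinder a x ->
  exists s, ncylinder b s x /\ cylinder a `&` ncylinder b s = set0.
Proof.
move=> xE nax; have bx := Fin_cylinder xE.
have nxt e : ~ cylinder (fpath_rcons b e) x.
  by move=> /(cylinder_Fin xE); rewrite /flen /= size_rcons ltnn.
have [[z [az bz]]|nz] := pselect (exists z, cylinder a z /\ cylinder b z);
  last first.
  exists [::]; rewrite ncylinder_nil; split=> //.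
  by apply/seteqP; split=> z // [az bz]; apply: nz; exists z.
have [ab|ba] := leqP (flen a) (flen b).
  have [k [ak _] bE] := cylinder_comparable az bz ab; exfalso.
  by apply: nax; move: bx; rewrite bE; exact: cylinder_fcat.
have [[w q] [/= bk fk] aE] := cylinder_comparable bz az (ltnW ba).
case: q fk aE => [|f q] fk aE.
  by move: ba; rewrite aE flen_fcat /flen /= addn0 ltnn.
exists [:: f]; split; first by split=> // -[e _]; exact: nxt.
apply/seteqP; split=> y // [ay [_ ny]]; apply: ny; exists f; rewrite ?mem_head //.
have -> : fpath_rcons b f = fcat b (w, [:: f])
  by rewrite /fpath_rcons /fcat /= cats1.
apply: (@cylinder_fcat _ (rng f, q)) => //.
  by rewrite fend_fcat.
by rewrite -fcatA (_ : fcat (w, [:: f]) (rng f, q) = (w, f :: q)) // -aE.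
Qed.

Lemma cylinder_closed a : closed (cylinder a).
Proof.
rewrite -[cylinder a]setCK; apply: open_closedC; apply: open_local => x nax.
have [[b bx ba]|[b xE _]] := cylinder_take (flen a) x.
  exists (cylinder b); split=> //; first exact: cylinder_open.
  by move=> y by_ ay; apply: nax; rewrite (cylinder_flen_eq ay by_).
have [s [bx ab]] := cylinder_Fin_disjoint xE nax.
exists (ncylinder b s); split=> //; first by apply: open_ncylinder;
  exact: (cylinder_fpath bx.1).
by move=> y by_ ay; have : (cylinder a `&` ncylinder b s) y by []; rewrite ab.
Qed.

Lemma eq_cylinder x y : (forall a, cylinder a x -> cylinder a y) ->
  (forall a, cylinder a y -> cylinder a x) -> x = y.
Proof.
have fin x' y' b : (forall a, cylinder a y' -> cylinder a x') ->
    (forall a, cylinder a x' -> cylinder a y') -> val x' = Fin b -> x' = y'.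
  move=> yx xy xE; have := xy _ (Fin_cylinder xE).
  move=> /cylinder_next[[e /yx/(cylinder_Fin xE)]|[yE _]].
    by rewrite /flen /= size_rcons ltnn.
  by apply: val_inj; rewrite xE yE.
move=> xy yx.
have [[b xE]|nx] := pselect (exists b, val x = Fin b); first exact: fin xE.
have [[b yE]|ny] := pselect (exists b, val y = Fin b).
  by apply/esym; exact: fin yE.
case xE: (val x) => [b|u]; first by exfalso; apply: nx; exists b.
case yE: (val y) => [b|w]; first by exfalso; apply: ny; exists b.
apply: val_inj; rewrite xE yE; congr Inf; apply/funext => n.
have [[a ax an]|[b xb _]] := cylinder_take n.+1 x; last by exfalso; apply: nx;
  exists b.
have [x' [_ _]] := ax; have [y' [_ _]] := xy _ ax.
rewrite xE yE; case: (val x') => // u' ; case: (val y') => // w' [wE] [uE].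
have := congr1 (@^~ n) wE; have := congr1 (@^~ n) uE => /= -> ->.
by rewrite an ltnSn; apply: set_nth_default; rewrite -/(flen a) an.
Qed.

Lemma hausdorff_bpath : hausdorff_space (bpath E).
Proof.
rewrite open_hausdorff => x y /eqP xy.
have sep x' y' a : cylinder a x' -> ~ cylinder a y' ->
    exists2 AB : set (bpath E) * set (bpath E), (x' \in AB.1 /\ y' \in AB.2) &
      [/\ open AB.1, open AB.2 & AB.1 `&` AB.2 == set0].
  move=> ax nay; exists (cylinder a, ~` cylinder a); first by rewrite !inE.
  split; [exact: cylinder_open|exact/closed_openC/cylinder_closed|].
  by apply/eqP; rewrite setICr.
have [h|/existsNP[a /not_implyP[ax nay]]] := pselect (forall a, cylinder a x ->
  cylinder a y).
  have [h'|/existsNP[a /not_implyP[ay nax]]] := pselect (forall a,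
    cylinder a y -> cylinder a x).
    by case: xy; exact: eq_cylinder.
  have [[A B] /= [yA xB] [oA oB AB]] := sep _ _ _ ay nax.
  by exists (B, A) => //; split=> //=; rewrite setIC.
have [[A B] /= [yA xB] [oA oB AB]] := sep _ _ _ ax nay.
by exists (A, B).
Qed.

Lemma ultra_ncylinder (F : set_system (bpath E)) b (s : seq (edge E)) :
  UltraFilter F -> F (cylinder b) ->
  (forall e, e \in s -> ~ F (cylinder (fpath_rcons b e))) -> F (ncylinder b s).
Proof.
move=> UF Fb; elim: s => [|e s IH] nF; first by rewrite ncylinder_nil.
have Fs : F (ncylinder b s) by apply: IH => f fs; apply: nF; rewrite inE fs orbT.
have [Fe|Fe] := in_ultra_setVsetC (cylinder (fpath_rcons b e)) UF.
  by exfalso; apply: (nF e) => //; rewrite mem_head.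
apply: (filterS _ (filterI Fs Fe)) => x [[bx nx] ex]; split=> // -[f].
rewrite inE => /orP[/eqP ->//|fs fx]; by apply: nx; exists f.
Qed.

(** An ultrafilter containing the cylinder of [a] is followed down the tree of paths. Either some
    path [b] has its cylinder in the ultrafilter but none of its one-edge extensions, and the limit
    is the finite path [b]; or the descent never stops and the limit is the infinite path it
    traces. *)
Lemma compact_cylinder a : compact (cylinder a).
Proof.
rewrite compact_ultra => F UF Fa.
have PF : ProperFilter F by exact: ultra_proper.
have [[b [Fb nb]]|h] := pselect (exists b, F (cylinder b) /\
    forall e, ~ F (cylinder (fpath_rcons b e))).
  have [z bz] := filter_ex Fb; have fb := cylinder_fpath bz.
  have bdb : boundary_path (Fin b).
    (* At a regular vertex the cylinder of [b] is a finite union of cylinders of one-edge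
       extensions, and the ultrafilter would contain one of these. *)
    split=> //; apply: contrapT => /not_orP[ns /contrapT ne].
    have [x [[bx nx]]] : (ncylinder b (fset_set [set e | src e = fend b]) `&`
      cylinder b) !=set0.
      apply: (@filter_ex _ F _); apply: filterI => //.
      by apply: ultra_ncylinder => // e _.
    move=> _; case: (cylinder_next bx) => [[e ex]|[_ []//]].
    apply: nx; exists e => //; rewrite in_fset_set // inE /=.
    by have [_ ->] := is_fpath_rconsP (cylinder_fpath ex).
  pose x : bpath E := mkbpath bdb; have xE : val x = Fin b by [].
  have bx := Fin_cylinder xE.
  have cvg : F --> x.
    move=> A /nbhs_openP[U [oU Ux UA]].
    have [c [s [cx cU]]] := open_ncylinderP oU Ux.
    suff Fc : F (ncylinder c s) by apply: (filterS _ Fc) => y /cU/UA.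
    have [k [ck fk] bE] := cylinder_comparable cx.1 bx (cylinder_Fin xE cx.1).
    have [k0|k0] := pselect (k.2 = [::]).
      move: (Fb) cx; rewrite bE fcat_size0 // => Fc cx.
      apply: ultra_ncylinder => // e _; have := nb e.
      by rewrite {1}bE fcat_size0.
    apply: (filterS _ Fb); rewrite bE.
    by apply: (cylinder_sub_ncylinder ck k0 _ cx); rewrite -bE.
  exists x; split=> //; apply: cylinder_closed => A xA.
  have FA := cvg A xA; exact: filter_ex (filterI Fa FA).
have nextF b : F (cylinder b) -> exists e, F (cylinder (fpath_rcons b e)).
  move=> Fb; apply: contrapT => ne; apply: h; exists b; split=> // e Fe.
  by apply: ne; exists e.
have [e0 _] := nextF a Fa.
have /choice[f fP] : forall b, exists e, F (cylinder b) ->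
  F (cylinder (fpath_rcons b e)).
  by move=> b; have [/nextF[e]|nFb] := pselect (F (cylinder b));
    [exists e|exists e0].
pose b n := iter n (fun b => fpath_rcons b (f b)) a.
have Fb n : F (cylinder (b n)) by elim: n => //= n /fP.
have fb n : is_fpath (b n) by have [z /cylinder_fpath] := filter_ex (Fb n).
have bfe n : fend (b n) = src (f (b n)) by have [] := is_fpath_rconsP (fb n.+1).
have bu m : boundary_path (Inf (fun n => f (b (m + n)%N))).
  by move=> n; rewrite -(fend_fpath_rcons (b (m + n)%N)) addnS;
    exact: (bfe (m + n).+1).
(* The tail of the limit after the prefix [b n], the witness that [x] lies in each of these
   cylinders. *)
pose y n : bpath E := mkbpath (bu n).
have [x xE] : exists x, cat_of a (y 0%N) x.
  by apply: cat_of_ex; [exact: (fb 0%N)|exact: (bfe 0%N)].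
have bx n : cat_of (b n) (y n) x.
  elim: n => [//|n IH] /=; rewrite fpath_rconsE; apply: cat_of_trans IH;
    split => //=.
    by rewrite addn0; have := bfe n.+1; rewrite /= fend_fpath_rcons.
  by congr Inf; apply/funext => -[|m] /=; rewrite ?addn0 ?subn1 // addnS.
have lb n : flen (b n) = (flen a + n)%N.
  by elim: n => [|n IH] /=; rewrite ?addn0 //
    /flen /= size_rcons -/(flen _) IH addnS.
exists x; split; first by exists (y 0%N).
move=> A /nbhs_openP[U [oU Ux UA]].
have [c [s [cx cU]]] := open_ncylinderP oU Ux.
suff Fc : F (ncylinder c s) by apply: (filterS _ Fc) => z /cU/UA.
have cb : (flen c < flen (b (flen c).+1))%N by rewrite lb; lia.
have bcx : cylinder (b (flen c).+1) x by exists (y (flen c).+1).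
have [k [ck fk] bE] := cylinder_comparable cx.1 bcx (ltnW cb).
apply: (filterS _ (Fb (flen c).+1)); rewrite bE.
apply: (cylinder_sub_ncylinder ck _ _ cx); last by rewrite -bE.
by move=> k0; move: cb; rewrite bE fcat_size0 // ltnn.
Qed.

Lemma compact_open_ncylinder a (s : seq (edge E)) : compact_open (ncylinder a s).
Proof.
have cE : closed (~` [set x | exists2 e, e \in s & cylinder (fpath_rcons a e) x]).
  apply: open_closedC.
  rewrite (_ : [set x | _] = \bigcup_(e in [set` s]) cylinder (fpath_rcons a e)).
    by apply: bigcup_open => e _; exact: cylinder_open.
  by apply/seteqP; split=> x [e es ex]; exists e.
split.
  have [fa|nfa] := pselect (is_fpath a); first exact: open_ncylinder.
  rewrite (_ : ncylinder a s = set0); first exact: open0.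
  by apply/seteqP; split=> x // -[/cylinder_fpath].
by apply: compact_closedI => //; exact: compact_cylinder.
Qed.

Lemma bpath_base_compact_open : has_compact_open_base (bpath E).
Proof.
move=> x U oU Ux; have [a [s [ax aU]]] := open_ncylinderP oU Ux.
by exists (ncylinder a s); split=> //; exact: compact_open_ncylinder.
Qed.

(** Basic neighbourhoods can be chosen to begin with [a]: if the path found is shorter than [a], its
    basic set contains the whole cylinder of [a], and [k] is empty. *)
Lemma open_ncylinder_ext a x (A : set (bpath E)) : open A -> A x -> cylinder a x ->
  exists k s, [/\ fend a = k.1, is_fpath k, ncylinder (fcat a k) s x &
    ncylinder (fcat a k) s `<=` A].
Proof.
move=> oA Ax ax; have [c [s [cx cA]]] := open_ncylinderP oA Ax.
have [ac|ca] := leqP (flen a) (flen c).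
  have [k [ak fk] cE] := cylinder_comparable ax cx.1 ac.
  by exists k, s; rewrite -cE.
have [k [ck fk] aE] := cylinder_comparable cx.1 ax (ltnW ca).
exists (vpath (fend a)), [::]; rewrite fcat_size0 // ncylinder_nil; split=> //.
apply: subset_trans cA; rewrite aE.
apply: (cylinder_sub_ncylinder ck _ _ cx); last by rewrite -aE.
by move=> k0; move: ca; rewrite aE fcat_size0 // ltnn.
Qed.

Lemma ncylinder_cat a y x (s : seq (edge E)) : cat_of a y x ->
  (ncylinder a s x <-> forall e, e \in s -> ~ cylinder (epath e) y).
Proof.
move=> yx; have [_ ay _] := yx; split.
  move=> [_ nx] e es [z zy]; apply: nx; exists e => //; exists z.
  by rewrite fpath_rconsE; exact: cat_of_trans yx.
move=> nx; split; first by exists y.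
move=> [e es [z zx]]; apply: (nx e es); exists z.
have [_ ae] := is_fpath_rconsP (let: And3 h _ _ := zx in h).
by move: zx; rewrite fpath_rconsE; exact: cat_of_comparable.
Qed.

(** * The topology of the path groupoid *)

Implicit Types g h : parrow E.

Definition nbicylinder a b (s : seq (edge E)) : set (parrow E) :=
  parrow_set a b (ncylinder a s) (ncylinder b s).

Lemma nbicylinder_nil a b : nbicylinder a b [::] = bicylinder a b.
Proof.
rewrite /nbicylinder !ncylinder_nil; apply/seteqP; split=> g [y [ay by_ d _ _]].
  by exists y.
by exists y; split=> //; exists y.
Qed.

Lemma bicylinderP a b g : bicylinder a b g <-> exists y,
  [/\ cat_of a y (pran g), cat_of b y (pdom g) & pdeg g =
    (flen a)%:Z - (flen b)%:Z].
Proof. by split=> [[y [? ? ? _ _]]|[y [? ? ?]]]; exists y. Qed.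

Lemma nbicylinder_bicylinder a b s : nbicylinder a b s `<=` bicylinder a b.
Proof. by move=> g [y [? ? ? _ _]]; exists y. Qed.

Lemma bicylinder_ex g : exists a b, bicylinder a b g.
Proof.
by have [a [b [y [? ? ?]]]] := parrowP g; exists a, b; apply/bicylinderP; exists y.
Qed.

Lemma bicylinder_fpath a b g : bicylinder a b g ->
  [/\ is_fpath a, is_fpath b & fend a = fend b].
Proof.
by move=> /bicylinderP[y [[fa ay _] [fb by_ _] _]]; split; rewrite // ay by_.
Qed.

Lemma bicylinder_dom a b x : cylinder b x -> is_fpath a -> fend a = fend b ->
  exists2 g, bicylinder a b g & pdom g = x.
Proof.
move=> [y yx] fa ab; have [_ by_ _] := yx.
have [z yz] : exists z, cat_of a y z by apply: cat_of_ex; rewrite ?ab.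
have tr : arrow_triple (z, (flen a)%:Z - (flen b)%:Z, x) by exists a, b, y.
by exists (pmk tr) => //; apply/bicylinderP; exists y.
Qed.

Lemma nbicylinderE a b s : nbicylinder a b s =
  bicylinder a b `&` @pdom E @^-1` ncylinder b s.
Proof.
apply/seteqP; split=> g; first by move=> [y [? ? ? _ ?]]; split=> //; exists y.
move=> [/bicylinderP[y [ay by_ d]] bg]; exists y; split=> //.
by apply/(ncylinder_cat _ ay)/(ncylinder_cat _ by_).
Qed.

Lemma open_nbicylinder a b s : open (nbicylinder a b s).
Proof.
have [[g0 /nbicylinder_bicylinder/bicylinder_fpath[fa fb ab]]|n0] :=
  pselect (nbicylinder a b s !=set0); last first.
  rewrite (_ : nbicylinder a b s = set0); first exact: open0.
  by apply/seteqP; split=> g // ag; apply: n0; exists g.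
have pb : parrow_base (nbicylinder a b s).
  exists a, b, (ncylinder a s), (ncylinder b s); split=> //; split=> //.
  split; [by move=> x []|by move=> x []|exact: compact_open_ncylinder|
    exact: compact_open_ncylinder|].
  by move=> y u w ay by_; rewrite (ncylinder_cat _ ay) (ncylinder_cat _ by_).
exists [set nbicylinder a b s] => [_ ->|]; last by rewrite bigcup_set1.
exists [fset (nbicylinder a b s)]%fset; first by move=> B /fset1P ->; rewrite inE.
by apply/seteqP; split=> x; [move=> hx;
  exact: (hx _ (fset11 (nbicylinder a b s)))|move=> ax B /fset1P ->].
Qed.

(** The degree of [g] fixes the difference of lengths, so both paths are prolonged by the same
    number of edges, and both prolongations begin the same tail. Hence two bicylinders are nested or
    disjoint. *)
Lemma bicylinder_nested a b a' b' g : bicylinder a b g -> bicylinder a' b' g ->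
  (flen a <= flen a')%N ->
  exists k, [/\ fend a = k.1, is_fpath k, a' = fcat a k & b' = fcat b k].
Proof.
move=> abg abg'; have [_ _ ab] := bicylinder_fpath abg.
move: abg abg' => /bicylinderP[y [ay by_ d]] /bicylinderP[y' [ay' by' d']] aa'.
have bb' : (flen b <= flen b')%N by move: d; rewrite d'; lia.
have ax : cylinder a (pran g) by exists y.
have ax' : cylinder a' (pran g) by exists y'.
have bx : cylinder b (pdom g) by exists y.
have bx' : cylinder b' (pdom g) by exists y'.
have [k [ak fk] aE] := cylinder_comparable ax ax' aa'.
have [k' [bk' fk'] bE] := cylinder_comparable bx bx' bb'.
exists k; split=> //; rewrite bE; congr fcat.
have ky : cylinder k y by exists y'; apply: (cat_of_comparable ak ay); rewrite -aE.
have ky' : cylinder k' y by exists y'; apply: (cat_of_comparable bk' by_);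
  rewrite -bE.
apply: (cylinder_flen_eq ky' ky).
by move: d; rewrite d' aE bE !flen_fcat; lia.
Qed.

Lemma bicylinder_fcat a b k : fend a = k.1 -> fend b = k.1 ->
  bicylinder (fcat a k) (fcat b k) `<=` bicylinder a b.
Proof.
move=> ak bk g /bicylinderP[z [/(cat_of_split ak)[y zy ay] bz d]].
have [y' zy' by_] := cat_of_split bk bz.
apply/bicylinderP; exists y; split=> //; first by rewrite (cat_of_fun zy zy').
by rewrite d !flen_fcat; lia.
Qed.

Lemma bicylinder_fcat_mem a b k g : fend a = k.1 -> bicylinder a b g ->
  cylinder (fcat b k) (pdom g) -> bicylinder (fcat a k) (fcat b k) g.
Proof.
move=> ak abg [z bz]; have [_ _ ab] := bicylinder_fpath abg.
have /bicylinderP[y [ay by_ d]] := abg.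
have bk : fend b = k.1 by rewrite -ab.
have zy := cat_of_comparable bk by_ bz.
apply/bicylinderP; exists z; split=> //; first exact: cat_of_trans zy ay.
by rewrite d !flen_fcat; lia.
Qed.

Lemma nbicylinderI a b s a' b' s' g : nbicylinder a b s g ->
  nbicylinder a' b' s' g ->
  exists c d r, nbicylinder c d r g /\
    nbicylinder c d r `<=` nbicylinder a b s `&` nbicylinder a' b' s'.
Proof.
wlog aa' : a b s a' b' s' / (flen a <= flen a')%N.
  move=> wl h h'; have [l|/ltnW l] := leqP (flen a) (flen a'); first exact: wl.
  by have [c [d [r [? ?]]]] := wl _ _ _ _ _ _ l h' h; exists c, d, r; rewrite setIC.
rewrite !nbicylinderE => -[abg bg] [abg' bg'].
have [_ _ ab] := bicylinder_fpath abg.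
have [k [ak fk aE bE]] := bicylinder_nested abg abg' aa'.
have bk : fend b = k.1 by rewrite -ab.
have bx' : cylinder b' (pdom g) by case: bg'.
have oA : open (ncylinder b s `&` ncylinder b' s').
  by apply: openI; apply: open_ncylinder;
    [case: (bicylinder_fpath abg)|case: (bicylinder_fpath abg')].
have [l [r [bl fl lx lA]]] := open_ncylinder_ext oA (conj bg bg') bx'.
have [_ _ ab'] := bicylinder_fpath abg'.
have al : fend a' = l.1 by rewrite ab'.
exists (fcat a' l), (fcat b' l), r; rewrite !nbicylinderE; split.
  by split=> //; apply: bicylinder_fcat_mem => //; case: lx.
move=> h [/(bicylinder_fcat al bl) abh' /lA[bh bh']]; split=> //; split=> //.
by move: abh'; rewrite aE bE; exact: bicylinder_fcat.
Qed.

Lemma open_nbicylinderP g (A : set (parrow E)) : open A -> A g ->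
  exists a b s, nbicylinder a b s g /\ nbicylinder a b s `<=` A.
Proof.
move=> [D' sD' <-] [B DB Bg].
have [fs fsD BE] := sD' B DB.
suff [a [b [s [ag as_]]]] : exists a b s, nbicylinder a b s g /\
    nbicylinder a b s `<=` \bigcap_(i in [set` fs]) i.
  exists a, b, s; split=> // x' /as_; rewrite BE => Bx'; by exists B.
have {BE} : (\bigcap_(i in [set` fs]) i) g by rewrite BE.
move: fsD; elim/finSet_rect: fs => fs IH fsD fsx.
have [->|[A0 A0fs]] := fset_0Vmem fs.
  have [a [b abg]] := bicylinder_ex g.
  exists a, b, [::]; rewrite nbicylinder_nil; split=> //.
have [|||a [b [s [ax as_]]]] := IH (fs `\ A0)%fset.
- by apply: fproperD1.
- by move=> i; rewrite inE => /andP[_ /fsD].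
- by move=> i /=; rewrite inE => /andP[_ ifs]; exact: fsx.
have [a' [b' [U [V [[fa' fb' ab'] [[Ua Vb [oU cU] [oV cV] UV] A0E]]]]]] :
  parrow_base A0.
  by have := fsD A0 A0fs; rewrite inE.
have /[dup] A0g : A0 g by exact: (fsx A0 A0fs).
rewrite {1}A0E => -[y [ay by_ d Ug Vg]].
have ag' : cylinder a' (pran g) by exists y.
have bg' : cylinder b' (pdom g) by exists y.
have abg' : bicylinder a' b' g by apply/bicylinderP; exists y.
(* Only [V] is refined: by the compatibility of [U] and [V] the condition on ranges follows. *)
have [k [r [bk fk kx kV]]] := open_ncylinder_ext oV Vg bg'.
have ak : fend a' = k.1 by rewrite ab'.
have sub : nbicylinder (fcat a' k) (fcat b' k) r `<=` A0.
  rewrite nbicylinderE A0E => h [/(bicylinder_fcat ak bk)/bicylinderP[z [az bz dz]] /kV Vh].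
  by exists z; split=> //; apply/(UV _ _ _ az bz).
have kg : nbicylinder (fcat a' k) (fcat b' k) r g.
  by rewrite nbicylinderE; split=> //; apply: bicylinder_fcat_mem => //; case: kx.
have [c [e [q [cx cs]]]] := nbicylinderI ax kg; exists c, e, q; split=> //.
move=> h /cs[/as_ ah /sub A0h] i /= ifs.
have [->//|iA0] := eqVneq i A0.
by apply: ah; rewrite /= !inE iA0.
Qed.

Notation GE := (path_groupoid E).

Lemma nbicylinder_dom_image a b s : is_fpath a -> fend a = fend b ->
  @pdom E @` nbicylinder a b s = ncylinder b s.
Proof.
move=> fa ab; apply/seteqP; split=> [_ [g abg <-]|x bx].
  by move: abg; rewrite nbicylinderE => -[].
have [g abg gx] := bicylinder_dom bx.1 fa ab; exists g => //.
by rewrite nbicylinderE; split; rewrite // /preimage /= gx.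
Qed.

Lemma nbicylinder_bisection a b s : @bisection GE (nbicylinder a b s).
Proof.
split=> g h [y [ay by_ d _ _]] [y' [ay' by' d' _ _]] /= e.
  have yy : y = y' by apply: (cat_of_inj by_); rewrite [pdom g]e.
  apply: parrow_eq => //; last by rewrite d d'.
  by apply: (cat_of_fun ay); rewrite yy.
have yy : y = y' by apply: (cat_of_inj ay); rewrite [pran g]e.
apply: parrow_eq => //; first by rewrite d d'.
by apply: (cat_of_fun by_); rewrite yy.
Qed.

Lemma path_dom_continuous : continuous (@pdom E).
Proof.
apply/continuousP => W oW; apply: open_local => g Wg.
have [a [b abg]] := bicylinder_ex g; have [_ _ ab] := bicylinder_fpath abg.
have bg : cylinder b (pdom g) by have /bicylinderP[y [_ ? _]] := abg; exists y.
have [k [s [bk fk kx kW]]] := open_ncylinder_ext oW Wg bg.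
have ak : fend a = k.1 by rewrite ab.
exists (nbicylinder (fcat a k) (fcat b k) s); split.
- exact: open_nbicylinder.
- by rewrite nbicylinderE; split=> //; apply: bicylinder_fcat_mem => //; case: kx.
- by rewrite nbicylinderE => h [_ /kW].
Qed.

Lemma path_dom_open (U : set (parrow E)) : open U -> open (@pdom E @` U).
Proof.
move=> oU; apply: open_local => _ [g Ug <-].
have [a [b [s [abg abU]]]] := open_nbicylinderP oU Ug.
have [fa fb ab] := bicylinder_fpath (nbicylinder_bicylinder abg).
exists (ncylinder b s); split; first exact: open_ncylinder.
  by move: abg; rewrite nbicylinderE => -[].
by rewrite -(nbicylinder_dom_image _ fa ab); exact: image_subset.
Qed.

Lemma compact_nbicylinder a b s : compact (nbicylinder a b s).
Proof.
have [[g abg]|n0] := pselect (nbicylinder a b s !=set0); last first.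
  rewrite (_ : nbicylinder a b s = set0); first exact: compact0.
  by apply/seteqP; split=> g // ag; apply: n0; exists g.
have [fa fb ab] := bicylinder_fpath (nbicylinder_bicylinder abg).
have [dinj _] := nbicylinder_bisection a b s.
apply: (compact_open_image_inj path_dom_open (open_nbicylinder a b s)) => //.
by rewrite nbicylinder_dom_image //; case: (compact_open_ncylinder b s).
Qed.

Lemma path_inv_continuous : continuous (@pinv E).
Proof.
apply/continuousP => W oW; apply: open_local => g Wg.
have [a [b [s [abg abW]]]] := open_nbicylinderP oW Wg.
exists (nbicylinder b a s); split; first exact: open_nbicylinder.
  move: abg => [y [ay by_ d ag bg]]; exists y; split=> //.
  by rewrite -[pdeg g]opprK (d : - pdeg g = _) opprB.
move=> h [y [by_ ay d bh ah]]; apply: abW; exists y; split=> //.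
by rewrite /= (_ : pdeg (pinv h) = - pdeg h) // d opprB.
Qed.

Lemma path_ran_continuous : continuous (@pran E).
Proof.
move=> g; apply: (@continuous_comp _ _ _ (@pinv E) (@pdom E)).
  exact: path_inv_continuous.
exact: path_dom_continuous.
Qed.

(** A unit has degree 0, so it lies in [Z(a, b)] only if [a] and [b] have equal length; being
    prefixes of one path they then coincide. *)
Lemma path_unit_continuous : continuous (@punit E).
Proof.
apply/continuousP => W oW; apply: open_local => x Wx.
have [a [b [s [abg abW]]]] := open_nbicylinderP oW Wx.
have [y [ay by_ d ax bx]] := abg.
have ab : a = b.
  apply: (@cylinder_flen_eq _ _ x); [by exists y|by exists y|].
  by move: d; rewrite (_ : pdeg (punit x) = 0) //; lia.
exists (ncylinder b s); split=> //.
  by apply: open_ncylinder; exact: (cylinder_fpath bx.1).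
move=> z bz; apply: abW; rewrite nbicylinderE; split=> //.
have [w wz] := bz.1; apply/bicylinderP; exists w; rewrite ab; split=> //.
by rewrite subrr.
Qed.

Lemma path_unit_open : open (range (@punit E)).
Proof.
apply: open_local => _ [x _ <-].
exists (bicylinder (vpath (start (val x))) (vpath (start (val x)))); split.
- by rewrite -nbicylinder_nil; exact: open_nbicylinder.
- by apply/bicylinderP; exists x; split; rewrite ?subrr //; exact: cat_of_vpath.
move=> g /bicylinderP[y [/cat_of_vpathE[ay _] /cat_of_vpathE[by_ _] d]].
exists y => //; apply: parrow_eq; rewrite -?ay -?by_ //.
Qed.

Lemma open_deg (n : int) : open [set g : parrow E | pdeg g = n].
Proof.
apply: open_local => g gn; have [a [b abg]] := bicylinder_ex g.
exists (bicylinder a b); split=> //.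
  by rewrite -nbicylinder_nil; exact: open_nbicylinder.
move: abg => /bicylinderP[_ [_ _ d]] h /bicylinderP[_ [_ _ d']] /=.
by rewrite d' -d.
Qed.

Lemma hausdorff_parrow : hausdorff_space (parrow E).
Proof.
rewrite open_hausdorff => g h /eqP gh.
have sep (f : parrow E -> bpath E) : continuous f -> f g <> f h ->
    exists2 AB : set (parrow E) * set (parrow E), (g \in AB.1 /\ h \in AB.2) &
      [/\ open AB.1, open AB.2 & AB.1 `&` AB.2 == set0].
  move=> cf /(hausdorff_sep hausdorff_bpath)[U [V [oU oV Ug Vh UV]]].
  exists (f @^-1` U, f @^-1` V) => /=; first by rewrite !inE.
  split; [by apply: open_comp => // x _; exact: cf|by apply: open_comp => //
    x _; exact: cf|].
  by rewrite -preimage_setI UV preimage_set0.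
have [rgh|] := pselect (pran g = pran h); last by apply: sep;
  exact: path_ran_continuous.
have [dgh|] := pselect (pdom g = pdom h); last by apply: sep;
  exact: path_dom_continuous.
exists ([set k | pdeg k = pdeg g], [set k | pdeg k = pdeg h]) => /=; first
  by rewrite !inE.
split; [exact: open_deg|exact: open_deg|].
apply/eqP/seteqP; split=> k //= [kg kh]; apply: gh; apply: parrow_eq => //.
by rewrite -kg.
Qed.

Lemma compact_open_nbicylinder a b s : compact_open (nbicylinder a b s).
Proof. by split; [exact: open_nbicylinder|exact: compact_nbicylinder]. Qed.

Lemma path_groupoid_ample_facts : ample_facts GE.
Proof.
split.
- exact: hausdorff_bpath.
- exact: hausdorff_parrow.
- exact: bpath_base_compact_open.
- exact: path_dom_continuous.
- exact: path_dom_open.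
- exact: path_inv_continuous.
- exact: path_unit_continuous.
- exact: path_unit_open.
move=> g U oU Ug; have [a [b [s [abg abU]]]] := open_nbicylinderP oU Ug.
exists (nbicylinder a b s); split=> //; first exact: compact_open_nbicylinder.
exact: nbicylinder_bisection.
Qed.

End BoundaryPaths.

(** * Leavitt path algebras and Steinberg algebras *)

Section LeavittAlgebra.
Variables (R : comPzRingType) (E : digraph).
Notation L := (lpa R E).
Notation "x ** y" := (@lpa_mul R E x y) (at level 40, left associativity).
Implicit Types (x y z : L) (v w : vert E) (e f : edge E) (a b : fpath E).

Definition lvert v : L := lpi (LVert R v).
Definition ledge e : L := lpi (LEdge R e).
Definition lghost e : L := lpi (LGhost R e).

Lemma lpiD (t u : lterm R E) : lpi (LAdd t u) = lpi t + lpi u.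
Proof. by rewrite -lpi_add. Qed.

Lemma lpiZ r (t : lterm R E) : lpi (LScale r t) = r *: lpi t.
Proof. by rewrite -lpi_scale. Qed.

Lemma lmulA x y z : x ** (y ** z) = x ** y ** z.
Proof.
have [t ->] := lpi_surj x; have [u ->] := lpi_surj y; have [w ->] := lpi_surj z.
by rewrite !lpi_mul; apply/lpiP/lcong_mulA.
Qed.

Lemma lmulDl x y z : (x + y) ** z = x ** z + y ** z.
Proof.
have [t ->] := lpi_surj x; have [u ->] := lpi_surj y; have [w ->] := lpi_surj z.
by rewrite -(lpiD t u) !lpi_mul -(lpiD (LMul t w)); apply/lpiP/lcong_mulDl.
Qed.

Lemma lmulDr x y z : x ** (y + z) = x ** y + x ** z.
Proof.
have [t ->] := lpi_surj x; have [u ->] := lpi_surj y; have [w ->] := lpi_surj z.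
by rewrite -(lpiD u w) !lpi_mul -(lpiD (LMul t u)); apply/lpiP/lcong_mulDr.
Qed.

Lemma lmulZl r x y : (r *: x) ** y = r *: (x ** y).
Proof.
have [t ->] := lpi_surj x; have [u ->] := lpi_surj y.
by rewrite -(lpiZ r t) !lpi_mul -(lpiZ r (LMul t u)); apply/esym/lpiP/lcong_scaleAl.
Qed.

Lemma lmulZr r x y : x ** (r *: y) = r *: (x ** y).
Proof.
have [t ->] := lpi_surj x; have [u ->] := lpi_surj y.
by rewrite -(lpiZ r u) !lpi_mul -(lpiZ r (LMul t u)); apply/esym/lpiP/lcong_scaleAr.
Qed.

Lemma lmul0l x : 0 ** x = 0.
Proof. by apply: (@addrI _ (0 ** x)); rewrite -lmulDl !addr0. Qed.

Lemma lmul0r x : x ** 0 = 0.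
Proof. by apply: (@addrI _ (x ** 0)); rewrite -lmulDr !addr0. Qed.

Lemma lmul_suml (I : Type) (s : seq I) (F : I -> L) x :
  (\sum_(i <- s) F i) ** x = \sum_(i <- s) F i ** x.
Proof.
by elim: s => [|i s IH]; rewrite ?big_nil ?lmul0l // !big_cons lmulDl IH.
Qed.

Lemma lmul_sumr (I : Type) (s : seq I) (F : I -> L) x :
  x ** (\sum_(i <- s) F i) = \sum_(i <- s) x ** F i.
Proof.
by elim: s => [|i s IH]; rewrite ?big_nil ?lmul0r // !big_cons lmulDr IH.
Qed.

Lemma lvert_mul v w : lvert v ** lvert w = if v == w then lvert v else 0.
Proof.
rewrite lpi_mul; case: eqVneq => [->|vw]; first by apply/lpiP/lcong_vert.
by apply/(lpiP _ (LZero R E))/lcong_vert0.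
Qed.

Lemma lsrcK e : lvert (src e) ** ledge e = ledge e.
Proof. by rewrite lpi_mul; apply/lpiP/lcong_src. Qed.

Lemma lrngK e : ledge e ** lvert (rng e) = ledge e.
Proof. by rewrite lpi_mul; apply/lpiP/lcong_rng. Qed.

Lemma lghost_rngK e : lvert (rng e) ** lghost e = lghost e.
Proof. by rewrite lpi_mul; apply/lpiP/lcong_ghost_rng. Qed.

Lemma lghost_srcK e : lghost e ** lvert (src e) = lghost e.
Proof. by rewrite lpi_mul; apply/lpiP/lcong_ghost_src. Qed.

Lemma lghost_edge e f : lghost e ** ledge f = if e == f then lvert (rng e) else 0.
Proof.
rewrite lpi_mul; case: eqVneq => [->|ef]; first by apply/lpiP/lcong_ck1.
by apply/(lpiP _ (LZero R E))/lcong_ck1_0.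
Qed.

Lemma lpi_sum_ghost (s : seq (edge E)) :
  lpi (lsum_ghost R s) = \sum_(e <- s) ledge e ** lghost e.
Proof.
elim: s => [|e s IH]; first by rewrite big_nil.
by rewrite big_cons -IH /ledge /lghost lpi_mul; exact: lpiD.
Qed.

Lemma lvert_ck2 v : ~ sink v -> ~ infinite_emitter v ->
  lvert v = \sum_(e <- fset_set [set e | src e = v]) ledge e ** lghost e.
Proof. by move=> sv iv; rewrite -lpi_sum_ghost; apply/lpiP/lcong_ck2. Qed.

Lemma lvert_edge v e : lvert v ** ledge e = if v == src e then ledge e else 0.
Proof.
by rewrite -{1}lsrcK lmulA lvert_mul; case: eqVneq => [->|]; rewrite ?lsrcK ?lmul0l.
Qed.

Lemma lghost_vert e v : lghost e ** lvert v = if src e == v then lghost e else 0.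
Proof.
rewrite -{1}lghost_srcK -lmulA lvert_mul.
by case: eqVneq => _; rewrite ?lghost_srcK ?lmul0r.
Qed.

Lemma ledge_vert e v : ledge e ** lvert v = if rng e == v then ledge e else 0.
Proof.
rewrite -{1}lrngK -lmulA lvert_mul.
by case: eqVneq => _; rewrite ?lrngK ?lmul0r.
Qed.

Fixpoint pelt_from v (p : seq (edge E)) : L :=
  if p is e :: q then ledge e ** pelt_from (rng e) q else lvert v.

(** Ghost edges come in reverse order, [(e_1 ... e_n)^* = e_n^* ... e_1^*], so the recursion
    multiplies on the right. *)
Fixpoint gelt_from v (p : seq (edge E)) : L :=
  if p is e :: q then gelt_from (rng e) q ** lghost e else lvert v.

Definition lmon a b : L := pelt_from a.1 a.2 ** gelt_from b.1 b.2.

Lemma lvert_pelt v a : is_fpath a ->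
  lvert v ** pelt_from a.1 a.2 = if v == a.1 then pelt_from a.1 a.2 else 0.
Proof.
case: a => w [|e q]; rewrite /is_fpath /=; [move=> _|move=> [<- _]].
  by rewrite lvert_mul; case: eqVneq => // ->.
by rewrite lmulA lvert_edge; case: eqP => // _; rewrite lmul0l.
Qed.

Lemma lvert_gelt b : lvert (fend b) ** gelt_from b.1 b.2 = gelt_from b.1 b.2.
Proof.
case: b => w q; rewrite /fend /=; elim: q w => [|e q IH] w /=.
  by rewrite lvert_mul eqxx.
by rewrite lmulA IH.
Qed.

Lemma lghost_gelt b e : src e = fend b ->
  lghost e ** gelt_from b.1 b.2 = gelt_from (fpath_rcons b e).1 (fpath_rcons b e).2.
Proof.
case: b => w q; rewrite /fend /=; elim: q w => [|f q IH] w /=.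
  by move=> <-; rewrite lghost_srcK lghost_rngK.
by move=> eb; rewrite lmulA IH.
Qed.

Definition wf_pair (p : fpath E * fpath E) : Prop :=
  [/\ is_fpath p.1, is_fpath p.2 & fend p.1 = fend p.2].

Definition lmons (l : seq (R * (fpath E * fpath E))) : L :=
  \sum_(q <- l) q.1 *: lmon q.2.1 q.2.2.

Definition spans (P : fpath E * fpath E -> Prop) x : Prop :=
  exists l, (forall q, q \in l -> P q.2) /\ x = lmons l.

Lemma spans0 P : spans P 0.
Proof. by exists [::]; split=> //; rewrite /lmons big_nil. Qed.

Lemma spansD P x y : spans P x -> spans P y -> spans P (x + y).
Proof.
move=> [l [lP ->]] [l' [l'P ->]]; exists (l ++ l'); split.
  by move=> q; rewrite mem_cat => /orP[/lP|/l'P].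
by rewrite /lmons big_cat.
Qed.

Lemma spansZ P r x : spans P x -> spans P (r *: x).
Proof.
move=> [l [lP ->]]; exists [seq (r * q.1, q.2) | q <- l]; split.
  by move=> _ /mapP[q /lP ql ->].
by rewrite /lmons big_map scaler_sumr; apply: eq_bigr => q _; rewrite scalerA.
Qed.

Lemma spans_sum P (I : eqType) (s : seq I) (F : I -> L) :
  (forall i, i \in s -> spans P (F i)) -> spans P (\sum_(i <- s) F i).
Proof.
elim: s => [|i s IH] h; first by rewrite big_nil; exact: spans0.
rewrite big_cons; apply: spansD; first by apply: h; rewrite mem_head.
by apply: IH => j js; apply: h; rewrite inE js orbT.
Qed.

Lemma spans_mon (P : fpath E * fpath E -> Prop) a b : P (a, b) ->
  spans P (lmon a b).
Proof.
move=> Pab; exists [:: (1, (a, b))]; split; first by move=> q; rewrite inE =>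
  /eqP ->.
by rewrite /lmons big_seq1 scale1r.
Qed.

Lemma lmul_lmons x l : x ** lmons l = \sum_(q <- l) q.1 *: (x ** lmon q.2.1 q.2.2).
Proof. by rewrite /lmons lmul_sumr; apply: eq_bigr => q _; rewrite lmulZr. Qed.

Lemma spans_mul (P Q : fpath E * fpath E -> Prop) x y :
  (forall a b, P (a, b) -> spans Q (x ** lmon a b)) ->
  spans P y -> spans Q (x ** y).
Proof.
move=> PQ [l [lP ->]]; rewrite lmul_lmons; apply: spans_sum => -[r [a b]] /lP ab.
exact/spansZ/PQ.
Qed.

Definition wf_upto n (p : fpath E * fpath E) : Prop :=
  wf_pair p /\ (flen p.1 <= n)%N.

Lemma lvert_lmon v a b : is_fpath a ->
  lvert v ** lmon a b = if v == a.1 then lmon a b else 0.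
Proof.
move=> fa; rewrite /lmon lmulA lvert_pelt //.
by case: eqP => // _; rewrite lmul0l.
Qed.

Lemma lghost_lmon_nil e v b :
  lghost e ** lmon (vpath v) b =
  if src e == v then lghost e ** gelt_from b.1 b.2 else 0.
Proof.
by rewrite /lmon /= lmulA lghost_vert; case: eqP => // _; rewrite lmul0l.
Qed.

Lemma lghost_lmon_cons e v f p b : is_fpath (v, f :: p) ->
  lghost e ** lmon (v, f :: p) b = if e == f then lmon (rng f, p) b else 0.
Proof.
move=> [_ fp]; rewrite /lmon /= !lmulA lghost_edge.
case: eqVneq => [->|_]; last by rewrite !lmul0l.
by rewrite (@lvert_pelt _ (rng f, p)) // eqxx.
Qed.

Lemma lmon_vpath b : lmon (vpath (fend b)) b = gelt_from b.1 b.2.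
Proof. by rewrite /lmon lvert_gelt. Qed.

(** A ghost edge removes the first edge of [a] or kills the monomial. If [a] is empty and the
    monomial survives, it is absorbed into [b^*] and the first path stays empty, which fits the
    truncated [n.-1]. *)
Lemma spans_ghost n e x : spans (wf_upto n) x ->
  spans (wf_upto n.-1) (lghost e ** x).
Proof.
apply: spans_mul => -[v [|f p]] b [[/= fa fb ab] n1].
  rewrite lghost_lmon_nil; case: eqP => [ev|_]; last exact: spans0.
  rewrite lghost_gelt; last by rewrite -ab ev.
  rewrite -lmon_vpath fend_fpath_rcons; apply: spans_mon; split=> //; split=> //=.
    by apply: is_fpath_rcons; rewrite // -ab ev.
  by rewrite fend_fpath_rcons.
rewrite lghost_lmon_cons //; case: eqVneq => _; last exact: spans0.
apply: spans_mon; split; first by split=> //; case: fa.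
by move: n1; rewrite /flen /=; lia.
Qed.

(** Stability under left multiplication is carried along for the sake of products: only generators
    have to be multiplied with monomials, and associativity does the rest. *)
Lemma spans_gen (t : lterm R E) : (forall x, spans wf_pair x ->
  spans wf_pair (lpi t ** x)) /\
  spans wf_pair (lpi t).
Proof.
elim: t => [v|e|e||t [tm ts] u [um us]|t [tm ts]|r t [tm ts]|t [tm ts] u [um us]].
- split.
    move=> x; apply: spans_mul => a b [/= fa fb ab];
      rewrite -/(lvert v) lvert_lmon //.
    by case: eqP => _; [exact: spans_mon|exact: spans0].
  have -> : lpi (LVert R v) = lmon (vpath v) (vpath v)
    by rewrite /lmon /= lvert_mul eqxx.
  exact: spans_mon.
- split.
    move=> x; apply: spans_mul => -[v p] b [/= fa fb ab]; rewrite -/(ledge e) /lmon.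
    rewrite -[pelt_from _ _](_ : lvert v ** pelt_from v p = _); last first.
      by rewrite (@lvert_pelt v (v, p)) // eqxx.
    rewrite !lmulA ledge_vert; case: eqVneq => [ev|_]; last first.
      by rewrite !lmul0l; exact: spans0.
    rewrite -ev in fa ab *; apply: (@spans_mon _ (src e, e :: p) b).
    by split.
  have -> : lpi (LEdge R e) = lmon (epath e) (vpath (rng e))
    by rewrite /lmon /= -lmulA lvert_mul eqxx lrngK.
  by apply: spans_mon; split.
- split.
    move=> x [l [lP xE]].
    have : spans (wf_upto (\max_(q <- l) flen q.2.1)) x.
      exists l; split=> // q ql; split; first exact: lP.
      by rewrite (big_rem q) //= leq_maxl.
    move=> /(spans_ghost e)[l' [l'P ->]]; exists l'; split=> // q /l'P[].
  by [].
  have -> : lpi (LGhost R e) = lmon (vpath (rng e)) (epath e)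
    by rewrite /lmon /= lmulA lvert_mul eqxx lghost_rngK.
  by apply: spans_mon; split.
- split=> [x _|]; last exact: spans0.
  by rewrite (_ : lpi (LZero R E) = 0) // lmul0l; exact: spans0.
- split=> [x sx|]; rewrite lpiD ?lmulDl; apply: spansD => //; [exact: tm|exact: um].
- have -> : lpi (LOpp t) = -1 *: lpi t.
    by rewrite scaleN1r -lpi_opp.
  by split=> [x sx|]; rewrite ?lmulZl; apply: spansZ => //; exact: tm.
- by split=> [x sx|]; rewrite lpiZ ?lmulZl; apply: spansZ => //; exact: tm.
split=> [x sx|]; rewrite -lpi_mul -?lmulA; last exact: tm.
by apply: tm; exact: um.
Qed.

Lemma spans_all x : spans wf_pair x.
Proof. by have [t ->] := lpi_surj x; have [] := spans_gen t. Qed.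

End LeavittAlgebra.

(** * Evaluation as an isomorphism of the Leavitt path algebra onto the Steinberg algebra of the
    path groupoid *)

Section Evaluation.
Variables (R : comPzRingType) (E : digraph).
Notation L := (lpa R E).
Notation GE := (path_groupoid E).
Notation "x ** y" := (@lpa_mul R E x y) (at level 40, left associativity).
Implicit Types (x y z : L) (v w : vert E) (e f : edge E) (a b c k : fpath E).
Implicit Types (g h : garr GE).

Definition bicyl (p : fpath E * fpath E) : garr GE -> R := \1_(bicylinder p.1 p.2).

Lemma bisection_bicylinder a b : @bisection GE (bicylinder a b).
Proof. by rewrite -nbicylinder_nil; exact: nbicylinder_bisection. Qed.

Lemma finite_fibres_indic (A : set (garr GE)) : bisection A ->
  finite_fibres (\1_A : garr GE -> R).
Proof.
move=> [dA _] x; have [[b [Ab bx]]|nb] := pselect (exists h, A h /\ gdom h = x).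
  apply: (sub_finite_set (B := [set b])) => // c [cx n0].
  by apply: dA; rewrite ?cx //; exact: indic_neq0 n0.
apply: (sub_finite_set (B := set0)) => // c [cx n0].
by apply: nb; exists c; split=> //; exact: indic_neq0 n0.
Qed.

Lemma finite_fibres_eval (t : lterm R E) : finite_fibres (lterm_eval t).
Proof.
elim: t => [v|e|e||t tf u uf|t tf|r t tf|t tf u uf] /=.
- exact/finite_fibres_indic/bisection_bicylinder.
- exact/finite_fibres_indic/bisection_bicylinder.
- exact/finite_fibres_indic/bisection_bicylinder.
- by move=> x; apply: (sub_finite_set (B := set0)) => // c [].
- exact: finite_fibresD.
- by apply: finite_fibres_sub tf => a n0 t0; apply: n0; rewrite t0 oppr0.
- by apply: finite_fibres_sub tf => a n0 t0; apply: n0; rewrite t0 mulr0.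
- exact: finite_fibres_conv.
Qed.

Lemma eval_vert v : lterm_eval (LVert R v) = @unit_indic R GE (cylinder (vpath v)).
Proof.
rewrite /= /unit_indic; congr indic; apply/seteqP; split=> [g|_ [x vx <-]].
  move=> /bicylinderP[y [/cat_of_vpathE[ry rv] /cat_of_vpathE[dy dv] d]].
  exists y; first by apply/cylinder_vpath; rewrite ry.
  by apply: parrow_eq; rewrite -?ry -?dy // d subrr.
apply/bicylinderP; exists x; have := vx => /cylinder_vpath <-.
by rewrite subrr; split=> //; exact: cat_of_vpath.
Qed.

Lemma ginv_bicylinder a b : @ginv GE @` bicylinder a b = bicylinder b a.
Proof.
rewrite (@ginv_image GE); apply/seteqP.
split=> g /bicylinderP[y [ay by_ d]]; apply/bicylinderP; exists y; split=> //.
  by rewrite -[pdeg g]opprK (d : - pdeg g = _) opprB.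
by rewrite /= (_ : pdeg (pinv g) = - pdeg g) // d opprB.
Qed.

Lemma gdom_bicylinder a b : is_fpath a -> fend a = fend b ->
  @gdom GE @` bicylinder a b = cylinder b.
Proof.
by move=> fa ab; rewrite -nbicylinder_nil (nbicylinder_dom_image _ fa ab) ncylinder_nil.
Qed.

(** With [a] an edge [e] and [b] its range vertex this is the relation for [e^* e]; with the roles
    exchanged it shows that [e e^*] is the indicator of the cylinder of [e]. *)
Lemma conv_ck1 a b : is_fpath a -> fend a = fend b ->
  conv (bicyl (b, a)) (bicyl (a, b)) = @unit_indic R GE (cylinder b).
Proof.
move=> fa ab; rewrite /bicyl /= -(ginv_bicylinder a b) -(gdom_bicylinder fa ab).
exact: (@conv_inv_indic R GE _ (bisection_bicylinder a b)).
Qed.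

Lemma eval_sum_ghost (s : seq (edge E)) :
  lterm_eval (lsum_ghost R s) =
  fun g => \sum_(e <- s) @unit_indic R GE (cylinder (epath e)) g.
Proof.
elim: s => [|e s IH] /=; first by apply/funext => g; rewrite big_nil.
apply/funext => g; rewrite big_cons IH; congr (_ + _).
by rewrite -(@conv_ck1 (vpath (rng e)) (epath e)).
Qed.

Lemma cylinder_epath e (x : bpath E) : cylinder (epath e) x -> start (val x) =
  src e.
Proof. by move/cylinder_start. Qed.

Lemma eval_lcong (t u : lterm R E) : lcong t u -> lterm_eval t = lterm_eval u.
Proof.
have ff := finite_fibres_eval.
elim=> //=.
- by move=> {}t {}u w _ -> _ ->.
- by move=> {}t t' {}u u' _ -> _ ->.
- by move=> {}t t' _ ->.
- by move=> r {}t t' _ ->.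
- by move=> {}t t' {}u u' _ -> _ ->.
- by move=> {}t {}u w; apply/funext => g; rewrite addrA.
- by move=> {}t {}u; apply/funext => g; rewrite addrC.
- by move=> {}t; apply/funext => g; rewrite add0r.
- by move=> {}t; apply/funext => g; rewrite addNr.
- by move=> r s {}t; apply/funext => g; rewrite mulrA.
- by move=> {}t; apply/funext => g; rewrite mul1r.
- by move=> r {}t {}u; apply/funext => g; rewrite mulrDr.
- by move=> r s {}t; apply/funext => g; rewrite mulrDl.
- move=> {}t {}u w; exact: (@convA R GE _ _ _ (ff _) (ff _)).
- move=> {}t {}u w; exact: (@convDl R GE _ _ _ (ff _)).
- move=> {}t {}u w; exact: (@convDr R GE _ _ _ (ff _) (ff _)).
- by move=> r {}t {}u; rewrite convZl.
- by move=> r {}t {}u; rewrite convZr.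
- move=> v; have /= -> := eval_vert v.
  by rewrite conv_unit_indic setIid.
- move=> v w /eqP vw; have /= -> := eval_vert v; have /= -> := eval_vert w.
  rewrite conv_unit_indic (_ : _ `&` _ = set0).
    by apply/funext => g; rewrite /unit_indic image_set0 indic_eq0.
  by apply/seteqP; split=> x // -[/cylinder_vpath xv /cylinder_vpath xw];
    apply: vw; rewrite -xv.
- move=> e; have /= -> := eval_vert (src e); rewrite conv_unit_indicl.
  apply/funext => g; have [eg|eg] :=
    pselect (bicylinder (epath e) (vpath (rng e)) g).
    rewrite indic_eq1 ?mul1r //; apply/cylinder_vpath/(@cylinder_epath e).
    by have /bicylinderP[y [ey _ _]] := eg; exists y.
  by rewrite [X in _ * X]indic_eq0 // mulr0 indic_eq0.
- move=> e; have /= -> := eval_vert (rng e); rewrite conv_unit_indicr.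
  apply/funext => g; have [eg|eg] :=
    pselect (bicylinder (epath e) (vpath (rng e)) g).
    rewrite [X in _ * X]indic_eq1 ?mulr1 //; apply/cylinder_vpath.
    by have /bicylinderP[y [_ ey _]] := eg; exact: (cat_of_start ey).
  by rewrite indic_eq0 // mul0r.
- move=> e; have /= -> := eval_vert (rng e); rewrite conv_unit_indicl.
  apply/funext => g; have [eg|eg] :=
    pselect (bicylinder (vpath (rng e)) (epath e) g).
    rewrite indic_eq1 ?mul1r //; apply/cylinder_vpath.
    by have /bicylinderP[y [ey _ _]] := eg; exact: (cat_of_start ey).
  by rewrite [X in _ * X]indic_eq0 // mulr0 indic_eq0.
- move=> e; have /= -> := eval_vert (src e); rewrite conv_unit_indicr.
  apply/funext => g; have [eg|eg] :=
    pselect (bicylinder (vpath (rng e)) (epath e) g).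
    rewrite [X in _ * X]indic_eq1 ?mulr1 //;
      apply/cylinder_vpath/(@cylinder_epath e).
    by have /bicylinderP[y [_ ey _]] := eg; exists y.
  by rewrite indic_eq0 // mul0r.
- by move=> e; have /= -> := eval_vert (rng e);
  exact: (@conv_ck1 (epath e) (vpath (rng e))).
- move=> e f /eqP ef; apply/funext => g; apply: contrapT =>
  /conv_neq0[h [hg n1 n2]].
  have /bicylinderP[y [_ ey _]] := indic_neq0 n1.
  have /bicylinderP[z [fz _ _]] := indic_neq0 n2.
  have e1 : cylinder (epath e) (pran h).
    by exists y; move: ey; rewrite (gdom_mulV hg : pdom _ = _).
  have f1 : cylinder (epath f) (pran h) by exists z.
  by apply: ef; have [] := cylinder_flen_eq e1 f1 erefl.
(* At a regular vertex every boundary path has a first edge, so the cylinder of [v] is the disjoint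
   union of the cylinders of the edges leaving [v]. *)
move=> v sv iv; have fin : finite_set [set e | src e = v] by apply: contrapT.
have /= -> := eval_vert v; rewrite eval_sum_ghost.
apply: (@diagonal_eq R GE).
- exact: support_unit_indic.
- move=> g n0; apply: contrapT => ng; apply: n0.
  rewrite /= big1 // => e _; apply: contrapT => n0.
  by apply: ng; exact: (support_unit_indic n0).
move=> x; rewrite unit_indicE.
have [vx|nvx] := pselect (cylinder (vpath v) x); last first.
  rewrite indic_eq0 // big_seq big1 // => e; rewrite in_fset_set // inE /= => ev.
  rewrite unit_indicE indic_eq0 // => ex; apply: nvx; apply/cylinder_vpath.
  by rewrite (cylinder_epath ex).
rewrite indic_eq1 //; case: (cylinder_next vx) => [[e ex]|[_ []//]].
have ev : src e = v by have [_ <-] := is_fpath_rconsP (cylinder_fpath ex).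
have ex' : cylinder (epath e) x by move: ex; rewrite /fpath_rcons /epath ev.
rewrite (big_rem e) /=; last by rewrite in_fset_set // inE.
rewrite unit_indicE indic_eq1 // big_seq big1 ?addr0 // => f.
rewrite mem_rem_uniq ?fset_uniq // inE => /andP[/eqP fe _].
rewrite unit_indicE indic_eq0 // => fx; apply: fe.
by have [] := cylinder_flen_eq fx ex' erefl.
Qed.

Definition ev x : garr GE -> R := lpa_to_steinberg x.

Lemma ev_lpi (t : lterm R E) : ev (lpi t) = lterm_eval t.
Proof. exact/eval_lcong/repr_lpi. Qed.

Lemma evD x y : ev (x + y) = fun g => ev x g + ev y g.
Proof.
have [t ->] := lpi_surj x; have [u ->] := lpi_surj y.
by rewrite -(lpiD t u) !ev_lpi.
Qed.

Lemma evZ r x : ev (r *: x) = fun g => r * ev x g.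
Proof.
have [t ->] := lpi_surj x.
by rewrite -(lpiZ r t) !ev_lpi.
Qed.

Lemma ev0 : ev 0 = fun=> 0.
Proof. exact: (ev_lpi (LZero R E)). Qed.

Lemma evM x y : ev (x ** y) = conv (ev x) (ev y).
Proof.
have [t ->] := lpi_surj x; have [u ->] := lpi_surj y.
by rewrite lpi_mul !ev_lpi.
Qed.

Lemma ev_sum (I : Type) (s : seq I) (F : I -> L) :
  ev (\sum_(i <- s) F i) = fun g => \sum_(i <- s) ev (F i) g.
Proof.
elim: s => [|i s IH]; first by rewrite big_nil ev0; apply/funext => g;
  rewrite big_nil.
by rewrite big_cons evD IH; apply/funext => g; rewrite big_cons.
Qed.

(** Each arrow has at most one factorization with second factor in the bisection [B], so no
    coefficient other than 0 and 1 appears. *)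
Lemma conv_indic_prod (A B C : set (garr GE)) : bisection B ->
  (forall h1 h2, A h1 -> B h2 -> gdom h1 = gran h2 -> C (gmul h1 h2)) ->
  (forall g, C g -> exists h, [/\ B h, gdom h = gdom g & A (gmul g (ginv h))]) ->
  conv (\1_A : garr GE -> R) (\1_B : garr GE -> R) = \1_C.
Proof.
move=> bB AB CA; apply/funext => g; have [Cg|nCg] := pselect (C g).
  have [h [Bh hg Ah]] := CA g Cg.
  by rewrite (conv_indic_dom _ bB Bh hg) !indic_eq1.
rewrite [RHS]indic_eq0 //; apply: contrapT => /conv_neq0[h [hg n1 n2]]; apply: nCg.
have Ah := indic_neq0 n1; have Bh := indic_neq0 n2.
rewrite -(gmulVK hg); apply: AB => //; exact: gdom_mulV.
Qed.

Lemma bicylinder_mk a b (y : bpath E) : is_fpath a -> is_fpath b -> fend a =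
  start (val y) ->
  fend b = start (val y) ->
  exists g : garr GE, [/\ cat_of a y (pran g),
    cat_of b y (pdom g) & bicylinder a b g].
Proof.
move=> fa fb ay by_; have [u au] := cat_of_ex fa ay; have [w bw] :=
  cat_of_ex fb by_.
have tr : arrow_triple (u, (flen a)%:Z - (flen b)%:Z, w) by exists a, b, y.
by exists (pmk tr); split=> //; apply/bicylinderP; exists y.
Qed.

Lemma conv_bicyl a b k c : is_fpath a -> fend a = fend b -> fend b = k.1 ->
  is_fpath (fcat b k) ->
  conv (bicyl (a, b)) (bicyl (fcat b k, c)) = bicyl (fcat a k, c).
Proof.
move=> fa ab bk fbk; have ak : fend a = k.1 by rewrite ab.
apply: conv_indic_prod => /= [|h1 h2|g]; first exact: bisection_bicylinder.
  move=> /bicylinderP[z [az bz d1]] /bicylinderP[y [bky cy d2]] e.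
  have [z' yz bz'] := cat_of_split bk bky.
  have zz : z = z' by apply: (cat_of_inj bz); rewrite (e : pdom h1 = pran h2).
  apply/bicylinderP; exists y; rewrite pran_mul // pdom_mul // pdeg_mul //;
    split=> //.
    by apply: cat_of_trans yz _; rewrite -zz.
  by rewrite d1 d2 !flen_fcat; lia.
move=> /bicylinderP[y [aky cy d]]; have [z yz az] := cat_of_split ak aky.
have [fc cs _] := cy; have [_ aks _] := aky.
have [h [bh ch bch]] : exists h, [/\ cat_of (fcat b k) y (pran h),
  cat_of c y (pdom h)
    & bicylinder (fcat b k) c h].
  by apply: bicylinder_mk => //; rewrite fend_fcat // -aks fend_fcat.
have hg : pdom h = pdom g by apply: (cat_of_fun ch).
exists h; split=> //; have [z' yz' bz'] := cat_of_split bk bh.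
have gh : pdom g = pran (pinv h) by [].
apply/bicylinderP; exists z; rewrite /= pran_mul // pdom_mul // pdeg_mul //;
  split=> //.
  by rewrite (cat_of_fun yz yz').
have -> : pdeg (pinv h) = - pdeg h by [].
have /bicylinderP[_ [_ _ ->]] := bch.
by rewrite d !flen_fcat; lia.
Qed.

Lemma conv_bicyl' a b k c : is_fpath a -> is_fpath (fcat b k) ->
  fend a = fend k -> fend b = k.1 -> fend b = fend c ->
  conv (bicyl (a, fcat b k)) (bicyl (b, c)) = bicyl (a, fcat c k).
Proof.
move=> fa fbk aek bk bc; have ck : fend c = k.1 by rewrite -bc.
apply: conv_indic_prod => /= [|h1 h2|g]; first exact: bisection_bicylinder.
  move=> /bicylinderP[y [ay bky d1]] /bicylinderP[z [bz cz d2]] e.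
  have [z' yz bz'] := cat_of_split bk bky.
  have zz : z = z' by apply: (cat_of_inj bz); rewrite -(e : pdom h1 = pran h2).
  apply/bicylinderP; exists y; rewrite pran_mul // pdom_mul // pdeg_mul //;
    split=> //.
    by apply: cat_of_trans yz _; rewrite -zz.
  by rewrite d1 d2 !flen_fcat; lia.
move=> /bicylinderP[y [ay cky d]]; have [z yz cz] := cat_of_split ck cky.
have [fb fk] := (is_fpath_fcat bk).1 fbk.
have [fc cs _] := cz.
have [h [bh ch bch]] : exists h, [/\ cat_of b z (pran h), cat_of c z (pdom h)
    & bicylinder b c h].
  by apply: bicylinder_mk => //; rewrite ?bc.
have hg : pdom h = pdom g by apply: (cat_of_fun ch).
exists h; split=> //.
have gh : pdom g = pran (pinv h) by [].
apply/bicylinderP; exists y; rewrite /= pran_mul // pdom_mul // pdeg_mul //;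
  split=> //.
  exact: cat_of_trans yz bh.
have -> : pdeg (pinv h) = - pdeg h by [].
have /bicylinderP[_ [_ _ ->]] := bch.
by rewrite d !flen_fcat; lia.
Qed.

Lemma ev_pelt a : is_fpath a -> ev (pelt_from R a.1 a.2) = bicyl (a,
  vpath (fend a)).
Proof.
case: a => v p; elim: p v => [|e p IH] v /=; first by move=> _;
  exact: (ev_lpi (LVert R v)).
move=> [/= <- fp]; rewrite evM IH // ev_lpi /=.
have := @conv_bicyl (epath e) (vpath (rng e)) (rng e, p) (vpath (fend (rng e, p))).
by apply => //; split.
Qed.

Lemma ev_gelt a : is_fpath a -> ev (gelt_from R a.1 a.2) =
  bicyl (vpath (fend a), a).
Proof.
case: a => v p; elim: p v => [|e p IH] v /=; first by move=> _;
  exact: (ev_lpi (LVert R v)).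
move=> [/= <- fp]; rewrite evM IH // ev_lpi /=.
have := @conv_bicyl' (vpath (fend (rng e, p))) (vpath (rng e)) (rng e, p) (epath e).
by apply => //; split.
Qed.

Lemma ev_lmon a b : wf_pair (a, b) -> ev (lmon R a b) = bicyl (a, b).
Proof.
move=> [/= fa fb ab]; rewrite evM ev_pelt // ev_gelt // -ab.
have := @conv_bicyl a (vpath (fend a)) (vpath (fend a)) b.
by rewrite !fcat_size0 //; apply.
Qed.

Lemma ev_lmons l : (forall q, q \in l -> wf_pair q.2) ->
  ev (lmons l) = fun g => \sum_(q <- l) q.1 * bicyl q.2 g.
Proof.
move=> lP; rewrite ev_sum; apply/funext => g.
rewrite big_seq [RHS]big_seq; apply: eq_bigr => -[r [a b]] ql /=.
by rewrite evZ ev_lmon //; exact: (lP _ ql).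
Qed.

Let aE := path_groupoid_ample_facts E.

Lemma steinberg_ev x : steinberg (ev x).
Proof.
have [l [lP ->]] := spans_all x; rewrite ev_lmons //.
elim: l {lP} => [|q l IH].
  rewrite (_ : (fun _ => _) = fun=> 0); first exact: steinberg0.
  by apply/funext => g; rewrite big_nil.
rewrite (_ : (fun _ => _) = fun g =>
  q.1 * bicyl q.2 g + \sum_(q <- l) q.1 * bicyl q.2 g).
  apply: steinbergD => //; apply: steinbergZ; apply: steinberg_indic;
    first exact: hausdorff_parrow.
  by rewrite -nbicylinder_nil; exact: compact_open_nbicylinder.
by apply/funext => g; rewrite big_cons.
Qed.

(** [steinberg_generated] asks for stability under pointwise products, which is not visible in the
    algebra. It holds because two bicylinders are nested or disjoint: the pointwise product of their
    indicators is one of them or 0. *)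
Lemma ev_surj (f : garr GE -> R) : steinberg f -> exists x, ev x = f.
Proof.
pose M (f : garr GE -> R) := exists l, (forall q, q \in l -> wf_pair q.2) /\
  f = ev (lmons l).
suff h : steinberg (R := R) (G := GE) `<=` M.
  by move=> /h[l [_ ->]]; exists (lmons l).
have Mspans x : M (ev x) by have [l [lP ->]] := spans_all x; exists l.
have M0 : M (fun=> 0) by rewrite -ev0.
have MD (f1 f2 : garr GE -> R) : M f1 -> M f2 -> M (fun g => f1 g + f2 g).
  by move=> [l [_ ->]] [l' [_ ->]]; rewrite -evD.
have MZ r (f1 : garr GE -> R) : M f1 -> M (fun g => r * f1 g).
  by move=> [l [_ ->]]; rewrite -evZ.
have Msum (I : eqType) (s : seq I) (F : I -> garr GE -> R) :
    (forall i, i \in s -> M (F i)) -> M (fun g => \sum_(i <- s) F i g).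
  elim: s => [|i s IH] MF.
    by rewrite (_ : (fun _ => _) = fun=> 0) //; apply/funext => g; rewrite big_nil.
  rewrite (_ : (fun _ => _) = fun g => F i g + \sum_(i <- s) F i g).
    apply: MD; first by apply: MF; rewrite mem_head.
    by apply: IH => j js; apply: MF; rewrite inE js orbT.
  by apply/funext => g; rewrite big_cons.
have Mbicyl p : wf_pair p -> M (bicyl p).
  by case: p => a b ab; rewrite -(ev_lmon ab).
have Mbb p q : wf_pair p -> wf_pair q -> M (fun g => bicyl p g * bicyl q g).
  move=> wp wq.
  have [[g [pg qg]]|nt] := pselect ((bicylinder p.1 p.2 `&`
    bicylinder q.1 q.2) !=set0); last first.
    rewrite (_ : (fun _ => _) = fun=> 0) //; apply/funext => g.
    have [pg|pg] := pselect (bicylinder p.1 p.2 g); last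
      by rewrite {1}/bicyl indic_eq0 ?mul0r.
    by rewrite [X in _ * X]indic_eq0 ?mulr0 // => qg; apply: nt; exists g.
  have ppq (A B : set (garr GE)) : A `<=` B -> (fun g => \1_A g * \1_B g : R) =
    \1_A.
    move=> AB; apply/funext => h; have [Ah|Ah] := pselect (A h).
      by rewrite !indic_eq1 ?mulr1 //; exact: AB.
    by rewrite indic_eq0 ?mul0r.
  have nest p' q' : wf_pair p' -> wf_pair q' -> bicylinder p'.1 p'.2 g ->
    bicylinder q'.1 q'.2 g ->
      (flen p'.1 <= flen q'.1)%N -> bicylinder q'.1 q'.2 `<=` bicylinder p'.1 p'.2.
    move=> [_ _ e] _ pg' qg' pq; have [k [ak fk -> ->]] :=
      bicylinder_nested pg' qg' pq.
    by apply: bicylinder_fcat; rewrite // -e.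
  have [pq|/ltnW qp] := leqP (flen p.1) (flen q.1).
    rewrite (_ : (fun _ => _) = bicyl q); first exact: Mbicyl.
    rewrite -[RHS](ppq _ (bicylinder p.1 p.2)); last exact: nest.
    by apply/funext => h; rewrite mulrC.
  by rewrite ppq; [exact: Mbicyl|exact: nest].
have MM (f1 f2 : garr GE -> R) : M f1 -> M f2 -> M (fun g => f1 g * f2 g).
  move=> [l [lP ->]] [l' [l'P ->]]; rewrite !ev_lmons //.
  rewrite (_ : (fun _ => _) = fun g => \sum_(p <- l) \sum_(q <- l')
     p.1 * (q.1 * (bicyl p.2 g * bicyl q.2 g))).
    apply: (Msum _ l (fun p g => _)) => p pl; apply: (Msum _ l' (fun q g =>
      _)) => q ql.
    by apply: (MZ _ _); apply: (MZ _ _); apply: Mbb; [exact: lP|exact: l'P].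
  apply/funext => g; rewrite big_distrl /=; apply: eq_bigr => p _.
  rewrite big_distrr /=; apply: eq_bigr => q _.
  by rewrite mulrACA -!mulrA.
move=> f0; apply: steinberg_generated => // g U oU Ug.
have [a [b [s [abg abU]]]] := open_nbicylinderP oU Ug.
have wab : wf_pair (a, b).
  by have [? ? ?] := bicylinder_fpath (nbicylinder_bicylinder abg); split.
exists (nbicylinder a b s); split=> //; first exact: open_nbicylinder.
have [_ _ ab] := wab.
(* Excluding one more edge [e] subtracts the pointwise product with the indicator of the bicylinder
   prolonged by [e] on both sides. *)
elim: s {abg abU} => [|e s IH]; first by rewrite nbicylinder_nil;
  exact: (Mbicyl (a, b)).
rewrite (_ : \1_(_) = fun g => \1_(nbicylinder a b s) g +
    -1 * (\1_(nbicylinder a b s) g * bicyl (fpath_rcons a e, fpath_rcons b e) g)).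
  apply: (MD _ _) => //; apply: (MZ _ _); apply: (MM _ _) => //.
  have [ae|ae] := pselect (fend a = src e).
    apply: Mbicyl; split=> /=; rewrite ?fend_fpath_rcons //.
      by apply: is_fpath_rcons => //; case: wab.
    by apply: is_fpath_rcons; [case: wab|rewrite -ab].
  rewrite (_ : bicyl _ = fun=> 0) //; apply/funext => h;
    rewrite /bicyl indic_eq0 //.
  by move=> /bicylinder_fpath[/is_fpath_rconsP[_ ?]].
apply/funext => h.
have key : nbicylinder a b (e :: s) h <-> nbicylinder a b s h /\
  ~ bicylinder (fpath_rcons a e) (fpath_rcons b e) h.
  rewrite !nbicylinderE; split.
    move=> [abh [bh nh]]; split.
      split=> //; split=> // -[e' fs fh]; apply: nh; exists e' => //.
      by rewrite inE fs orbT.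
    move=> /bicylinderP[y [_ by_ _]]; apply: nh; exists e; rewrite ?mem_head //.
    by exists y.
  move=> [[abh [bh nh]] neh]; split=> //; split=> // -[e'].
  rewrite inE => /orP[/eqP ->|fs] fh; last by apply: nh; exists e'.
  apply: neh; have [_ be] := is_fpath_rconsP (cylinder_fpath fh).
  move: fh; rewrite !fpath_rconsE => fh; apply: bicylinder_fcat_mem => //.
  by rewrite /= in ab; rewrite ab.
have [nh|nh] := pselect (nbicylinder a b s h); last first.
  rewrite [RHS]/= (@indic_eq0 _ _ (nbicylinder a b s)) // mul0r mulr0 addr0.
  by rewrite indic_eq0 // => /key[].
have [eh|eh] := pselect (bicylinder (fpath_rcons a e) (fpath_rcons b e) h).
  rewrite /bicyl (@indic_eq1 _ _ (nbicylinder a b s)) //.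
  rewrite (@indic_eq1 _ _ (bicylinder (fpath_rcons a e) (fpath_rcons b e))) //
    mulr1 mulr1 subrr.
  by rewrite indic_eq0 // => /key[].
rewrite /bicyl (@indic_eq1 _ _ (nbicylinder a b s)) //.
rewrite (@indic_eq0 _ _ (bicylinder (fpath_rcons a e) (fpath_rcons b e))) //
  !mulr0 addr0.
by rewrite indic_eq1 //; apply/key.
Qed.

(** When the first paths are empty, bicylinders with a common arrow coincide, so the value at an
    arrow of one of them is the total coefficient of that monomial. Coefficients are grouped because
    a pair may occur several times in the list. *)
Lemma lmons_indep l :
  (forall q, q \in l -> wf_pair q.2 /\ q.2.1.2 = [::]) ->
  (forall q, q \in l -> exists2 g, bicylinder q.2.1 q.2.2 g & ev (lmons l) g = 0) ->
  lmons l = 0.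
Proof.
move=> lP lg.
have coef q0 : q0 \in l -> \sum_(q <- l | q.2 == q0.2) q.1 = 0.
  move=> q0l; have [g gq0 g0] := lg q0 q0l; rewrite -[RHS]g0.
  rewrite ev_lmons; last by move=> q /lP[].
  rewrite [LHS]big_mkcond /=; apply: eq_big_seq => q ql /=.
  case: eqP => [->|qq0]; first by rewrite /bicyl indic_eq1 ?mulr1.
  rewrite /bicyl indic_eq0 ?mulr0 // => gq; apply: qq0.
  have [[wq1 _ wq] q0n] := lP q ql; have [[_ _ _] q0n'] := lP q0 q0l.
  have [|k [ak fk e1 e2]] := bicylinder_nested gq gq0; first by rewrite /flen q0n.
  have k0 : k.2 = [::] by move: q0n'; rewrite e1 /= q0n.
  by rewrite [RHS]surjective_pairing e1 e2 !fcat_size0 -?surjective_pairing // -wq.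
rewrite /lmons (eq_big_seq (fun q : R * (fpath E * fpath E) =>
    \sum_(p <- undup [seq q.2 | q <- l] | q.2 == p) q.1 *: lmon R p.1 p.2)).
  rewrite (exchange_big_dep xpredT) //= big_seq big1 // => p.
  rewrite mem_undup => /mapP[q0 q0l ->].
  by rewrite -scaler_suml coef // scale0r.
move=> q ql /=; rewrite big_mkcond (bigD1_seq q.2) ?undup_uniq //=; last first.
  by rewrite mem_undup; apply/mapP; exists q.
rewrite eqxx big1 ?addr0 // => p pq.
by rewrite eq_sym (negbTE pq).
Qed.

Lemma lvert_sum l : (forall q, q \in l -> wf_pair q.2) ->
  lmons l = \sum_(v <- undup [seq q.2.1.1 | q <- l]) lvert R v ** lmons l.
Proof.
move=> lP; under [RHS]eq_bigr do rewrite lmul_lmons.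
rewrite exchange_big /=; apply: eq_big_seq => -[r [a b]] ql /=.
have [fa _ _] := lP _ ql; rewrite (bigD1_seq a.1) ?undup_uniq //=; last first.
  by rewrite mem_undup; apply/mapP; exists (r, (a, b)).
rewrite lvert_lmon // eqxx big1 ?addr0 // => v va.
by rewrite lvert_lmon // (negbTE va) scaler0.
Qed.

Lemma lmons_filter (P : pred (R * (fpath E * fpath E))) l :
  lmons l = lmons [seq q <- l | P q] + lmons [seq q <- l | ~~ P q].
Proof. by rewrite /lmons !big_filter [LHS](bigID P). Qed.

(** By induction every [e^* x] is 0, as its bound is smaller. It remains to recover each [v x] from
    the products [e^* v x], in a way that depends on the kind of the vertex [v]. *)
Lemma ev_inj0_upto n x : spans (wf_upto n) x -> ev x = (fun=> 0) -> x = 0.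
Proof.
have ev_mul0 y x' : ev x' = (fun=> 0) -> ev (y ** x') = fun=> 0.
  move=> x0; rewrite evM x0; apply/funext => g; apply: conv_eq0 => h _.
  by rewrite mulr0.
have nil0 x' : spans (wf_upto 0) x' -> ev x' = (fun=> 0) -> x' = 0.
  move=> [l [lP ->]] e; apply: lmons_indep => q ql.
    have [wq] := lP q ql; split=> //; by apply: size0nil; move: b;
      rewrite leqn0 => /eqP.
  have [[fa fb ab] _] := lP q ql; have [y ya] := bpath_from (fend q.2.1).
  have [|g [_ _ bg]] := @bicylinder_mk q.2.1 q.2.2 y fa fb (esym ya).
    by rewrite -ab ya.
  by exists g => //; rewrite e.
elim: n x => [|n IH] x; first exact: nil0.
move=> sx ex.
have ghost0 e : lghost R e ** x = 0.
  by apply: IH; [exact: (spans_ghost e sx)|exact: ev_mul0].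
have [l [lP xE]] := sx.
have lwf q : q \in l -> wf_pair q.2 by move=> /lP[].
rewrite xE (lvert_sum lwf) big1 // -xE => v _.
have xvE : lvert R v ** x = lmons [seq q <- l | v == q.2.1.1].
  rewrite xE lmul_lmons /lmons big_filter [RHS]big_mkcond; apply: eq_big_seq =>
    -[r [a b]] ql /=.
  have [fa _ _] := lwf _ ql; rewrite lvert_lmon //.
  by case: eqP => // _; rewrite scaler0.
have ghostv e : lghost R e ** (lvert R v ** x) = 0.
  by rewrite lmulA lghost_vert; case: eqP => _; rewrite ?ghost0 ?lmul0l.
(* No edge leaves a sink, so all monomials of [v x] have an empty first path. *)
have [sv|nsv] := pselect (sink v).
  apply: nil0; last exact: ev_mul0.
  rewrite xvE; eexists; split; last reflexivity.
  move=> [r [[w p] b]]; rewrite mem_filter /= => /andP[/eqP vw ql].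
  split; first exact: lwf ql.
  have [/= fa _ _] := lwf _ ql; case: p fa {ql} => [//|f p] [/= sf _].
  have : [set e | src e = v] f by rewrite /= sf vw.
  by rewrite sv.
(* At a regular vertex [v] is the sum of the [e e^*], and [v x] vanishes at once. *)
have [iv|niv] := pselect (infinite_emitter v); last first.
  rewrite (lvert_ck2 R nsv niv) lmul_suml big1 // => e _.
  by rewrite -lmulA ghost0 lmul0r.
pose lv := [seq q <- l | v == q.2.1.1].
pose F := undup (flatten [seq q.2.1.2 | q <- lv]).
pose l1 := [seq q <- lv | q.2.1.2 == [::]].
pose l2 := [seq q <- lv | q.2.1.2 != [::]].
have x12 : lvert R v ** x = lmons l1 + lmons l2 by rewrite xvE;
  exact: (lmons_filter (fun q => q.2.1.2 == [::])).
(* An edge occurring in no first path: its ghost kills [l2], and therefore also [l1] alone. *)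
have [e ev_ eF] : exists2 e, src e = v & e \notin F.
  apply: contrapT => h; apply: iv; apply: (sub_finite_set (B := [set` F])) => //.
  by move=> e ev_ /=; apply: contrapT => /negP eF; apply: h; exists e.
have lvP r w p b : (r, ((w, p), b)) \in lv -> wf_pair ((w, p), b) /\ w = v.
  by rewrite mem_filter /= => /andP[/eqP -> /lwf].
have l2P r w p b : (r, ((w, p), b)) \in l2 -> exists f p', [/\ p = f :: p',
  f \in F & wf_pair ((w, p), b)].
  rewrite mem_filter /= => /andP[pn ql]; case: p pn ql => // f p _ ql.
  exists f, p; split=> //; last by case: (lvP _ _ _ _ ql).
  rewrite mem_undup; apply/flattenP; exists (f :: p); rewrite ?mem_head //.
  by apply/mapP; exists (r, ((w, f :: p), b)).
have ghost2 f : f \notin F -> lghost R f ** lmons l2 = 0.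
  move=> fF; rewrite lmul_lmons big_seq big1 // => -[r [[w p] b]] ql /=.
  have [f' [p' [pE f'F [fa _ _]]]] := l2P _ _ _ _ ql.
  rewrite pE in fa *; rewrite lghost_lmon_cons //.
  by case: eqVneq fF => [->|_ _]; [rewrite f'F|rewrite scaler0].
have l10 : lmons l1 = 0.
  have g1 : lghost R e ** lmons l1 = 0.
    by rewrite -(ghostv e) x12 lmulDr (ghost2 _ eF) addr0.
  apply: lmons_indep => q ql.
    case: q ql => r [[w p] b]; rewrite mem_filter /= => /andP[/eqP pn ql].
    by have [? _] := lvP _ _ _ _ ql.
  case: q ql => r [[w p] b]; rewrite mem_filter /= => /andP[/eqP pn ql].
  have [[/= fa fb ab] wv] := lvP _ _ _ _ ql; rewrite pn wv /= in fa ab *.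
  (* The test arrow [g] has a range that begins with [e]. Translation by the arrow [h] of
     [Z(rng e, e)] shows that [e^* l1] takes at [h g] the value of [l1] at [g]. *)
  have [z ze] := bpath_from (rng e).
  have [y zy] : exists y : bpath E, cat_of (epath e) z y by apply: cat_of_ex;
    rewrite ?ze.
  have yv : start (val y) = v by rewrite (cat_of_start zy).
  have [||g [gr gd bg]] := @bicylinder_mk (v, [::]) b y fa fb.
  - by rewrite yv.
  - by rewrite -ab yv.
  exists g => //.
  have gy : pran g = y by have /cat_of_vpathE[] := gr.
  have [_ /= ee _] := zy.
  have [h [hr hd bh]] : exists h, [/\ cat_of (vpath (rng e)) z (pran h),
    cat_of (epath e) z (pdom h)
      & bicylinder (vpath (rng e)) (epath e) h].
    by apply: bicylinder_mk => //; rewrite -ze.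
  have hg : pdom h = pran g by rewrite gy; exact: cat_of_fun hd zy.
  have := congr1 (fun k : garr GE -> R => k (pmul h g)) (congr1 ev g1);
    rewrite ev0 evM ev_lpi /=.
  rewrite (@conv_single _ _ _ _ _ g) /=.
  + have -> : pmul (pmul h g) (pinv g) = h by exact: (@gmulKV GE h g hg).
    by rewrite indic_eq1 // mul1r.
  + by rewrite (pdom_mul hg).
  move=> a ag n0; have n1 : (\1_(bicylinder (vpath (rng e)) (epath e)) :
    garr GE -> R) (pmul (pmul h g) (pinv a)) <> 0.
    by move=> e0; apply: n0; rewrite e0 mul0r.
  have bha := indic_neq0 n1.
  have [_ rinj] := bisection_bicylinder (vpath (rng e)) (epath e).
  have ahg : @gdom GE a = @gdom GE (@gmul GE h g) by [].
  have E1 : @gmul GE (@gmul GE h g) (@ginv GE a) = h.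
    apply: rinj => //; rewrite (@gran_mulV GE _ _ ahg);
      exact: (@gran_mul GE h g hg).
  have rah : @gdom GE h = @gran GE a by rewrite -(@gdom_mulV GE _ _ ahg) E1.
  by apply: (@gmul_injl GE h _ _ rah hg); rewrite -{1}E1 (@gmulVK GE _ _ ahg).
rewrite x12 l10 add0r.
(* Each monomial of [l2] begins with one edge [f] of [F], so it is fixed by [f f^*] and killed by
   the other summands; this finite sum replaces the relation lacking at an infinite emitter. *)
have -> : lmons l2 = \sum_(f <- F) ledge R f ** (lghost R f ** lmons l2).
  under eq_bigr do rewrite lmul_lmons lmul_sumr.
  rewrite exchange_big /=; apply: eq_big_seq => -[r [[w p] b]] ql /=.
  have [f [p' [-> fF [fa _ _]]]] := l2P _ _ _ _ ql.
  rewrite (bigD1_seq f) ?undup_uniq //= big1 ?addr0.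
    rewrite lmulZr lghost_lmon_cons // eqxx /lmon /= lmulA //.
  move=> f' ff'; rewrite lghost_lmon_cons // (negbTE ff') scaler0 lmul0r //.
rewrite big1 // => f _.
have -> : lmons l2 = lvert R v ** x by rewrite x12 l10 add0r.
by rewrite ghostv lmul0r.
Qed.

Lemma ev_inj x y : ev x = ev y -> x = y.
Proof.
move=> exy; apply/eqP; rewrite -subr_eq0; apply/eqP.
have [l [lP lE]] := spans_all (x - y).
apply: (@ev_inj0_upto (\max_(q <- l) flen q.2.1)).
  exists l; split=> // q ql; split; first exact: lP.
  by rewrite (big_rem q) //= leq_maxl.
rewrite -scaleN1r evD evZ exy; apply/funext => g.
by rewrite mulN1r subrr.
Qed.

End Evaluation.

(** * Reconstruction of a groupoid from its algebra and diagonal *)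

Section FiniteFibres.
Variables (R : comPzRingType) (G : groupoid).
Hypothesis aG : ample_facts G.

(** A bisection meets each fibre of [gdom] at most once, and finitely many bisections cover the
    compact support. *)
Lemma steinberg_finite_fibres (f : garr G -> R) : steinberg f -> finite_fibres f.
Proof.
move=> /steinbergP[_ cf] x.
pose P (A : set (garr G)) := finite_set [set a | gdom a = x /\ A a].
have: P (support f); last by [].
apply: (compact_ind cf).
- by apply: (sub_finite_set (B := set0)) => // a [].
- move=> A B fA fB; rewrite /P.
  apply: (sub_finite_set (B := [set a | gdom a = x /\ A a] `|`
      [set a | gdom a = x /\ B a])); last by rewrite finite_setU.
  by move=> a [ax [Aa|Ba]]; [left|right].
- by move=> A B AB; apply: sub_finite_set => a [ax /AB].
move=> a _; have [A [[oA _] [dA _] Aa _]] := af_bisection aG (@openT _) (I :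
  setT a).
exists A; split=> //; rewrite /P.
have [[b [bx Ab]]|nb] := pselect (exists b, gdom b = x /\ A b).
  apply: (sub_finite_set (B := [set b])) => // c [cx Ac].
  by apply: dA => //; rewrite cx.
by apply: (sub_finite_set (B := set0)) => // b Ab; apply: nb; exists b.
Qed.

(** The model is [1_V] and [1_(V^-1)] for a compact open bisection [V]. Being expressed by products
    and the diagonal, the notion can be transported by a diagonal-preserving isomorphism of rings;
    the opposite conjugation is the same condition on the swapped pair. *)
Definition normalizing_pair (m n : garr G -> R) : Prop :=
  [/\ conv (conv m n) m = m, diagonal (conv m n), diagonal (conv n m) &
      forall f, diagonal f -> diagonal (conv (conv n f) m)].

(** The single place through which reducedness of [R] or condition (L) enters the reconstruction. *)
Definition local_bisection_hypothesis : Prop := forall m n : garr G -> R,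
  steinberg m -> steinberg n -> normalizing_pair m n -> normalizing_pair n m ->
  bisection (support m).

End FiniteFibres.

(** Additive and multiplicative only, so that isomorphisms of rings are covered. [T] is a total map,
    constrained only on Steinberg functions. *)
Definition steinberg_morphism (R : comPzRingType) (G H : groupoid)
    (T : (garr G -> R) -> garr H -> R) : Prop :=
  [/\ forall f, steinberg f -> steinberg (T f),
      forall f g, steinberg f -> steinberg g ->
        T (fun a => f a + g a) = (fun a => T f a + T g a),
      forall f g, steinberg f -> steinberg g -> T (conv f g) = conv (T f) (T g) &
      forall f, diagonal f -> diagonal (T f)].

(** * The map on compact open sets of units induced by a diagonal-preserving morphism *)

Section DiagonalTransport.
Variables (R : comPzRingType) (G H : groupoid).
Hypotheses (hR : indecomposable R) (aG : ample_facts G) (aH : ample_facts H).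
Variable T : (garr G -> R) -> garr H -> R.
Hypothesis hT : steinberg_morphism T.

(** [T] sends the idempotent of [W] to an idempotent of the diagonal, hence to the indicator of a
    compact open set; taking the support names that set without a choice. *)
Definition idempotent_map (W : set (gobj G)) : set (gobj H) :=
  @gunit H @^-1` support (T (unit_indic R W)).

Lemma steinberg_morphism0 : T (fun=> 0) = (fun=> 0).
Proof.
have [_ TD _ _] := hT; have s0 := @steinberg0 R G.
apply/funext => a; have := congr1 (fun h => h a) (TD _ _ s0 s0).
have -> : (fun a : garr G => 0 + 0 : R) = (fun=> 0) by apply/funext=> b;
  rewrite addr0.
by move=> e; apply: (@addrI _ (T (fun=> 0) a)); rewrite addr0.
Qed.

Lemma idempotent_mapP W : compact_open W ->
  compact_open (idempotent_map W) /\
  T (unit_indic R W) = unit_indic R (idempotent_map W).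
Proof.
move=> cW; have [_ _ TM TD] := hT; have dW := diagonal_unit_indic R aG cW.
have [||W' cW' e] := @diagonal_idempotent R H aH (T (unit_indic R W)) hR.
- exact: TD.
- by rewrite -TM ?conv_unit_indic ?setIid //; case: dW.
suff -> : idempotent_map W = W' by [].
apply/seteqP; rewrite /idempotent_map e; split=> x.
  by rewrite /preimage /support /= unit_indicE => h; exact: indic_neq0 h.
move=> W'x; rewrite /preimage /support /= unit_indicE indic_eq1 //.
by have [n01 _] := hR => /esym.
Qed.

Lemma idempotent_mapI A B : compact_open A -> compact_open B ->
  idempotent_map (A `&` B) = idempotent_map A `&` idempotent_map B.
Proof.
move=> cA cB; have [n01 _] := hR; apply: (@unit_indic_inj R H) => //.
have [_ _ TM _] := hT.
have [_ <-] := idempotent_mapP (compact_openI (af_obj aG) cA cB).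
rewrite -!conv_unit_indic TM; last 2 first.
- by case: (diagonal_unit_indic R aG cA).
- by case: (diagonal_unit_indic R aG cB).
by have [_ ->] := idempotent_mapP cA; have [_ ->] := idempotent_mapP cB.
Qed.

Lemma idempotent_map0 : idempotent_map set0 = set0.
Proof.
have [n01 _] := hR.
rewrite /idempotent_map (_ : unit_indic R set0 = fun=> 0).
  by rewrite steinberg_morphism0; apply/seteqP; split=> x //; apply.
by apply/funext => a; rewrite /unit_indic image_set0 indic_eq0.
Qed.

(** The indicator of [A] is the sum of those of [A \ B] and of the intersection with [B], and
    additivity of [T] covers the image of [A]; multiplicativity makes the images of [A \ B] and [B]
    disjoint. *)
Lemma idempotent_mapD A B : compact_open A -> compact_open B ->
  idempotent_map (A `\` B) = idempotent_map A `\` idempotent_map B.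
Proof.
move=> cA cB; have [_ TD _ _] := hT; have [n01 _] := hR.
have cI := compact_openI (af_obj aG) cA cB.
have cD := compact_openD (af_obj aG) cA cB.
have eD : idempotent_map (A `\` B) `&` idempotent_map B = set0.
  by rewrite -idempotent_mapI // setDE -setIA setICl setI0 idempotent_map0.
have eA : idempotent_map (A `\` B) `&` idempotent_map A = idempotent_map (A `\` B).
  by rewrite -idempotent_mapI // (setIidl (@subDsetl _ _ _)).
apply/seteqP; split=> x.
  move=> Dx; split; first by move: Dx; rewrite -eA => -[].
  move=> Bx; suff: set0 x by []; by rewrite -eD.
move=> [Ax Bx]; apply: (@indic_neq0 R).
have sD : steinberg (unit_indic R (A `\` B)) by case: (diagonal_unit_indic R aG cD).
have sI : steinberg (unit_indic R (A `&` B)) by case: (diagonal_unit_indic R aG cI).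
have := congr1 (fun h => h (gunit x)) (TD _ _ sD sI).
rewrite (_ : (fun a => _) = unit_indic R A).
  have [_ ->] := idempotent_mapP cA; have [_ ->] := idempotent_mapP cD.
  have [_ ->] := idempotent_mapP cI; rewrite idempotent_mapI // !unit_indicE.
  rewrite indic_eq1 // [X in _ + X]indic_eq0 ?addr0; last by case.
  by move=> <- /esym.
apply: diagonal_eq; last first.
- move=> y; rewrite !unit_indicE.
  have [Ay|Ay] := pselect (A y); have [By|By] := pselect (B y).
  + by rewrite indic_eq0 ?add0r ?indic_eq1 //; case.
  + by rewrite indic_eq1 // indic_eq0 ?addr0 ?indic_eq1 //; case.
  + by rewrite !indic_eq0 ?addr0 //; case.
  + by rewrite !indic_eq0 ?addr0 //; case.
- exact: support_unit_indic.
move=> a n0; have [D0|D0] := pselect (unit_indic R (A `\` B) a = 0).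
  apply: (@support_unit_indic R _ (A `&` B)) => I0; apply: n0.
  by rewrite /= D0 I0 addr0.
exact: support_unit_indic D0.
Qed.

End DiagonalTransport.

Definition bisection_sum (R : comPzRingType) (G : groupoid) (f : garr G -> R) :
  Prop :=
  exists l : seq (R * set (garr G)),
    (forall p, p \in l -> compact_open p.2 /\ bisection p.2) /\
    f = fun a => \sum_(p <- l) p.1 * \1_(p.2) a.

Lemma steinberg_bisection_sum (R : comPzRingType) (G : groupoid) (f : garr G -> R) :
  ample_facts G -> steinberg f -> bisection_sum f.
Proof.
move=> aG; apply: steinberg_generated => {f}.
- by exists [::]; split=> //; apply/funext => a; rewrite big_nil.
- move=> f g [l [lP ->]] [l' [l'P ->]]; exists (l ++ l'); split.
    by move=> p; rewrite mem_cat => /orP[/lP|/l'P].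
  by apply/funext => a; rewrite big_cat.
- move=> k f [l [lP ->]]; exists [seq (k * p.1, p.2) | p <- l]; split.
    by move=> _ /mapP[p /lP pl ->].
  apply/funext => a; rewrite big_map big_distrr /=.
  by apply: eq_bigr => p _; rewrite mulrA.
- move=> f g [l [lP ->]] [l' [l'P ->]].
  exists [seq (p.1 * q.1, p.2 `&` q.2) | p <- l, q <- l']; split.
    move=> _ /allpairsP[[p q] [/lP[cp bp] /l'P[cq bq] ->]] /=; split.
      exact: (compact_openI (af_arr aG) cp cq).
    by apply: bisection_sub bp => a [].
  apply/funext => a; rewrite big_allpairs_dep big_distrl /=.
  apply: eq_bigr => p _; rewrite big_distrr /=; apply: eq_bigr => q _.
  by rewrite indicI /= mulrACA.
move=> a U oU Ua; have [A [cA bA Aa AU]] := af_bisection aG oU Ua.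
exists A; split=> //; first by case: cA.
exists [:: (1, A)]; split; first by move=> p; rewrite inE => /eqP ->.
by apply/funext => b; rewrite big_seq1 /= mul1r.
Qed.

(** * Construction of the groupoid isomorphism from the supports of [T 1_V] *)

Section Reconstruction.
Variables (R : comPzRingType) (G H : groupoid).
Hypotheses (hR : indecomposable R) (aG : ample_facts G) (aH : ample_facts H).
Hypothesis lG : local_bisection_hypothesis R G.
Variables (T : (garr H -> R) -> garr G -> R) (S : (garr G -> R) -> garr H -> R).
Hypotheses (hT : steinberg_morphism T) (hS : steinberg_morphism S).
Hypotheses (TK : forall f, steinberg f -> S (T f) = f)
  (SK : forall f, steinberg f -> T (S f) = f).
Hypothesis cH : forall f g : garr H -> R,
  steinberg f -> steinberg g -> steinberg (conv f g).
Implicit Types (V : set (garr H)) (W : set (gobj H)).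

Let t := idempotent_map T.
Let s := idempotent_map S.
Let n01 : 0 <> 1 :> R := hR.1.
Let n10 : 1 <> 0 :> R := fun e => n01 (esym e).

Definition co_bisection V := compact_open V /\ bisection V.

Let ind V : garr H -> R := \1_V.
Let m V := T (ind V).

Let sind V : compact_open V -> steinberg (ind V).
Proof. by apply: steinberg_indic; exact: af_arr. Qed.

Let sunit W : compact_open W -> steinberg (unit_indic R W).
Proof. by move=> /(diagonal_unit_indic R aH)[]. Qed.

Let Tunit W : compact_open W -> T (unit_indic R W) = unit_indic R (t W).
Proof. by move=> cW; case: (idempotent_mapP hR aH aG hT cW). Qed.

Let sm V : compact_open V -> steinberg (m V).
Proof. by case: hT => Ts _ _ _ cV; apply: Ts; exact: sind. Qed.

Let co_bisection_inv V : co_bisection V -> co_bisection (@ginv H @` V).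
Proof.
by move=> [cV bV]; split; [exact: compact_open_inv|exact: bisection_inv].
Qed.

Let indK V : co_bisection V -> conv (unit_indic R (@gran H @` V)) (ind V) = ind V.
Proof.
move=> [cV bV]; rewrite conv_unit_indicl; apply/funext => a.
have [Va|Va] := pselect (V a); last by rewrite /ind (@indic_eq0 _ _ V) // mulr0.
by rewrite indic_eq1 ?mul1r //; exists a.
Qed.

(** A subset of a bisection is its part over a set of domains, so its indicator is a product with a
    diagonal idempotent; [m_restr] carries this through [T]. *)
Let ind_restr V V' : co_bisection V -> compact_open V' -> V' `<=` V ->
  ind V' = conv (ind V) (unit_indic R (@gdom H @` V')).
Proof.
move=> [cV [dV rV]] cV' VV; rewrite conv_unit_indicr; apply/funext => a.
have [Va|Va] := pselect (V' a).
  have Va' := VV _ Va; have dVa : (@gdom H @` V') (gdom a) by exists a.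
  by rewrite /ind !indic_eq1 ?mulr1.
rewrite /ind (@indic_eq0 _ _ V') //; have [Va'|Va'] := pselect (V a); last first.
  by rewrite (@indic_eq0 _ _ V) ?mul0r.
rewrite [X in _ * X]indic_eq0 ?mulr0 // => -[b V'b ba]; apply: Va.
by rewrite -(dV b a (VV _ V'b) Va' ba).
Qed.

Let m_mul V : co_bisection V -> conv (m V) (m (@ginv H @` V)) =
  unit_indic R (t (@gran H @` V)).
Proof.
move=> [cV bV]; have [_ _ TM _] := hT.
have cV' := compact_open_inv aH cV.
rewrite -Tunit; last exact: compact_open_ran.
by rewrite /m -TM ?conv_indic_inv //; exact: sind.
Qed.

Let m_mulV V : co_bisection V -> conv (m (@ginv H @` V)) (m V) =
  unit_indic R (t (@gdom H @` V)).
Proof.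
move=> [cV bV]; have [_ _ TM _] := hT.
have cV' := compact_open_inv aH cV.
rewrite -Tunit; last exact: compact_open_dom.
by rewrite /m -TM ?conv_inv_indic //; exact: sind.
Qed.

Let m_ranK V : co_bisection V -> conv (unit_indic R (t (@gran H @` V))) (m V) = m V.
Proof.
move=> bV; have [_ _ TM _] := hT; have [cV _] := bV.
have cr := compact_open_ran aH cV.
by rewrite -Tunit // -TM ?indK //; [exact: sunit|exact: sind].
Qed.

Let m_pair V : co_bisection V -> normalizing_pair (m V) (m (@ginv H @` V)).
Proof.
move=> bV; have [cV [dV rV]] := bV; have [Ts TA TM TD] := hT.
have [Ss SA SM SD] := hS.
have cV' := compact_open_inv aH cV.
split; first by rewrite m_mul // m_ranK.
- rewrite m_mul //; apply: diagonal_unit_indic => //.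
  by case: (idempotent_mapP hR aH aG hT (compact_open_ran aH cV)).
- rewrite m_mulV //; apply: diagonal_unit_indic => //.
  by case: (idempotent_mapP hR aH aG hT (compact_open_dom aH cV)).
move=> f df; have sf : steinberg f by case: df.
have sSf := Ss _ sf; have sV := sind cV; have sV' := sind cV'.
(* Writing [f] as [T (S f)] moves the product to [H], where [S f] is diagonal and conjugation by the
   bisection [V] preserves the diagonal. *)
rewrite -(SK sf) /m -!TM //; last exact: cH.
apply: TD; split; first by apply: (cH _ _) => //; exact: cH.
move=> a /conv_neq0[b [ba c0 n0b]]; have Vb := indic_neq0 n0b.
have := c0; rewrite conv_diagr; last by case: (SD f df).
move=> n0; have : ind (@ginv H @` V) (gmul a (ginv b)) <> 0.
  by move=> e0; apply: n0; rewrite e0 mul0r.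
move=> n1; have [c Vc cab] := indic_neq0 n1.
have ab := gdom_mulV ba.
have e : c = b by apply: rV => //; rewrite -ab -cab gdom_inv.
exists (gdom b) => //; rewrite -(gmulVK ba) -cab e gmulVl //.
Qed.

Let m_bis V : co_bisection V -> bisection (support (m V)).
Proof.
move=> bV; have [cV _] := bV.
apply: (lG _ _ (m_pair bV)); [exact: sm|by apply: sm; exact: compact_open_inv|].
by have := m_pair (co_bisection_inv bV); rewrite ginv_imageK.
Qed.

Let m_restr V V' a : co_bisection V -> compact_open V' -> V' `<=` V ->
  m V' a = m V a * \1_(t (@gdom H @` V')) (gdom a).
Proof.
move=> bV cV' VV; have [_ _ TM _] := hT; have [cV _] := bV.
have cd := compact_open_dom aH cV'.
rewrite /m (ind_restr bV cV' VV) TM ?Tunit ?conv_unit_indicr //.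
  exact: sind.
exact: sunit.
Qed.

(** The product of [m V] with its partner is 1 at [gunit (gran a)], and as the support is a
    bisection only one term of that sum survives. *)
Let m_unit V a : co_bisection V -> m V a <> 0 ->
  m V a * m (@ginv H @` V) (ginv a) = 1.
Proof.
move=> bV ma; have [_ rm] := m_bis bV.
have := congr1 (fun h => h (gunit (gran a))) (m_mul bV); rewrite unit_indicE.
have ra : t (@gran H @` V) (gran a).
  apply: (@indic_neq0 R) => e; apply: ma.
  by rewrite -(m_ranK bV) conv_unit_indicl e mul0r.
rewrite indic_eq1 // (@conv_single _ _ _ _ _ (ginv a)) ?gdom_inv ?gdom_unit //.
  by rewrite ginvK gmul_unitl.
move=> b ba n0; rewrite -[LHS]ginvK; congr ginv.
apply: rm => //; last by rewrite gran_inv.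
move=> e; apply: n0; rewrite gmul_unitl ?gran_inv //.
by rewrite e mul0r.
Qed.

Section Arrows.
Variables (f0 : gobj H -> gobj G) (g0 : gobj G -> gobj H).
Hypotheses (f0K : cancel f0 g0) (g0K : cancel g0 f0).
Hypotheses (f0c : continuous f0) (g0c : continuous g0).
Hypothesis f0t : forall W x, compact_open W -> (W x <-> t W (f0 x)).

Let tg W y : compact_open W -> t W y -> W (g0 y).
Proof. by move=> cW tW; apply/(f0t _ cW); rewrite g0K. Qed.

Let m_dom V a : co_bisection V -> m V a <> 0 -> exists2 b, V b & f0 (gdom b) =
  gdom a.
Proof.
move=> bV ma; have [cV _] := bV; have cd := compact_open_dom aH cV.
have : t (@gdom H @` V) (gdom a).
  apply: (@indic_neq0 R) => e; apply: ma.
  by rewrite (@m_restr V V) // e mulr0.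
by move=> /(tg cd)[b Vb ba]; exists b; rewrite // ba g0K.
Qed.

Let m_ex V b : co_bisection V -> V b -> exists2 a, m V a <> 0 & gdom a =
  f0 (gdom b).
Proof.
move=> bV Vb; have [cV _] := bV; have cd := compact_open_dom aH cV.
have : conv (m (@ginv H @` V)) (m V) (gunit (f0 (gdom b))) <> 0.
  rewrite m_mulV // unit_indicE indic_eq1; first exact: n10.
  by apply/(f0t _ cd); exists b.
by move=> /conv_neq0[a [ab _ ma]]; exists a => //; rewrite ab gdom_unit.
Qed.

(** Otherwise a compact open [W] contains [gran b] but not the point [g0 (gran a)]. Restricting [V]
    to ranges in [W] leaves the value at [a] unchanged, judged by domains, and makes it vanish,
    judged by ranges. *)
Let m_ran V a b : co_bisection V -> V b -> m V a <> 0 -> gdom a = f0 (gdom b) ->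
  gran a = f0 (gran b).
Proof.
move=> bV Vb ma ab; apply: (can_inj g0K); rewrite f0K.
have [_ _ TM _] := hT; have [cV _] := bV.
apply: contrapT => ne; have /(compact_open_sep (af_obj aH) (af_base aH)) :
  gran b <> g0 (gran a).
  by move=> e; apply: ne.
move=> [W [cW Wb nWa]].
have cVW := compact_open_ran_restr aH cV cW.
have sVW : V `&` @gran H @^-1` W `<=` V by move=> c [].
have e1 : conv (unit_indic R W) (ind V) = ind (V `&` @gran H @^-1` W).
  rewrite conv_unit_indicl; apply/funext => c; rewrite /ind indicI /= mulrC.
  by congr (_ * _); rewrite !indicE.
have := m_restr a bV cVW sVW.
rewrite [X in _ * X]indic_eq1 ?mulr1; last first.
  rewrite ab; apply/f0t; first exact: compact_open_dom.
  by exists b.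
rewrite /m -e1 TM ?Tunit //; last 2 first.
- exact: sunit.
- exact: sind.
rewrite conv_unit_indicl indic_eq0 ?mul0r; first by move=> e; apply: ma.
by move=> /(tg cW).
Qed.

(** Two bisections through [b] are compared through their intersection, whose image under [m] is a
    restriction of both. *)
Let arrow_ex b : exists a, gdom a = f0 (gdom b) /\
  forall V, co_bisection V -> V b -> m V a <> 0.
Proof.
have [V1 [cV1 bV1 V1b _]] := af_bisection aH (@openT _) (I : setT b).
have coV1 : co_bisection V1 by split.
have [a ma ab] := m_ex coV1 V1b; exists a; split=> // V coV Vb.
have [cV bV] := coV.
have cI := compact_openI (af_arr aH) cV1 cV.
have coI : co_bisection (V1 `&` V) by split=> //; apply: bisection_sub bV => ? [].
have [|a' ma' a'b] := m_ex coI (b := b); first by [].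
have a'1 : m V1 a' <> 0.
  move=> e; apply: ma'; rewrite (m_restr a' coV1 cI) ?e ?mul0r // => ? [] //.
have a'2 : m V a' <> 0.
  move=> e; apply: ma'; rewrite (m_restr a' coV cI) ?e ?mul0r // => ? [] //.
have [dm _] := m_bis coV1.
by rewrite (dm a a') // ab a'b.
Qed.

Let psi b := sval (cid (arrow_ex b)).

Let psi_dom b : gdom (psi b) = f0 (gdom b).
Proof. by rewrite /psi; case: cid => a [/= ->]. Qed.

Let psi_m V b : co_bisection V -> V b -> m V (psi b) <> 0.
Proof. by rewrite /psi; case: cid => a [/= _]; apply. Qed.

Let psi_uniq V a b : co_bisection V -> V b -> m V a <> 0 -> gdom a = f0 (gdom b) ->
  a = psi b.
Proof.
move=> coV Vb ma ab; have [dm _] := m_bis coV.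
by apply: dm => //; [exact: psi_m|rewrite psi_dom].
Qed.

Let co_bisection_at b U : open U -> U b -> exists V, [/\ co_bisection V,
  V b & V `<=` U].
Proof.
by move=> oU Ub; have [V [cV bV Vb VU]] := af_bisection aH oU Ub; exists V.
Qed.

Let psi_ran b : gran (psi b) = f0 (gran b).
Proof.
have [V [coV Vb _]] := co_bisection_at (@openT _) (I : setT b).
exact: (m_ran coV Vb (psi_m coV Vb) (psi_dom b)).
Qed.

Let psi_mul b c : gdom b = gran c -> psi (gmul b c) = gmul (psi b) (psi c).
Proof.
move=> bc; have [V [coV Vb _]] := co_bisection_at (@openT _) (I : setT b).
have [V' [coV' Vc _]] := co_bisection_at (@openT _) (I : setT c).
have [cV [dV rV]] := coV; have [cV' [dV' rV']] := coV'.
have [_ _ TM _] := hT.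
(* [k] takes only the values 0 and 1, so it is the indicator of the bisection [P] of products; [P]
   is compact open because [k] is a Steinberg function. *)
pose k := conv (ind V) (ind V').
have kE a : k a = 1 \/ k a = 0.
  have [[c' V'c' c'a]|nc'] := pselect (exists2 c', V' c' & gdom c' = gdom a).
    rewrite /k (conv_indic_dom _ (conj dV' rV') V'c' c'a) /ind indicE.
    by case: (_ \in _); [left|right].
  by right; apply: conv_indic_eq0 => c' V'c' c'a; apply: nc'; exists c'.
have sk : steinberg k by apply: cH; exact: sind.
pose P := support k.
have kP : k = ind P.
  apply/funext => a; have [Pa|/contrapT Pa] := pselect (k a <> 0).
    by rewrite /ind indic_eq1 //; case: (kE a).
  by rewrite Pa /ind indic_eq0 //; apply.
have Pdec a : P a -> exists b' c', [/\ V b', V' c', gdom b' = gran c' & a =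
  gmul b' c'].
  move=> /conv_neq0[c' [c'a n1 n2]]; exists (gmul a (ginv c')), c'.
  have Vn1 := indic_neq0 n1; have Vn2 := indic_neq0 n2.
  by split=> //; [exact: gdom_mulV|rewrite gmulVK].
have coP : co_bisection P.
  split; first exact: compact_open_support.
  split=> _ _ /Pdec[b1 [c1 [Vb1 Vc1 e1 ->]]] /Pdec[b2 [c2 [Vb2 Vc2 e2 ->]]].
    rewrite !gdom_mul // => /(dV' _ _ Vc1 Vc2) e; rewrite e in e1 *.
    by rewrite (dV b1 b2) // e1 e2.
  rewrite !gran_mul // => /(rV _ _ Vb1 Vb2) e; rewrite e in e1 *.
  by rewrite (rV' c1 c2) // -e1 -e2.
have Pbc : P (gmul b c).
  rewrite /P /support /= /k (conv_indic_dom _ (conj dV' rV') Vc) ?gdom_mul //.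
  by rewrite gmulKV // /ind indic_eq1.
have dpsi : gdom (psi b) = gran (psi c) by rewrite psi_dom psi_ran bc.
apply/esym/(psi_uniq coP Pbc); last by rewrite !gdom_mul // psi_dom.
rewrite /m -kP TM; [|exact: sind|exact: sind].
rewrite -/(m V) -/(m V') (@conv_single _ _ _ _ _ (psi c)) ?gdom_mul //.
  (* The product of the two nonzero values is nonzero because the first is a unit of [R]. *)
  rewrite gmulKV // => e; have mb := psi_m coV Vb; have mc := psi_m coV' Vc.
  apply: mc; rewrite -[LHS]mul1r -(m_unit coV mb) mulrAC e mul0r //.
move=> a ac n0; have [dm _] := m_bis coV'; apply: dm => //.
- by move=> e; apply: n0; rewrite e mulr0.
- exact: psi_m.
Qed.

Let psi_unit x : psi (gunit x) = gunit (f0 x).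
Proof.
rewrite -[in RHS](gdom_unit x) -psi_dom; apply: gidem_unit.
  by rewrite psi_dom psi_ran gdom_unit gran_unit.
by rewrite -psi_mul ?gdom_unit ?gran_unit // gmul_unitl // gran_unit.
Qed.

Let t_base y U : open U -> U y -> exists W, [/\ compact_open W, t W y & t W `<=` U].
Proof.
move=> oU Uy; have oU' : open (f0 @^-1` U) by apply: open_comp => // x _;
  exact: f0c.
have [|W [cW Wy WU]] := af_base aH oU' (x := g0 y); first
  by rewrite /preimage /= g0K.
exists W; split=> //; first by rewrite -(g0K y); apply/f0t.
by move=> z /(tg cW)/WU; rewrite /preimage /= g0K.
Qed.

(** If [psi b] is a unit, the support of [m V] near it consists of units, so a restriction of [V]
    around [b] has a diagonal image under [m]. Applying [S] shows that this part of [V] consists of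
    units. *)
Let psi_unitP b : range (@gunit G) (psi b) -> range (@gunit H) b.
Proof.
move=> [x _ xb]; have [V [coV Vb _]] := co_bisection_at (@openT _) (I : setT b).
have [cV bV] := coV; have [_ SD' SM SD] := hS; have [_ _ TM _] := hT.
have oU : open (@gunit G @^-1` support (m V)).
  apply: open_comp => [y _|]; first exact: af_unit.
  by case: (compact_open_support (sm cV)).
have [|W [cW Wx WU]] := t_base oU (y := x).
  by rewrite /preimage /= xb; exact: psi_m.
have cVW := compact_open_dom_restr aH cV cW.
have sVW : V `&` @gdom H @^-1` W `<=` V by move=> ? [].
have dx : x = f0 (gdom b) by rewrite -psi_dom -xb gdom_unit.
have Wb : W (gdom b) by apply/(f0t _ cW); rewrite -dx.
have dm : diagonal (m (V `&` @gdom H @^-1` W)).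
  split; first exact: sm.
  move=> a; rewrite /support /= (m_restr a coV cVW sVW) => n0.
  have ma : m V a <> 0 by move=> e; apply: n0; rewrite e mul0r.
  have : t (@gdom H @` (V `&` @gdom H @^-1` W)) (gdom a).
    by apply: (@indic_neq0 R) => e; apply: n0; rewrite e mulr0.
  have cdVW := compact_open_dom aH cVW.
  move=> /(tg cdVW)[c [Vc Wc] ca].
  have Wa : t W (gdom a) by rewrite -(g0K (gdom a)); apply/f0t => //; rewrite -ca.
  have [dmV _] := m_bis coV; exists (gdom a) => //.
  by apply: dmV => //; [exact: WU|rewrite gdom_unit].
have := SD _ dm; rewrite /m TK; last exact: sind.
move=> [_]; apply; rewrite /support /= /ind indic_eq1 //.
Qed.

Let psi_inj : injective psi.
Proof.
move=> b c e; have bcd : gdom b = gdom c.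
  by apply: (can_inj f0K); rewrite -!psi_dom e.
have : range (@gunit G) (psi (gmul b (ginv c))).
  rewrite psi_mul ?gran_inv // e; exists (gran (psi c)) => //.
  rewrite -psi_mul ?gran_inv // gmulV psi_unit psi_ran //.
by move=> /psi_unitP[x _ /esym]; exact: (fun h => esym (gmulV_unit (esym bcd) h)).
Qed.

Let psi_support V : co_bisection V -> psi @` V = support (m V).
Proof.
move=> coV; apply/seteqP; split=> [_ [b Vb <-]|a ma]; first exact: psi_m.
have [b Vb ba] := m_dom coV ma; exists b => //.
by apply/esym/(psi_uniq coV).
Qed.

(** [1_U] is the image under [T] of a finite combination of indicators of bisections, so one summand
    is nonzero at [a]; then [a] is in the support of some [m V], which is the image of [V] under
    [psi]. *)
Let psi_surj a : exists b, psi b = a.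
Proof.
have [U [cU bU Ua _]] := af_bisection aG (@openT _) (I : setT a).
have sU : steinberg (\1_U : garr G -> R) by apply: steinberg_indic => //;
  exact: af_arr.
have [Ss SA SM SD] := hS; have [Ts TA TM TD] := hT.
have [l [lP e]] := steinberg_bisection_sum aH (Ss _ sU).
have : T (S (\1_U)) a <> 0 by rewrite SK // indic_eq1.
rewrite e => {e}; elim: l lP => [|p l IH] lP.
  rewrite (_ : (fun _ => _) = fun=> 0) ?steinberg_morphism0 //.
  by apply/funext => b; rewrite big_nil.
have [cp bp] := lP p (mem_head _ _).
have s1 : steinberg (fun b => p.1 * ind p.2 b) by apply: steinbergZ; exact: sind.
have s2 : steinberg (fun b => \sum_(q <- l) q.1 * ind q.2 b).
  have {}lP q : q \in l -> compact_open q.2 by move=> ql; case: (lP q);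
    rewrite // inE ql orbT.
  elim: l lP {IH} => [|q l IH] lP.
    rewrite (_ : (fun _ => _) = fun=> 0); first exact: steinberg0.
    by apply/funext => b; rewrite big_nil.
  rewrite (_ : (fun _ => _) = fun b =>
    q.1 * ind q.2 b + \sum_(q <- l) q.1 * ind q.2 b).
    apply: steinbergD; first by apply: steinbergZ; apply: sind; exact/lP/mem_head.
    by apply: IH => r rl; apply: lP; rewrite inE rl orbT.
  by apply/funext => b; rewrite big_cons.
rewrite (_ : (fun _ => _) = fun b =>
  p.1 * ind p.2 b + \sum_(q <- l) q.1 * ind q.2 b); last first.
  by apply/funext => b; rewrite big_cons.
rewrite TA //.
have [e0|n0] := pselect (T (fun b => \sum_(q <- l) q.1 * ind q.2 b) a = 0);
  last first.
  by move=> _; apply: IH => // q ql; apply: lP; rewrite inE ql orbT.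
rewrite e0 addr0.
have cr := compact_open_ran aH cp.
(* [T] need not commute with scalars, so [p.1] is put into a diagonal left factor, which [T] keeps
   diagonal. *)
pose d b : R := p.1 * unit_indic R (@gran H @` p.2) b.
have dd : diagonal d.
  have [sr dr] := diagonal_unit_indic R aH cr.
  split; first exact: steinbergZ.
  by move=> b n0; apply: dr => b0; apply: n0; rewrite /d /= b0 mulr0.
rewrite (_ : (fun b => _) = conv d (ind p.2)); last first.
  rewrite /d convZl; last by apply: steinberg_finite_fibres => //; exact: sind.
  by rewrite (indK (conj cp bp)).
rewrite TM; [|by case: dd|exact: sind].
rewrite conv_diagl; last by case: (TD _ dd).
move=> n0; have ma : m p.2 a <> 0 by move=> e; apply: n0; rewrite -/(m p.2) e mulr0.
have : support (m p.2) a by [].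
by rewrite -psi_support //; case=> b _ <-; exists b.
Qed.

Let phi a := sval (cid (psi_surj a)).

Let phiK : cancel phi psi.
Proof. by move=> a; rewrite /phi; case: cid. Qed.

Let psiK : cancel psi phi.
Proof. by move=> b; apply: psi_inj; rewrite phiK. Qed.

Let psi_open U : open U -> open (psi @` U).
Proof.
move=> oU; apply: open_local => _ [b Ub <-].
have [V [coV Vb VU]] := co_bisection_at oU Ub.
exists (psi @` V); split; last exact: image_subset.
- by rewrite psi_support //; case: (compact_open_support (sm coV.1)).
- by exists b.
Qed.

Let phi_cont : continuous phi.
Proof.
apply/continuousP => U oU; rewrite (_ : phi @^-1` U = psi @` U);
  first exact: psi_open.
apply/seteqP; split=> [a Ua|_ [b Ub <-]]; last by rewrite /preimage /= psiK.
by exists (phi a).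
Qed.

Let psi_cont : continuous psi.
Proof.
apply/continuousP => O oO; apply: open_local => b Ob.
have [V [coV Vb _]] := co_bisection_at (@openT _) (I : setT b).
have [cV bV] := coV; have [dm _] := m_bis coV.
(* Objects whose image under [f0] is the domain of an arrow of the support lying in [O]; over them
   uniqueness forces [psi] into [O]. *)
pose D := f0 @^-1` (@gdom G @` (O `&` support (m V))).
have oD : open D.
  apply: open_comp => [x _|]; first exact: f0c.
  apply: af_dom_open => //; apply: openI => //.
  by case: (compact_open_support (sm cV)).
exists (V `&` @gdom H @^-1` D); split.
- by apply: openI; [case: cV|exact: open_dom_preimage].
- split=> //; exists (psi b); last exact: psi_dom.
  by split=> //; exact: psi_m.
move=> c [Vc [a [Oa ma] ac]].
by rewrite /preimage /= -(psi_uniq coV Vc ma ac).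
Qed.

(** The isomorphism is the inverse [phi] of [psi]. The second clause, tying supports to arrows, is
    what later determines degrees. *)
Lemma reconstruction_arrows : exists p : gfunctor G H, groupoid_iso p /\
  forall V a, co_bisection V -> (T (\1_V) a <> 0 <-> V (farr p a)).
Proof.
have phi_dom a : gdom (phi a) = g0 (gdom a) by rewrite -{2}(phiK a) psi_dom f0K.
have phi_ran a : gran (phi a) = g0 (gran a) by rewrite -{2}(phiK a) psi_ran f0K.
have phi_unit x : phi (gunit x) = gunit (g0 x)
  by rewrite -{1}(g0K x) -psi_unit psiK.
have phi_mul a b : gdom a = gran b -> phi (gmul a b) = gmul (phi a) (phi b).
  move=> ab; apply: psi_inj; rewrite psi_mul ?phiK //.
  by rewrite phi_dom phi_ran ab.
exists (GFunctor phi_dom phi_ran phi_unit phi_mul); split.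
  split; first exact: g0c.
  split; first exact: phi_cont.
  by exists (GFunctor psi_dom psi_ran psi_unit psi_mul); split.
move=> V a coV /=; split=> [ma|Va].
  have : support (m V) a by [].
  by rewrite -psi_support // => -[b Vb <-]; rewrite psiK.
by rewrite -(phiK a); exact: psi_m.
Qed.

End Arrows.

Lemma reconstruction : exists p : gfunctor G H, groupoid_iso p /\
  forall V a, co_bisection V -> (T (\1_V) a <> 0 <-> V (farr p a)).
Proof.
have sP (W : set (gobj G)) : compact_open W -> compact_open (s W) /\
  S (unit_indic R W) = unit_indic R (s W).
  exact: idempotent_mapP.
have tP W : compact_open W -> compact_open (t W) /\ T (unit_indic R W) =
  unit_indic R (t W).
  exact: idempotent_mapP.
have [|||||f0 [g0 [f0K g0K f0c g0c f0t]]] := @stone_duality _ _ t s (af_obj aH)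
    (af_base aH) (af_obj aG) (af_base aG).
- by move=> W /tP[].
- by move=> W /sP[].
- move=> W cW; have [ctW Tt] := tP W cW; have [_ St] := sP _ ctW.
  by apply: (@unit_indic_inj R H) => //; rewrite -St -Tt TK //; exact: sunit.
- move=> W cW; have [ctW Tt] := sP W cW; have [_ St] := tP _ ctW.
  apply: (@unit_indic_inj R G) => //; rewrite -St -Tt SK //.
  by case: (diagonal_unit_indic R aG cW).
- by move=> A B cA cB; exact: idempotent_mapD.
exact: (reconstruction_arrows f0K g0K f0c g0c f0t).
Qed.

End Reconstruction.

(** * Units of Laurent polynomial rings *)

Section Laurent.
Import Order.TTheory Num.Theory.
Variable R : comPzRingType.
Hypothesis redR : reduced R.
Implicit Types (u v : int -> R) (K : seq int).

(* Armendariz: [v i] kills all terms of the coefficient of [i + j] but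
   [v i * u j], so [(v i * u j) ^+ 2 = 0]. *)
Lemma laurent_low u v K (N : nat) : uniq K ->
  (forall k : int, u k <> 0 -> k \in K) ->
  (forall k : int, k < - N%:Z -> u k = 0) -> (forall k : int, k < - N%:Z ->
    v k = 0) ->
  (forall l : int, l < 0 -> \sum_(k <- K) v (l - k) * u k = 0) ->
  forall i j : int, i + j < 0 -> v i * u j = 0.
Proof.
move=> uK suK uN vN H.
(* Outer induction on [i + j], at least [- (N + N)] when both coefficients are nonzero, and inner
   induction on [i]; both are shifted to natural numbers. *)
suff main n : forall (p : nat) (i j : int), i + j = - (N + N)%:Z + n%:Z ->
  i = - N%:Z + p%:Z ->
    i + j < 0 -> v i * u j = 0.
  move=> i j ij0; have [iN|Ni] := ltP i (- N%:Z); first by rewrite vN ?mul0r.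
  have [jN|Nj] := ltP j (- N%:Z); first by rewrite uN ?mulr0.
  by apply: (main `|(i + j + (N + N)%:Z)%R|%N `|(i + N%:Z)%R|%N i j) => //; lia.
elim/ltn_ind: n => n IHn; elim/ltn_ind => p IHp i j ijn ip ij0.
have kill (i' j' : int) : i' + j' < i + j -> v i' * u j' = 0.
  move=> lt; have [iN|Ni] := ltP i' (- N%:Z); first by rewrite vN ?mul0r.
  have [jN|Nj] := ltP j' (- N%:Z); first by rewrite uN ?mulr0.
  by apply: (IHn `|(i' + j' + (N + N)%:Z)%R|%N _ `|(i' + N%:Z)%R|%N i' j') =>
    //; lia.
have killp (i' j' : int) : i' + j' = i + j -> i' < i -> v i' * u j' = 0.
  move=> e lt; have [iN|Ni] := ltP i' (- N%:Z); first by rewrite vN ?mul0r.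
  by apply: (IHp `|(i' + N%:Z)%R|%N _ i' j') => //; lia.
apply: (redR (n := 2)); have [uj0|uj0] := pselect (u j = 0); first
  by rewrite uj0 mulr0 expr0n.
have jK := suK j uj0.
have := congr1 (fun r => v i * u j * r) (H _ ij0).
rewrite mulr0 big_distrr /= (bigD1_seq j) //= big1 ?addr0; first
  by rewrite addrK expr2.
move=> k kj; have [ik|ik] := ltP (i + j - k) i.
  by rewrite [X in _ * X]killp ?mulr0 //; lia.
have ltk : i + k < i + j by move/eqP: kj => kj; lia.
by rewrite mulrC -mulrA [u k * _]mulrA [u k * _]mulrC kill // mul0r mulr0.
Qed.

(** [laurent_low] and its mirror image leave only the products [v (- k) * u k]. These are orthogonal
    idempotents with sum 1, so one of them is 1 in an indecomposable ring, and it kills the other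
    coefficients of [u]. *)
Lemma laurent_unit u v K (J : seq int) : indecomposable R -> uniq K ->
  (forall k : int, u k <> 0 -> k \in K) -> (forall k : int, v k <> 0 -> k \in J) ->
  (forall l : int, \sum_(k <- K) v (l - k) * u k = if l == 0 then 1 else 0) ->
  forall k k' : int, u k <> 0 -> u k' <> 0 -> k = k'.
Proof.
move=> [n01 idR] uK suK svJ H.
pose N := (\max_(k <- K ++ J) `|k|)%N.
have Nb (k : int) : k \in K ++ J -> (`|k| <= N)%N.
  by move=> kK; rewrite /N (big_rem k) //= leq_maxl.
have uN (k : int) : (N < `|k|)%N -> u k = 0.
  move=> Nk; apply: contrapT => /suK kK.
  by have := Nb k; rewrite mem_cat kK => /(_ isT); lia.
have vN (k : int) : (N < `|k|)%N -> v k = 0.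
  move=> Nk; apply: contrapT => /svJ kK.
  by have := Nb k; rewrite mem_cat kK orbT => /(_ isT); lia.
have low (i j : int) : i + j < 0 -> v i * u j = 0.
  apply: (@laurent_low u v K N) => //.
  - by move=> k kN; apply: uN; lia.
  - by move=> k kN; apply: vN; lia.
  by move=> l l0; rewrite H; case: eqP => // e; move: l0; rewrite e ltxx.
have high (i j : int) : i + j > 0 -> v i * u j = 0.
  move=> ij0; rewrite -[i]opprK -[j]opprK.
  (* Replacing [X] by [X^-1] exchanges low and high degrees. *)
  apply: (@laurent_low (fun k => u (- k)) (fun k => v (- k)) [seq - k | k <- K] N).
  - by rewrite map_inj_uniq //; exact: oppr_inj.
  - by move=> k /suK kK; apply/mapP; exists (- k); rewrite ?opprK.
  - by move=> k kN; apply: uN; lia.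
  - by move=> k kN; apply: vN; lia.
  - move=> l l0; rewrite big_map -[RHS](_ : (if - l == 0 then 1 else 0) = 0 :> R).
      by rewrite -H; apply: eq_bigr => k _; rewrite opprK; congr (v _ * _); lia.
    by case: eqP => // e; lia.
  by lia.
have zero (i j : int) : i + j <> 0 -> v i * u j = 0.
  by case: (ltgtP (i + j) 0) => // [/low|/high].
have H0 := H 0; rewrite eqxx in H0.
have [k0 k0K ek0] : exists2 k0, k0 \in K & v (- k0) * u k0 <> 0.
  apply: contrapT => ne; apply: n01; rewrite -H0 big_seq big1 // => k kK.
  by rewrite sub0r; apply: contrapT => n0; apply: ne; exists k.
have e1 : v (- k0) * u k0 = 1.
  case: (idR (v (- k0) * u k0)) => //.
  have := congr1 (fun r => v (- k0) * u k0 * r) H0.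
  rewrite mulr1 big_distrr /= (bigD1_seq k0) //= big1 ?addr0 ?sub0r //.
  move=> k /eqP kk0; rewrite sub0r mulrACA [u k0 * u k]mulrC mulrACA.
  by rewrite zero ?mul0r //; lia.
have only (k : int) : u k <> 0 -> k = k0.
  move=> uk; apply: contrapT => kk0; apply: uk.
  by rewrite -[LHS]mul1r -e1 mulrAC zero ?mul0r //; lia.
by move=> k k' /only -> /only ->.
Qed.

End Laurent.

(** * Normalizers of the diagonal *)

Section Normalizers.
Variables (R : comPzRingType) (G : groupoid).
Hypotheses (hR : indecomposable R) (aG : ample_facts G).
Variables m n : garr G -> R.
Hypotheses (sm : steinberg m) (sn : steinberg n).
Hypotheses (mn : normalizing_pair m n) (nm : normalizing_pair n m).

Let fm : finite_fibres m. Proof. exact: steinberg_finite_fibres. Qed.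
Let fn : finite_fibres n. Proof. exact: steinberg_finite_fibres. Qed.

Lemma normalizer_dom_unit : exists2 B, compact_open B & conv n m = unit_indic R B.
Proof.
case: mn => mnm dmn dnm _; apply: diagonal_idempotent => //.
rewrite -convA //; last exact: finite_fibres_conv.
by rewrite [conv m (conv n m)]convA // mnm.
Qed.

(** [1_W m = 1_W m n m = m (n 1_W m)], since diagonal functions commute, and [n 1_W m] is an
    idempotent of the diagonal. Cutting [m] by ranges thus amounts to cutting it by domains. *)
Lemma normalizer_sep W : compact_open W -> exists W', forall a,
  \1_W (gran a) * m a = m a * \1_W' (gdom a).
Proof.
move=> cW; case: mn => mnm dmn dnm dn.
have fW : finite_fibres (unit_indic R W).
  by apply: steinberg_finite_fibres => //; case: (diagonal_unit_indic R aG cW).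
have fWm : finite_fibres (conv (unit_indic R W) m) by exact: finite_fibres_conv.
have fnW : finite_fibres (conv n (unit_indic R W)) by exact: finite_fibres_conv.
pose q := conv (conv n (unit_indic R W)) m.
have dq : diagonal q by apply: dn; exact: diagonal_unit_indic.
have fq : finite_fibres q by exact: finite_fibres_conv.
have key : conv (unit_indic R W) m = conv m q.
  rewrite /q -[conv (conv n _) m]convA // convA //.
  have comm : conv (conv m n) (unit_indic R W) = conv (unit_indic R W) (conv m n).
    apply/funext => a; rewrite conv_unit_indicr conv_unit_indicl mulrC.
    have [mna|mna] := pselect (conv m n a = 0); first by rewrite mna !mulr0.
    by have [x _ <-] := dmn.2 a mna; rewrite gdom_unit gran_unit.
  rewrite [RHS]convA // comm -[RHS]convA //; last exact: finite_fibres_conv.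
  by rewrite mnm.
have [|W' cW' qE] := diagonal_idempotent aG hR dq.
  rewrite {1}/q -convA // -key convA //.
  by rewrite -[conv (conv n _) (unit_indic R W)]convA // conv_unit_indic setIid.
exists W' => a; have := congr1 (fun h => h a) key.
by rewrite conv_unit_indicl qE conv_unit_indicr.
Qed.

(** By [normalizer_sep], a compact open set separating the two ranges would separate the equal
    domains. *)
Lemma normalizer_ran a b : m a <> 0 -> m b <> 0 -> gdom a = gdom b -> gran a =
  gran b.
Proof.
move=> ma mb ab; apply: contrapT => /(compact_open_sep (af_obj aG) (af_base aG)).
move=> [W [cW Wa nWb]]; have [W' WW] := normalizer_sep cW.
have := WW a; rewrite indic_eq1 // mul1r ab => ea.
have := WW b; rewrite indic_eq0 // mul0r => eb.
have [W'b|W'b] := pselect (W' (gdom b)).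
  by apply: mb; rewrite eb indic_eq1 // mulr1.
by apply: ma; rewrite ea indic_eq0 // mulr0.
Qed.

(** Mirror image of [normalizer_sep], through [m 1_W = (m 1_W n) m]; that [m 1_W n] is diagonal
    comes from the swapped pair. *)
Lemma normalizer_sep_dom W : compact_open W -> exists W', forall a,
  m a * \1_W (gdom a) = \1_W' (gran a) * m a.
Proof.
move=> cW; case: mn => mnm dmn dnm _; case: nm => _ _ _ dn.
have fW : finite_fibres (unit_indic R W).
  by apply: steinberg_finite_fibres => //; case: (diagonal_unit_indic R aG cW).
have fmW : finite_fibres (conv m (unit_indic R W)) by exact: finite_fibres_conv.
have fnm : finite_fibres (conv n m) by exact: finite_fibres_conv.
have fWn : finite_fibres (conv (unit_indic R W) n) by exact: finite_fibres_conv.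
have comm : conv (conv n m) (unit_indic R W) = conv (unit_indic R W) (conv n m).
  apply/funext => a; rewrite conv_unit_indicr conv_unit_indicl mulrC.
  have [mna|mna] := pselect (conv n m a = 0); first by rewrite mna !mulr0.
  by have [x _ <-] := dnm.2 a mna; rewrite gdom_unit gran_unit.
pose q := conv (conv m (unit_indic R W)) n.
have dq : diagonal q by apply: dn; exact: diagonal_unit_indic.
have fq : finite_fibres q by exact: finite_fibres_conv.
have key : conv m (unit_indic R W) = conv q m.
  rewrite /q -[conv (conv _ n) m]convA // -[RHS]convA // -comm convA //.
  by rewrite [conv m (conv n m)]convA // mnm.
have [|W' cW' qE] := diagonal_idempotent aG hR dq.
  rewrite {2}/q convA // [conv q (conv m _)]convA // -key.
  by rewrite -[conv (conv m _) (unit_indic R W)]convA // conv_unit_indic setIid.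
exists W' => a; have := congr1 (fun h => h a) key.
by rewrite conv_unit_indicr qE conv_unit_indicl.
Qed.

Lemma normalizer_dom a b : m a <> 0 -> m b <> 0 -> gran a = gran b -> gdom a =
  gdom b.
Proof.
move=> ma mb ab; apply: contrapT => /(compact_open_sep (af_obj aG) (af_base aG)).
move=> [W [cW Wa nWb]]; have [W' WW] := normalizer_sep_dom cW.
have := WW a; rewrite indic_eq1 // mulr1 ab => ea.
have := WW b; rewrite indic_eq0 // mulr0 => eb.
have [W'b|W'b] := pselect (W' (gran b)).
  by apply: mb; rewrite eb indic_eq1 // mul1r.
by apply: ma; rewrite ea indic_eq0 // mul0r.
Qed.

(* A second element of the support over [gdom a] persists over a neighbourhood
   of [gdom a]. *)
Lemma normalizer_bisection (P : set (gobj G)) :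
  (forall U : set (gobj G), open U -> U !=set0 -> exists2 x, U x & P x) ->
  (forall a b, m a <> 0 -> m b <> 0 -> gdom a = gdom b -> P (gdom a) -> a = b) ->
  bisection (support m).
Proof.
move=> dP Pm.
have dinj a b : m a <> 0 -> m b <> 0 -> gdom a = gdom b -> a = b.
  move=> ma mb ab; apply: contrapT => nab.
  have [U [V [oU oV Ua Vb UV]]] := hausdorff_sep (af_arr aG) nab.
  have [osm _] := compact_open_support sm.
  have oD : open ((@gdom G @` (U `&` support m)) `&` (@gdom G @` (V `&`
    support m))).
    by apply: openI; apply: (af_dom_open aG); exact: openI.
  have [|x [[a' [Ua' ma'] a'x] [b' [Vb' mb'] b'x]] Px] := dP _ oD.
    exists (gdom a); split; first by exists a.
    by exists b.
  have e : a' = b' by apply: Pm => //; rewrite a'x ?b'x.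
  have : (U `&` V) a' by split=> //; rewrite e.
  by rewrite UV.
split=> a b ma mb; first exact: dinj.
by move=> ab; apply: dinj => //; exact: normalizer_dom.
Qed.
End Normalizers.

(** * Isotropy of the path groupoid *)

Section Isotropy.
Variable E : digraph.
Implicit Types (a b p k : fpath E) (x y z : bpath E) (v : vert E) (e : edge E).

Definition trivial_isotropy x : Prop := forall n : int, arrow_triple (x, n,
  x) -> n = 0.

Lemma trivial_isotropy_Fin x c : val x = Fin c -> trivial_isotropy x.
Proof.
move=> xc n [a [b [y [/= [_ _ ax] [_ _ bx] ->]]]].
move: ax bx; rewrite xc; case: (val y) => // d [e1] [e2].
have := congr1 (@flen E) e1; have := congr1 (@flen E) e2.
by rewrite /flen /= !size_cat; lia.
Qed.

(** An isotropy arrow makes the shifts of [u] by the lengths of its two prefixes agree; aperiodicity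
    forces these lengths to be equal. *)
Lemma trivial_isotropy_Inf x (u : nat -> edge E) : val x = Inf u ->
  (forall i j, (i < j)%N -> exists n, u (i + n)%N <> u (j + n)%N) ->
  trivial_isotropy x.
Proof.
move=> xu ap n [a [b [y [/= [_ _ ax] [_ _ bx] nE]]]].
have [w ab] : exists w : nat -> edge E, forall n, u (flen a + n)%N = w n /\
  u (flen b + n)%N = w n.
  move: ax bx; rewrite xu; case: (val y) => // w [ua] [ub]; exists w => i.
  have := congr1 (@^~ (flen a + i)%N) ua; have := congr1 (@^~ (flen b + i)%N) ub.
  by rewrite /= !ltnNge !leq_addr !addKn /= => -> ->.
case: (ltngtP (flen a) (flen b)) => [lt|lt|e].
- by have [i []] := ap _ _ lt; have [-> ->] := ab i.
- by have [i []] := ap _ _ lt; have [-> ->] := ab i.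
by rewrite nE e subrr.
Qed.

Lemma cylinder_nth a x u : cylinder a x -> val x = Inf u ->
  forall i, (i < flen a)%N -> u i = nth (u 0%N) a.2 i.
Proof.
move=> [y [_ _]] + xu; rewrite xu; case: (val y) => // w [uE] i ia.
have := congr1 (@^~ i) uE; rewrite /= ia => ->.
exact: set_nth_default.
Qed.

Lemma cylinder_agree a x y u w i : cylinder a x -> cylinder a y ->
  val x = Inf u -> val y = Inf w -> (i < flen a)%N -> u i = w i.
Proof.
move=> ax ay xu yw ia; rewrite (cylinder_nth ax xu ia) (cylinder_nth ay yw ia).
exact: set_nth_default.
Qed.

Lemma prefix_cylinder x u n : val x = Inf u ->
  cylinder (src (u 0%N), mkseq u n) x.
Proof.
move=> xu; have [[a ax an]|[a]] := cylinder_take n x; last by rewrite xu.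
suff -> : (src (u 0%N), mkseq u n) = a by [].
rewrite [a]surjective_pairing -(cylinder_start ax) xu /=; congr pair.
apply: (@eq_from_nth _ (u 0%N)); first by rewrite size_mkseq.
move=> i; rewrite size_mkseq => ilt; rewrite nth_mkseq //.
by apply: (cylinder_nth ax xu); rewrite an.
Qed.

Definition no_finite_path p : Prop := forall z, cylinder p z ->
  exists u, val z = Inf u.

Hypothesis condL : condition_L E.

(** Beyond [M] the path has no choice and returns to a vertex; the first return traces a cycle whose
    vertices emit no second edge, against condition (L). *)
Lemma unique_continuation_exit p u (M d : nat) : (0 < d)%N ->
  (forall m, rng (u m) = src (u m.+1)) ->
  (forall m e, (M <= m)%N -> src e = src (u m) -> e = u m) ->
  src (u (M + d)%N) = src (u M) -> False.
Proof.
move=> d0 pu uniq_u per.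
pose w m := src (u (M + m)%N).
have det (i j k : nat) : w i = w j -> w (i + k)%N = w (j + k)%N.
  move=> ij; elim: k => [|k IH]; first by rewrite !addn0.
  have uu : u (M + (i + k))%N = u (M + (j + k))%N.
    by apply: uniq_u => //; lia.
  by rewrite /w !addnS -!pu uu.
have ex : exists t, (0 < t)%N && (w t == w 0%N).
  by exists d; rewrite d0; apply/eqP; rewrite /w addn0.
(* The least return time makes the vertices of the loop distinct, as a simple circuit requires. *)
have [t /andP[t0 /eqP wt] tmin] := ex_minnP ex.
pose c : fpath E := (w 0%N, mkseq (fun i => u (M + i)%N) t).
have srcs : map (@src E) c.2 = mkseq w t by rewrite /c /= /mkseq -map_comp.
have cyc : is_cycle c.
  have fp s i : path_from (w i) (map (fun i => u (M + i)%N) (iota i s)).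
    elim: s i => //= s IH i; split=> //; rewrite pu -addnS; exact: IH.
  have fe s i : last (w i) (map (@rng E) (map (fun i =>
    u (M + i)%N) (iota i s))) = w (i + s)%N.
    elim: s i => [|s IH] i /=; first by rewrite addn0.
    by rewrite pu -addnS (IH i.+1) addSnnS.
  split.
  - exact: fp.
  - by move/(congr1 size); rewrite size_mkseq /=; lia.
  - by rewrite /fend /c /= /mkseq fe.
  rewrite srcs; apply/(uniqP (w 0%N)) => i j; rewrite !inE size_mkseq => it jt.
  rewrite !nth_mkseq //.
  wlog ij : i j it jt / (i < j)%N.
    move=> wl e; case: (ltngtP i j) => // ij; first exact: wl.
    by apply/esym/wl.
  move=> wij; have := det _ _ (t - j)%N wij; rewrite subnKC ?(ltnW jt) // wt => wi.
  have := tmin (i + (t - j))%N; rewrite wi eqxx andbT => /(_ _); lia.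
have [e [e' [/eqP ee' see' ein]]] := condL cyc.
move: ein; rewrite srcs => /mapP[i _ ei]; apply: ee'.
rewrite (uniq_u (M + i)%N e) ?leq_addr //.
by rewrite (uniq_u (M + i)%N e') ?leq_addr // -see'.
Qed.

(** Otherwise every path through [p] has period [j - i] from [i] on. A long enough prefix then
    determines the whole path, so each later vertex emits a single edge, and periodicity closes a
    cycle without exit. *)
Lemma extend_aperiodic p i j : is_fpath p -> no_finite_path p -> (i < j)%N ->
  exists k n, [/\ fend p = k.1, is_fpath (fcat p k) &
    forall z u, cylinder (fcat p k) z -> val z = Inf u ->
      u (i + n)%N <> u (j + n)%N].
Proof.
move=> fp nfp ij; apply: contrapT => nk.
have per z u : cylinder p z -> val z = Inf u -> forall n, u (i + n)%N = u (j + n)%N.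
  move=> pz zu n; apply: contrapT => ne; apply: nk.
  pose q : fpath E := (src (u 0%N), mkseq u (flen p + (j + n).+1)).
  have qz : cylinder q z by exact: prefix_cylinder.
  have lq : flen q = (flen p + (j + n).+1)%N by rewrite /flen size_mkseq.
  have [|k [pk fk] qE] := cylinder_comparable pz qz; first by rewrite lq leq_addr.
  exists k, n; rewrite -qE; split=> //; first exact: cylinder_fpath qz.
  move=> z' u' qz' zu'.
  rewrite (cylinder_agree qz' qz zu' zu) ?lq; last by lia.
  by rewrite (cylinder_agree qz' qz zu' zu) // lq; lia.
have [z pz] := cylinder_nonempty fp; have [u zu] := nfp z pz.
(* Large enough to contain [p] and to pass the index [j], from which on every edge repeats the one
   [j - i] places earlier. *)
pose M := (flen p + j)%N.
pose q : fpath E := (src (u 0%N), mkseq u M).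
have qz : cylinder q z by exact: prefix_cylinder.
have lq : flen q = M by rewrite /flen size_mkseq.
have [|k [pk fk] qE] := cylinder_comparable pz qz; first by rewrite lq leq_addr.
have uniqz z' u' : cylinder q z' -> val z' = Inf u' -> forall m, u' m = u m.
  move=> qz' zu'; have pz' : cylinder p z' by move: qz'; rewrite qE;
    exact: cylinder_fcat.
  elim/ltn_ind=> m IH; have [mM|Mm] := ltnP m M.
    by apply: (cylinder_agree qz' qz zu' zu); rewrite lq.
  have mE : m = (j + (m - j))%N by lia.
  rewrite mE -(per _ _ pz' zu') -(per _ _ pz zu); apply: IH; lia.
have pu m : rng (u m) = src (u m.+1) by have := bpathP z; rewrite zu; exact.
apply: (@unique_continuation_exit p u M (j - i)) => //; first lia.
  (* Another edge [e] leaving this vertex would give a second boundary path through [q], while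
     [uniqz] allows only [u]. *)
  move=> m e Mm em.
  pose r : fpath E := (src (u 0%N), mkseq u m).
  have rz : cylinder r z by exact: prefix_cylinder.
  have rz' : cylinder (src (u 0%N), mkseq u m.+1) z by exact: prefix_cylinder.
  have fr : fend r = src e.
    have : cylinder (fpath_rcons r (u m)) z by rewrite /fpath_rcons /r /= -mkseqS.
    by move=> /cylinder_fpath/is_fpath_rconsP[_ ->].
  have fre : is_fpath (fpath_rcons r e) by apply: is_fpath_rcons;
    first exact: cylinder_fpath rz.
  have [z' rez'] := cylinder_nonempty fre.
  have lr : flen r = m by rewrite /flen size_mkseq.
  have [|k' [qk' _] rE] := cylinder_comparable qz rz; first by rewrite lq lr.
  have qz' : cylinder q z'.
    have : cylinder r z' := cylinder_fpath_rcons rez'.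
    by rewrite rE; exact: cylinder_fcat.
  have pz' : cylinder p z' by move: (qz'); rewrite {1}qE; exact: cylinder_fcat.
  have [u' zu'] := nfp z' pz'.
  rewrite -(uniqz _ _ qz' zu' m) (cylinder_nth rez' zu') /fpath_rcons /flen /= ?size_rcons ?size_mkseq //.
  by rewrite nth_rcons size_mkseq ltnn eqxx.
have per' := per _ _ pz zu.
have -> : (M + (j - i) = j + (M - i))%N by rewrite /M; lia.
by rewrite -per'; congr (src (u _)); rewrite /M; lia.
Qed.

(** A Baire-type argument: unless [U] offers a finite path, a path [p] inside [U] is prolonged
    countably often, the pair [(i, j)] of shifts being treated at the stage numbered by its code. A
    point common to the nested compact cylinders is aperiodic. *)
Lemma trivial_isotropy_dense (U : set (bpath E)) : open U -> U !=set0 ->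
  exists2 x, U x & trivial_isotropy x.
Proof.
move=> oU [x Ux]; have [a [s [ax aU]]] := open_ncylinderP oU Ux.
case: (cylinder_next ax.1) => [[e ex]|[xa _]]; last first.
  by exists x => //; exact: trivial_isotropy_Fin xa.
pose p := fpath_rcons a e; have fp : is_fpath p := cylinder_fpath ex.
have pU : cylinder p `<=` U.
  apply: subset_trans aU; have [_ ae] := is_fpath_rconsP fp.
  rewrite /p fpath_rconsE; apply: (@cylinder_sub_ncylinder _ a (src e,
    [:: e]) s x ae _ _ ax) => //.
  by rewrite -fpath_rconsE.
have [[z [c [pz zc]]]|nfin] := pselect (exists z c, cylinder p z /\ val z = Fin c).
  by exists z; [exact: pU|exact: trivial_isotropy_Fin zc].
have nfp : no_finite_path p.
  move=> z pz; case zc: (val z) => [c|u]; last by exists u.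
  by exfalso; apply: nfin; exists z, c.
pose S (q : fpath E) := is_fpath q /\ exists k, fend p = k.1 /\ q = fcat p k.
have Sp : S p by split=> //; exists (vpath (fend p)); rewrite fcat_size0.
have Snf q : S q -> no_finite_path q.
  by move=> [_ [k [pk ->]]] z /(cylinder_fcat pk)/nfp.
pose good (i j : nat) q := (i < j)%N -> exists n, forall z u, cylinder q z ->
  val z = Inf u ->
  u (i + n)%N <> u (j + n)%N.
have step (c : nat * nat) q : exists q', S q -> S q' /\
  cylinder q' `<=` cylinder q /\ good c.1 c.2 q'.
  have [Sq|nSq] := pselect (S q); last by exists q.
  have [ij|ij] := boolP (c.1 < c.2)%N; last by exists q => _; split=> //;
    split=> // lt; rewrite lt in ij.
  have [k [n [qk fqk h]]] := extend_aperiodic Sq.1 (Snf q Sq) ij.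
  exists (fcat q k) => _; split; last split.
  - split=> //; have [fq [k' [pk' qE]]] := Sq.
    exists (fcat k' k); rewrite fcatA -qE; split=> //.
  - by move=> z; exact: cylinder_fcat.
  - by move=> _; exists n.
have /choice[f fP] : forall cq : (nat * nat) * fpath E, exists q', S cq.2 ->
    S q' /\ cylinder q' `<=` cylinder cq.2 /\ good cq.1.1 cq.1.2 q'.
  by move=> [c q]; exact: step.
(* Numbers coding no pair yield [(0, 0)], for which [good] holds vacuously. *)
pose code (n : nat) : nat * nat := odflt (0,
  0)%N (@choice.unpickle (nat * nat)%type n).
pose fix q n := if n is n'.+1 then f (code n', q n') else p.
have Sq n : S (q n) by elim: n => //= n IH; have [] := fP (code n, q n) IH.
have qsub n : cylinder (q n.+1) `<=` cylinder (q n) by have [_ []] :=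
  fP (code n, q n) (Sq n).
have qmono n l : cylinder (q (n + l)%N) `<=` cylinder (q n).
  elim: l => [|l IH]; first by rewrite addn0.
  by rewrite addnS; apply: subset_trans IH; exact: qsub.
pose F : set_system (bpath E) := fun A => exists n, cylinder (q n) `<=` A.
have FF : ProperFilter F.
  apply: Build_ProperFilter_ex.
    by move=> A [n qA]; have [z qz] := cylinder_nonempty (Sq n).1; exists z;
      exact: qA.
  split; first by exists 0%N.
    move=> A B [n qA] [l qB]; exists (n + l)%N => z qz; split.
      by apply: qA; exact: qmono qz.
    by apply: qB; move: qz; rewrite addnC; exact: qmono.
  by move=> A B AB [n qA]; exists n; exact: subset_trans AB.
have [|z [pz cz]] := @compact_cylinder E p F FF; first by exists 0%N.
have qz n : cylinder (q n) z by apply: cylinder_closed => A Az; apply: cz =>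
  //; exists n.
exists z; first exact: pU.
have [u zu] := nfp z pz; apply: (trivial_isotropy_Inf zu) => i j ij.
have [_ [_ g]] := fP (code (choice.pickle (i, j)), q (choice.pickle (i, j))) (Sq _).
move: g; rewrite /= /code choice.pickleK /= => /(_ ij)[n h]; exists n.
by apply: (h z) => //; have := qz (choice.pickle (i, j)).+1;
  rewrite /= /code choice.pickleK.
Qed.

End Isotropy.

(** * Normalizers of the diagonal over the path groupoid *)

Section PathLocalBisection.
Variables (R : comPzRingType) (E : digraph).
Notation GE := (path_groupoid E).
Hypothesis hR : indecomposable R.

Section Fibre.
Variables m n : garr GE -> R.
Hypotheses (sm : steinberg m) (sn : steinberg n).
Hypotheses (mn : normalizing_pair m n) (nm : normalizing_pair n m).

Let aE := path_groupoid_ample_facts E.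

(** The coefficient of degree [k] of the Laurent polynomial that [f] defines on the arrows from [x]
    to [y]: an arrow with given ends is determined by its degree. *)
Definition fibre_coef (f : garr GE -> R) (y x : bpath E) (k : int) : R :=
  if pselect (arrow_triple (y, k, x)) is left h then f (pmk h) else 0.

Lemma fibre_coefE f (a : parrow E) : fibre_coef f (pran a) (pdom a) (pdeg a) = f a.
Proof.
rewrite /fibre_coef; case: pselect => [h|[]]; last exact: parrowP.
by congr f; exact: parrow_eq.
Qed.

(* The elements of [m] and [n] over [x] are Laurent polynomials inverse to each
   other. *)
Lemma normalizer_fibre a b : reduced R -> m a <> 0 -> m b <> 0 ->
  gdom a = gdom b -> a = b.
Proof.
move=> red ma mb ab; have rab := normalizer_ran hR aE sm sn mn ma mb ab.
apply: parrow_eq => //.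
pose x := pdom a; pose y := pran a.
have fm := steinberg_finite_fibres aE sm; have fn := steinberg_finite_fibres aE sn.
have [s [us sE]] := finite_fibres_seq (x : gobj GE) fm.
have [t [ut tE]] := finite_fibres_seq (y : gobj GE) fn.
have sran c : c \in s -> pran c = y.
  by move=> /sE[cx mc]; exact: (normalizer_ran hR aE sm sn mn mc ma cx).
have coefP f z w k : fibre_coef f z w k <> 0 ->
    exists c : parrow E, [/\ pran c = z, pdeg c = k, pdom c = w & f c <> 0].
  by rewrite /fibre_coef; case: pselect => // h fh; exists (pmk h).
have [B cB nmB] := normalizer_dom_unit hR aE sm sn mn.
have Bx : B x.
  apply: (@indic_neq0 R) => e; apply: ma; case: mn => mnm _ _ _.
  by rewrite -mnm -convA // nmB conv_unit_indicr e mulr0.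
apply: (@laurent_unit R red (fibre_coef m y x) (fibre_coef n x y) [seq pdeg c | c <- s]
  [seq pdeg c | c <- t] hR).
- rewrite map_inj_in_uniq // => c c' cs c's e; apply: parrow_eq => //.
    by rewrite !sran.
  exact: (etrans ((sE c).1 cs).1 (esym ((sE c').1 c's).1)).
- move=> k /coefP[c [_ <- cx mc]]; apply/mapP; exists c => //.
  by apply/sE.
- move=> k /coefP[c [_ <- cx mc]]; apply/mapP; exists c => //.
  by apply/tE.
- move=> l; rewrite big_map.
  (* A degree [l] without isotropy arrow at [x] is nonzero, and no term contributes, since its two
     factors would compose to such an arrow. *)
  have [h|nh] := pselect (arrow_triple (x, l, x)); last first.
    have l0 : l <> 0 by move=> e; apply: nh; rewrite e; exact: arrow_triple_unit.
    case: eqP => // _; rewrite big_seq big1 // => c cs; apply: contrapT => n0.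
    have [d [dx dk dy _]] : exists d : parrow E, [/\ pran d = x, pdeg d =
      l - pdeg c, pdom d = y & n d <> 0].
      by apply: coefP => e; apply: n0; rewrite e mul0r.
    apply: nh; have := @arrow_triple_mul E x y x (pdeg d) (pdeg c).
    rewrite dk subrK; apply; first by rewrite -dx -dy -dk; exact: parrowP.
    have [<- _] := (sE c).1 cs; rewrite -(sran c cs); exact: parrowP.
  pose g : garr GE := pmk h.
  transitivity (conv n m g).
    rewrite (@conv_seq _ _ _ _ _ s) //; first last.
    - move=> c cg n0; apply/sE; split=> // m0; apply: n0.
      by rewrite m0 mulr0.
    - by move=> c /sE[].
    apply: eq_big_seq => c cs; have [cx mc] := (sE c).1 cs.
    have gc : pdom g = pran (pinv c) by exact: (esym cx).
    have <- : fibre_coef n x y (l - pdeg c) = n (pmul g (pinv c)).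
      rewrite -fibre_coefE; congr (fibre_coef n).
      + by rewrite pran_mul.
      + by rewrite pdom_mul // -(sran c cs).
      + by rewrite pdeg_mul.
    by rewrite -(fibre_coefE m c) (sran c cs) (cx : pdom c = x).
  rewrite nmB; case: eqP => [l0|l0].
    have -> : g = @gunit GE x by apply: parrow_eq.
    by rewrite unit_indicE indic_eq1.
  apply: contrapT => n0; have [z _ zg] := support_unit_indic n0.
  by apply: l0; have := congr1 (@pdeg E) zg.
- by rewrite fibre_coefE.
have -> : y = pran b by exact: rab.
by rewrite /x (ab : pdom a = pdom b) fibre_coefE.
Qed.

End Fibre.

(** For [R] reduced the Laurent argument works over every unit. Under condition (L) it suffices to
    test the dense set of units with trivial isotropy: two arrows [a], [b] of the support over such
    a unit have the same ends, and the isotropy arrow [b^-1 a] has degree 0. *)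
Lemma path_local_bisection : reduced R \/ condition_L E ->
  local_bisection_hypothesis R GE.
Proof.
move=> hRE m n sm sn mn nm; have aE := path_groupoid_ample_facts E.
case: hRE => [red|cL].
  apply: (@normalizer_bisection R GE hR aE m n sm sn mn nm setT) =>
    [U _ [x Ux]|a b ma mb ab _].
    by exists x.
  exact: (normalizer_fibre sm sn mn red).
apply: (@normalizer_bisection R GE hR aE m n sm sn mn nm (@trivial_isotropy E)).
  exact: trivial_isotropy_dense.
move=> a b ma mb ab ta; have rab := normalizer_ran hR aE sm sn mn ma mb ab.
apply: parrow_eq => //; apply/eqP; rewrite -subr_eq0; apply/eqP; apply: ta.
rewrite addrC; apply: (@arrow_triple_mul E _ (pran b)).
  rewrite [gdom a]ab; exact: (parrowP (pinv b)).
rewrite -(rab : pran a = pran b); exact: parrowP.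
Qed.

End PathLocalBisection.

(** * Isomorphisms of groupoids and of algebras *)

Lemma farr_inv (G H : groupoid) (p : gfunctor G H) a :
  farr p (ginv a) = ginv (farr p a).
Proof.
apply: (@gmul_injl H (farr p a)).
- by rewrite fdom fran gran_inv.
- by rewrite gran_inv.
- by rewrite gmulV -fmul ?gran_inv // gmulV funit fran.
Qed.

(** * Transport of functions along an isomorphism of groupoids *)

Section Pullback.
Variables (R : comPzRingType) (G H : groupoid).
Variables (p : gfunctor G H) (q : gfunctor H G).
Hypotheses (pc : continuous (farr p)) (qc : continuous (farr q)).
Hypotheses (pK : cancel (farr p) (farr q)) (qK : cancel (farr q) (farr p)).
Hypotheses (pOK : cancel (fobj p) (fobj q)) (qOK : cancel (fobj q) (fobj p)).
Implicit Types f g : garr G -> R.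

Lemma steinberg_pullback f : steinberg f -> steinberg (f \o farr q).
Proof.
move=> /steinbergP[lf cf]; apply/steinbergP; split.
  by move=> a; exact: (@qc a _ (lf (farr q a))).
rewrite (_ : support _ = farr p @` support f).
  by apply: continuous_compact => //; exact: continuous_subspaceT.
apply/seteqP; split=> [b fb|_ [a fa <-]]; first by exists (farr q b).
by rewrite /support /= pK.
Qed.

Lemma conv_pullback f g : conv f g \o farr q = conv (f \o farr q) (g \o farr q).
Proof.
apply/funext => c; rewrite /conv /=.
rewrite (reindex_fsbig (farr q) [set a | gdom a = gdom c]); last first.
  split=> [a ac|a b _ _ e|a /= ac]; first by rewrite /= !fdom ac.
    exact: (can_inj qK e).
  exists (farr p a) => //=; apply: (can_inj qOK).
  by rewrite -!fdom pK.
apply: eq_fsbigr => a; rewrite inE /= => ac.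
by rewrite fmul ?gran_inv // farr_inv.
Qed.

Lemma pullback_diagonal f : diagonal f -> diagonal (f \o farr q).
Proof.
move=> [sf df]; split; first exact: steinberg_pullback.
move=> b fb; have [x _ xb] := df _ fb; exists (fobj p x) => //.
by rewrite -funit xb qK.
Qed.

End Pullback.

Section Equivalence.
Variables (R : comPzRingType) (E : digraph) (G : groupoid).
Notation GE := (path_groupoid E).

Lemma alg_iso_of_groupoid_iso (p : gfunctor GE G) : groupoid_iso p ->
  exists Phi : lpa R E -> garr G -> R, [/\ alg_iso Phi, diagonal_preserving Phi &
    forall c, (forall a, c (farr p a) = pdeg a) -> graded_iso c Phi].
Proof.
move=> [_ [pc [q [_ qc [pOK qOK] pK qK]]]].
pose Phi (x : lpa R E) := ev x \o farr q.
have back (f : garr G -> R) : (f \o farr p) \o farr q = f.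
  by apply/funext => b /=; rewrite qK.
have PhiI x y : Phi x = Phi y -> x = y.
  move=> e; apply: ev_inj; apply/funext => a.
  by have := congr1 (fun f => f (farr p a)) e; rewrite /Phi /= pK.
have surj f : steinberg f -> exists2 x, Phi x = f & ev x = f \o farr p.
  move=> sf; have [x xE] := ev_surj (steinberg_pullback qc pc qK pK sf).
  by exists x => //; rewrite /Phi xE back.
exists Phi; split.
- split; last by move=> r x b; rewrite /Phi /= evZ.
  split.
  + split=> [x _|x y _ _|f sf];
    first exact: (steinberg_pullback pc qc pK qK (steinberg_ev x)).
      exact: PhiI.
    by have [x xf _] := surj f sf; exists x.
  + by move=> x y; rewrite /Phi evD.
  + move=> x y; rewrite /Phi evM.
    exact: (conv_pullback pK qK qOK).
- apply/seteqP; split=> [_ [x dx <-]|f df].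
    exact: (pullback_diagonal pc qc pK qK dx).
  have [x xf xE] := surj f df.1; exists x => //.
  rewrite /lpa_diagonal /preimage /= -/(ev x) xE.
  exact: (pullback_diagonal qc pc qK pK df).
move=> c cp k; apply/seteqP; split=> [_ [x [sx dx] <-]|f [sf df]].
  split; first exact: (steinberg_pullback pc qc pK qK sx).
  by move=> b xb; rewrite /preimage /= -(qK b) cp; exact: dx.
have [x xf xE] := surj f sf; exists x => //.
rewrite /lpa_homogeneous /preimage /= -/(ev x) xE; split.
  exact: (steinberg_pullback qc pc qK pK sf).
by move=> a fa; have := df _ fa; rewrite /preimage /= cp.
Qed.

Lemma groupoid_iso_of_ring_iso (Phi : lpa R E -> garr G -> R) :
  indecomposable R -> reduced R \/ condition_L E -> ample_facts G ->
  ring_iso Phi -> diagonal_preserving Phi ->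
  exists p : gfunctor GE G, groupoid_iso p /\
    forall c : garr G -> int, (forall k, open (c @^-1` [set k])) ->
      graded_iso c Phi ->
      forall a, c (farr p a) = pdeg a.
Proof.
move=> hR hRE aG [[PhiS PhiI PhiT] PhiD PhiM] dPhi.
have {}PhiI x y : Phi x = Phi y -> x = y by move=> e; apply: PhiI; rewrite ?inE.
have {}PhiS x : steinberg (Phi x) by exact: PhiS.
(* The partial inverses get the value 0 outside the image, so that [T] and [S] become maps on all
   functions. *)
pose inv f := if pselect (exists x, Phi x = f) is left h then sval (cid h) else 0.
have invK f : steinberg f -> Phi (inv f) = f.
  move=> /PhiT[x _ xf]; rewrite /inv; case: pselect => [h|[]]; last by exists x.
  by case: cid.
have invE x : inv (Phi x) = x by apply: PhiI; rewrite invK.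
pose evinv f := if pselect (exists x : lpa R E, ev x =
  f) is left h then sval (cid h) else 0.
have evinvK f : steinberg f -> ev (evinv f) = f.
  move=> /ev_surj[x xf]; rewrite /evinv; case: pselect => [h|[]]; last by exists x.
  by case: cid.
have evinvE x : evinv (ev x) = x.
  by apply: ev_inj; rewrite evinvK //; exact: steinberg_ev.
pose T f := ev (inv f); pose S f := Phi (evinv f).
have aE := path_groupoid_ample_facts E.
(* Closure under convolution is inherited from the Leavitt algebra through the surjectivity of
   [Phi]. *)
have cG (f g : garr G -> R) : steinberg f -> steinberg g -> steinberg (conv f g).
  by move=> sf sg; rewrite -(invK f sf) -(invK g sg) -PhiM.
have sev x := @steinberg_ev R E x.
have hT : steinberg_morphism T.
  split=> [f sf|f g sf sg|f g sf sg|f df]; first exact: sev.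
  - rewrite -evD; congr ev; apply: PhiI; rewrite PhiD !invK //.
    exact: steinbergD.
  - rewrite -evM; congr ev; apply: PhiI; rewrite PhiM !invK //.
    exact: cG.
  - have : (Phi @` @lpa_diagonal R E) f by rewrite [_ @` _]dPhi.
    by move=> [x dx <-]; rewrite /T invE.
have hS : steinberg_morphism S.
  split=> [f sf|f g sf sg|f g sf sg|f df]; first exact: PhiS.
  - transitivity (Phi (evinv f + evinv g)); last exact: PhiD.
    congr Phi; apply: ev_inj; rewrite evinvK ?evD ?evinvK //.
    exact: steinbergD.
  - transitivity (Phi (lpa_mul (evinv f) (evinv g))); last exact: PhiM.
    congr Phi; apply: ev_inj; rewrite evinvK ?evM ?evinvK //.
    by rewrite -(evinvK f sf) -(evinvK g sg) -evM; exact: sev.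
  - have <- : (Phi @` @lpa_diagonal R E) = @diagonal R G := dPhi.
    exists (evinv f) => //; rewrite /lpa_diagonal /preimage /= -/(ev _) evinvK //.
    exact: df.1.
have TK f : steinberg f -> S (T f) = f by move=> sf; rewrite /S /T evinvE invK.
have SK f : steinberg f -> T (S f) = f by move=> sf; rewrite /S /T invE evinvK.
have [p [pi pV]] := reconstruction hR aE aG (path_local_bisection hR hRE) hT hS TK SK cG.
exists p; split=> // c oc gc a.
(* A bisection around the image of [a] inside one set of constant degree: its indicator is
   homogeneous, so [T] of it, which is nonzero at [a], is supported in that degree. *)
have [V [cV bV Vb Vk]] := af_bisection aG (oc (c (farr p a))) (erefl :
  (c @^-1` [set c (farr p a)]) (farr p a)).
have coV : co_bisection V by split.
have hV : homogeneous c (c (farr p a)) (\1_V : garr G -> R).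
  split; first by apply: steinberg_indic => //; exact: af_arr.
  by move=> b n0; apply: Vk; exact: indic_neq0 n0.
move: hV; rewrite -(gc (c (farr p a))) => -[x [_ dx] xV].
have Ta : T (\1_V) a <> 0 by apply/pV.
by apply/esym/dx; move: Ta; rewrite -xV /T invE.
Qed.

End Equivalence.

Theorem theorem6p1 (R : comPzRingType) (E : digraph)
  (hR : indecomposable R) (hRE : reduced R \/ condition_L E) :
  (forall G : groupoid, ample G -> hausdorff_groupoid G ->
    [<-> exists phi : gfunctor (path_groupoid E) G, groupoid_iso phi;
         exists Phi : lpa R E -> garr G -> R,
           alg_iso Phi /\ diagonal_preserving Phi;
         exists Phi : lpa R E -> garr G -> R,
           ring_iso Phi /\ diagonal_preserving Phi]) /\
  (forall (G : groupoid) (c : garr G -> int),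
    ample G -> hausdorff_groupoid G -> cocycle c ->
    [<-> exists phi : gfunctor (path_groupoid E) G,
           groupoid_iso phi /\ forall a, c (farr phi a) = pdeg a;
         exists Phi : lpa R E -> garr G -> R,
           [/\ alg_iso Phi, diagonal_preserving Phi & graded_iso c Phi];
         exists Phi : lpa R E -> garr G -> R,
           [/\ ring_iso Phi, diagonal_preserving Phi & graded_iso c Phi]]).
Proof.
split=> [G aG hG|G c aG hG [oc _]].
  have afG := ample_ample_facts aG hG; tfae.
  - by move=> [p /(@alg_iso_of_groupoid_iso R)[Phi [? ? _]]]; exists Phi.
  - by move=> [Phi [[? _] ?]]; exists Phi.
  move=> [Phi [rPhi dPhi]].
  by have [p [pi _]] := groupoid_iso_of_ring_iso hR hRE afG rPhi dPhi; exists p.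
have afG := ample_ample_facts aG hG; tfae.
- move=> [p [/(@alg_iso_of_groupoid_iso R)[Phi [? ? gPhi]] cp]].
  by exists Phi; split=> //; exact: gPhi.
- by move=> [Phi [[? _] ? ?]]; exists Phi.
move=> [Phi [rPhi dPhi gPhi]].
have [p [pi pg]] := groupoid_iso_of_ring_iso hR hRE afG rPhi dPhi.
by exists p; split=> //; exact: pg.
Qed.
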